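(* Let $r\ge1$, $s\ge0$ be integers, $\alpha_1,\ldots,\alpha_r\in\mathbb{C}$, $\beta_1,\ldots,\beta_s\in\mathbb{C}\setminus\mathbb{Z}_{\le0}$, $x\ge0$, $p\ge 0$ (with $\Re(\alpha_1)>0$ in case $p=x=0$), $t\in\mathbb{C}$ with $|t|<1$, $\lambda\in\mathbb{C}$, $N\in\mathbb{N}=\{1,2,\ldots\}$ and $z\in\mathbb{C}$. Then $$\sum_{n=0}^{\infty}\frac{(\lambda)_{n}}{n!}\;{}_{r+N}\Gamma_{s}\left[\begin{array}{r}\Delta(N;\lambda+n),(\alpha_{1},x;p),\alpha_{2},\ldots,\alpha_{r};\\ \beta_{1},\ldots,\beta_{s};\end{array} z\right]t^{n}=(1-t)^{-\lambda}\;{}_{r+N}\Gamma_{s}\left[\begin{array}{r}\Delta(N;\lambda),(\alpha_{1},x;p),\alpha_{2},\ldots,\alpha_{r};\\ \beta_{1},\ldots,\beta_{s};\end{array}\frac{z}{(1-t)^{N}}\right],$$ provided that each member of this equation exists.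
   Context: Generalized incomplete Gamma function: $\Gamma(\nu,x;p):=\int_x^\infty u^{\nu-1}e^{-u-p/u}\,du$. Extended incomplete Pochhammer symbol: $[\lambda;x,p]_\nu:=\Gamma(\lambda+\nu,x;p)/\Gamma(\lambda)$, where $1/\Gamma(\lambda)$ is read as $0$ for $\lambda\in\mathbb{Z}_{\le0}$. Ordinary Pochhammer symbol: $(\lambda)_0=1$, $(\lambda)_n=\lambda(\lambda+1)\cdots(\lambda+n-1)$. $\Delta(N;\lambda)$ denotes the array of $N$ parameters $\frac{\lambda}{N},\frac{\lambda+1}{N},\ldots,\frac{\lambda+N-1}{N}$. Extended incomplete generalized hypergeometric function (when the series converges): for numerator parameters $a_1,\ldots,a_k$ listed together with the incomplete parameter $(\alpha_1,x;p)$ and $\alpha_2,\ldots,\alpha_r$ (the order of numerator parameters is irrelevant), $${}_{r+k}\Gamma_{s}\left[\begin{array}{r}a_1,\ldots,a_k,(\alpha_{1},x;p),\alpha_{2},\ldots,\alpha_{r};\\ \beta_{1},\ldots,\beta_{s};\end{array} z\right]:=\sum_{m=0}^{\infty}\frac{(a_1)_m\cdots(a_k)_m\,[\alpha_{1};x,p]_{m}(\alpha_{2})_{m}\cdots(\alpha_{r})_{m}}{(\beta_{1})_{m}\cdots(\beta_{s})_{m}}\frac{z^{m}}{m!}.$$ $(1-t)^{-\lambda}$ is the principal branch. ''Each member exists'' means that all the series involved (the inner hypergeometric series for every $n$, the sum over $n$, and the series on the right) converge. *)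

(* Defs.v *)
From Stdlib Require Import Reals List Factorial ClassicalEpsilon.
From Coquelicot Require Import Coquelicot.
Import ListNotations.
Open Scope R_scope.
Open Scope C_scope.

Definition natC (n : nat) : C := RtoC (INR n).

Definition nonpos_int (z : C) : Prop := exists k : nat, z = - natC k.

Definition Cexp (z : C) : C :=
  RtoC (exp (Re z)) * (cos (Im z), sin (Im z)).

(** Principal argument, with values in (-PI, PI] for [z <> 0]. *)
Definition Carg (z : C) : R :=
  if Rle_dec 0 (Im z) then acos (Re z / Cmod z) else (- acos (Re z / Cmod z))%R.

Definition Clog (z : C) : C := (ln (Cmod z), Carg z).

(** Principal branch of [z ^ a], for [z <> 0]. *)
Definition Cpower (z a : C) : C := Cexp (a * Clog z).

(** As with Coquelicot's other total operators, the value is meaningful only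
    when the series converges ([ex_series a]). *)
Definition CSeries (a : nat -> C) : C :=
  iota (T := C_CompleteNormedModule) (fun l : C => is_series a l).

(** The generalized incomplete Gamma function
      Gamma(nu, x; p) = int_x^oo u^(nu-1) exp(-u-p/u) du.
    The lower limit is approached from the right, so that the integral is also
    improper at [0] when [x = 0]. *)
Definition iGamma (nu : C) (x p : R) : C :=
  RInt_gen (V := C_R_CompleteNormedModule)
    (fun u : R => Cpower (RtoC u) (nu - 1) * RtoC (exp (- u - p / u)))
    (at_right x) (Rbar_locally p_infty).

Fixpoint poch (a : C) (n : nat) : C :=
  match n with
  | O => 1
  | S k => poch a k * (a + natC k)
  end.

(** Euler's Gamma function: Euler's integral Gamma(z, 0; 0) for [0 < Re z],
    continued to the complement of the nonpositive integers by
    Gamma(z) = Gamma(z + k) / (z)_k, where [k] is chosen such that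
    [0 < Re (z + k)] ([k = 0] if already [0 < Re z]). *)
Definition CGamma (z : C) : C :=
  let k := Z.to_nat (up (- Re z)) in
  iGamma (z + natC k) 0 0 / poch z k.

(** [1 / CGamma z], read as [0] at the poles. *)
Definition rGamma (z : C) : C :=
  if excluded_middle_informative (nonpos_int z) then 0 else / CGamma z.

(** The extended incomplete Pochhammer symbol [lambda; x, p]_nu. *)
Definition ipoch (lambda : C) (x p : R) (nu : C) : C :=
  iGamma (lambda + nu) x p * rGamma lambda.

Definition poch_prod (l : list C) (m : nat) : C :=
  fold_right Cmult 1 (map (fun a => poch a m) l).

(** [Delta_array N lambda] is lambda/N, (lambda+1)/N, ..., (lambda+N-1)/N. *)
Definition Delta_array (N : nat) (lambda : C) : list C :=
  map (fun j => (lambda + natC j) / natC N) (seq 0 N).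

(** General term of the extended incomplete generalized hypergeometric series
    with numerator parameters [a], (alpha1, x; p), [alpha] and denominator
    parameters [beta]. *)
Definition hypGamma_term (a : list C) (alpha1 : C) (x p : R)
    (alpha beta : list C) (z : C) (m : nat) : C :=
  poch_prod a m * ipoch alpha1 x p (natC m) * poch_prod alpha m
  / poch_prod beta m * (Cpow z m / natC (fact m)).

Definition ex_hypGamma (a : list C) (alpha1 : C) (x p : R)
    (alpha beta : list C) (z : C) : Prop :=
  ex_series (hypGamma_term a alpha1 x p alpha beta z).

Definition hypGamma (a : list C) (alpha1 : C) (x p : R)
    (alpha beta : list C) (z : C) : C :=
  CSeries (hypGamma_term a alpha1 x p alpha beta z).

(* Main.v *)
(* Let B_m be the general term of the series on the right at z (instead of w), and
   mu_m = lambda + N m.  Since (lambda)_n (lambda + n)_{Nm} = (lambda)_{Nm} (mu_m)_n, the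
   left-hand side is the power series sum_n e_n t^n / n! with e_n = sum_m B_m (mu_m)_n, and
   the right-hand side is F(t) = sum_m B_m (1 - t)^(- mu_m); formally they agree by the
   binomial series.  The double series need not converge absolutely at t, although every
   iterated sum exists, so the identity is continued analytically from 0.

   The B_m decay geometrically: up to powers of m, the Pochhammer symbols and
   Gamma(alpha_1 + m, x; p) are m!, so |B_m| is (m!)^(P - Q) |z|^m, and convergence of the
   inner series for every n makes B_m smaller than every power of m, which excludes the
   boundary of the disc of convergence.  Hence F is analytic where |1 - t| is large enough,
   in particular near 0.  Both sides are re-expanded in Taylor series along a polygon that
   stays in the lune |c| < |t|, |1 - c| > |1 - t| (or |1 - c| >= 1) and ends near t.
   Finally t is reached along a direction that is non-tangential for both circles, where
   Abel's limit theorem applies to both series; for t <= 0 no such direction exists, but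
   then F is continuous at t by dominated convergence. *)
Require Import Defs.
From Stdlib Require Import Reals List Factorial.
From Stdlib Require Import Arith ZArith Lra Lia Psatz ClassicalEpsilon FunctionalExtensionality.
From Coquelicot Require Import Coquelicot.
Open Scope R_scope.
Open Scope C_scope.

(** * Series of complex numbers *)

(** Absolute convergence of the double series is governed by sum_m |B_m| (1 - |t|)^(- N m), while
    the hypotheses control only |1 - t|^(- N m). If W is a radius of convergence of sum_m B_m v^m,
    then F is analytic where W |1 - c|^N > 1. The decay of B_m gives W > 1 and so places 0 inside
    this region; convergence at t gives only W |1 - t|^N >= 1, so t may lie on its boundary as well
    as on the circle of convergence of the left-hand side. Continuation works with explicit series
    for all derivatives of both sides ([power_jet], [shifted_jet]): equality of the whole sequence
    of derivatives at one point is carried to the next by Taylor's formula, with a step length that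
    is uniform along the path. The path avoids the straight segment from 0 to the target tau because
    |1 - c| is convex along it and can drop below both end values, out of the region; the detour
    through - |tau| excludes this. *)

Definition cvgC (u : nat -> C) (l : C) : Prop :=
  forall eps : R, (0 < eps)%R ->
    exists N, forall n, (N <= n)%nat -> (Cmod (u n - l) < eps)%R.

Lemma is_series_cvgC (a : nat -> C) (l : C) :
  is_series a l <-> cvgC (sum_n a) l.
Proof.
  split.
  - intros H eps Heps.
    assert (Hl : locally l (fun y : C => (Cmod (y - l) < eps)%R)).
    { apply (locally_le_locally_norm (V := C_NormedModule)).
      exists (mkposreal _ Heps). intros y Hy. exact Hy. }
    destruct (H _ Hl) as [N HN]. now exists N.
  - intros H P HP.
    apply (locally_norm_le_locally (V := C_NormedModule)) in HP.
    destruct HP as [eps He].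
    destruct (H eps (cond_pos eps)) as [N HN].
    exists N. intros n Hn. apply He. exact (HN n Hn).
Qed.

Lemma CSeries_unique (a : nat -> C) (l : C) : is_series a l -> CSeries a = l.
Proof.
  intros H. unfold CSeries.
  apply (iota_unique (V := C_CompleteNormedModule)); [|exact H].
  intros y Hy.
  exact (filterlim_locally_unique (V := C_NormedModule) _ _ _ Hy H).
Qed.

Lemma CSeries_correct (a : nat -> C) : ex_series a -> is_series a (CSeries a).
Proof. intros [l Hl]. now rewrite (CSeries_unique a l Hl). Qed.

Lemma csum_O (a : nat -> C) : sum_n a 0 = a 0%nat :> C.
Proof. exact (sum_O a). Qed.

Lemma csum_S (a : nat -> C) n : sum_n a (S n) = sum_n a n + a (S n) :> C.
Proof. exact (sum_Sn a n). Qed.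

Lemma rsum_O (a : nat -> R) : sum_n a 0 = a 0%nat :> R.
Proof. exact (sum_O a). Qed.

Lemma rsum_S (a : nat -> R) n : sum_n a (S n) = (sum_n a n + a (S n))%R :> R.
Proof. exact (sum_Sn a n). Qed.

Lemma csum_ext (a b : nat -> C) n :
  (forall k, (k <= n)%nat -> a k = b k) -> sum_n a n = sum_n b n :> C.
Proof. exact (sum_n_ext_loc a b n). Qed.

Lemma csum_mult_l (c : C) (a : nat -> C) n :
  sum_n (fun k => c * a k) n = c * sum_n a n :> C.
Proof.
  induction n; [now rewrite !csum_O|]. rewrite !csum_S, IHn. ring.
Qed.

Lemma Cmod_csum (a : nat -> C) n :
  (Cmod (sum_n a n) <= sum_n (fun k => Cmod (a k)) n)%R.
Proof.
  induction n; [rewrite csum_O, rsum_O; lra|].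
  rewrite csum_S, rsum_S. pose proof (Cmod_triangle (sum_n a n) (a (S n))). lra.
Qed.

Lemma rsum_le (a b : nat -> R) n :
  (forall k, (k <= n)%nat -> (a k <= b k)%R) -> (sum_n a n <= sum_n b n)%R.
Proof.
  induction n; intros H; [rewrite !rsum_O; auto|].
  rewrite !rsum_S. apply Rplus_le_compat; auto.
Qed.

Lemma rsum_mult_l (c : R) (a : nat -> R) n :
  sum_n (fun k => (c * a k)%R) n = (c * sum_n a n)%R :> R.
Proof. induction n; [now rewrite !rsum_O|]. rewrite !rsum_S, IHn. ring. Qed.

Lemma is_series_cmult_l (c : C) (a : nat -> C) (l : C) :
  is_series a l -> is_series (fun n => c * a n) (c * l).
Proof. exact (@is_series_scal _ C_NormedModule c a l). Qed.

Lemma is_series_cplus (a b : nat -> C) (la lb : C) :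
  is_series a la -> is_series b lb -> is_series (fun n => a n + b n) (la + lb).
Proof. exact (@is_series_plus _ C_NormedModule a b la lb). Qed.

Lemma is_series_cext (a b : nat -> C) (l : C) :
  (forall n, a n = b n) -> is_series a l -> is_series b l.
Proof. exact (@is_series_ext _ C_NormedModule a b l). Qed.

Lemma is_series_cunique (a : nat -> C) (l l' : C) :
  is_series a l -> is_series a l' -> l = l'.
Proof.
  intros H H'. rewrite <- (CSeries_unique _ _ H). now apply CSeries_unique.
Qed.

Lemma ex_series_cmod_le (a : nat -> C) (M : nat -> R) :
  (forall n, (Cmod (a n) <= M n)%R) -> ex_series M -> ex_series a.
Proof. exact (@ex_series_le _ C_CompleteNormedModule a M). Qed.

Lemma cvgC_unique (u : nat -> C) (l l' : C) : cvgC u l -> cvgC u l' -> l = l'.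
Proof.
  intros H H'. destruct (Req_dec (Cmod (l - l')) 0) as [E|E].
  { apply Cmod_eq_0 in E. replace l with (l - l' + l') by ring. rewrite E. ring. }
  pose proof (Cmod_ge_0 (l - l')).
  assert (He : (0 < Cmod (l - l') / 2)%R) by lra.
  destruct (H _ He) as [N HN], (H' _ He) as [N' HN'].
  specialize (HN (max N N') ltac:(lia)). specialize (HN' (max N N') ltac:(lia)).
  pose proof (Cmod_triangle (l - u (max N N')) (u (max N N') - l')).
  replace (l - u (max N N') + (u (max N N') - l')) with (l - l') in H1 by ring.
  replace (l - u (max N N')) with (- (u (max N N') - l)) in H1 by ring.
  rewrite Cmod_opp in H1. lra.
Qed.

Lemma cvgC_ext (u v : nat -> C) l : (forall n, u n = v n) -> cvgC u l -> cvgC v l.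
Proof.
  intros E H eps He. destruct (H eps He) as [N HN]. exists N. intros n Hn.
  rewrite <- E. auto.
Qed.

Lemma cvgC_mult (u v : nat -> C) l l' :
  cvgC u l -> cvgC v l' -> cvgC (fun n => u n * v n) (l * l').
Proof.
  intros H H' eps He.
  set (K := (Cmod l + Cmod l' + 1)%R).
  pose proof (Cmod_ge_0 l). pose proof (Cmod_ge_0 l').
  assert (HK : (0 < K)%R) by (unfold K; lra).
  set (d := Rmin 1 (eps / (2 * K))).
  assert (Hd : (0 < d)%R).
  { apply Rmin_pos; [lra|]. apply Rdiv_lt_0_compat; lra. }
  assert (Hd1 : (d <= 1)%R) by apply Rmin_l.
  assert (Hd2 : (d * (2 * K) <= eps)%R).
  { replace eps with (eps / (2 * K) * (2 * K))%R by (field; lra).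
    apply Rmult_le_compat_r; [lra|]. apply Rmin_r. }
  destruct (H d Hd) as [N HN], (H' d Hd) as [N' HN'].
  exists (max N N'). intros n Hn.
  specialize (HN n ltac:(lia)). specialize (HN' n ltac:(lia)).
  replace (u n * v n - l * l')
    with ((u n - l) * (v n - l') + ((u n - l) * l' + l * (v n - l'))) by ring.
  eapply Rle_lt_trans; [apply Cmod_triangle|].
  eapply Rle_lt_trans; [apply Rplus_le_compat_l, Cmod_triangle|].
  rewrite !Cmod_mult.
  pose proof (Cmod_ge_0 (u n - l)). pose proof (Cmod_ge_0 (v n - l')).
  unfold K in *. nra.
Qed.

Lemma is_series_partial_le (M : nat -> R) S n :
  (forall k, (0 <= M k)%R) -> is_series M S -> (sum_n M n <= S)%R.
Proof.
  intros HM HS.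
  apply (is_lim_seq_incr_compare (sum_n M) S); [exact HS|].
  intros k. rewrite rsum_S. specialize (HM (Datatypes.S k)). lra.
Qed.

(** For finite sections this is the triangle inequality, and the bound survives the limit because S
    dominates every partial sum of M. It makes tails uniformly small in Tannery's theorem. *)
Lemma csum_tail_le (a : nat -> C) (M : nat -> R) S l P :
  (forall n, (Cmod (a n) <= M n)%R) -> is_series M S -> is_series a l ->
  (Cmod (l - sum_n a P) <= S - sum_n M P)%R.
Proof.
  intros HaM HS Hl.
  assert (HM : forall k, (0 <= M k)%R)
    by (intros k; eapply Rle_trans; [apply Cmod_ge_0|apply HaM]).
  assert (Hfin : forall n, (P <= n)%nat ->
    (Cmod (sum_n a n - sum_n a P) <= sum_n M n - sum_n M P)%R).
  { intros n Hn. induction Hn.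
    - replace (sum_n a P - sum_n a P) with (RtoC 0) by ring. rewrite Cmod_0. lra.
    - rewrite csum_S, rsum_S.
      replace (sum_n a m + a (Datatypes.S m) - sum_n a P)
        with ((sum_n a m - sum_n a P) + a (Datatypes.S m)) by ring.
      pose proof (Cmod_triangle (sum_n a m - sum_n a P) (a (Datatypes.S m))).
      pose proof (HaM (Datatypes.S m)). lra. }
  apply le_epsilon. intros eps He.
  apply is_series_cvgC in Hl. destruct (Hl eps He) as [N HN].
  specialize (HN (max N P) ltac:(lia)). specialize (Hfin (max N P) ltac:(lia)).
  pose proof (is_series_partial_le M S (max N P) HM HS).
  pose proof (Cmod_triangle (l - sum_n a (max N P)) (sum_n a (max N P) - sum_n a P)).
  replace (l - sum_n a (max N P) + (sum_n a (max N P) - sum_n a P))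
    with (l - sum_n a P) in H0 by ring.
  replace (l - sum_n a (max N P)) with (- (sum_n a (max N P) - l)) in H0 by ring.
  rewrite Cmod_opp in H0. lra.
Qed.

Lemma cvgC_csum (a : nat -> nat -> C) (b : nat -> C) P :
  (forall m, cvgC (fun k => a k m) (b m)) ->
  cvgC (fun k => sum_n (a k) P) (sum_n b P).
Proof.
  intros H. induction P.
  - apply cvgC_ext with (fun k => a k 0%nat); [intros; now rewrite csum_O|].
    rewrite csum_O. apply H.
  - intros eps He. assert (He2 : (0 < eps / 2)%R) by lra.
    destruct (IHP _ He2) as [N HN], (H (S P) _ He2) as [N' HN'].
    exists (max N N'). intros n Hn.
    specialize (HN n ltac:(lia)). specialize (HN' n ltac:(lia)). simpl in *.
    rewrite !csum_S.
    replace (sum_n (a n) P + a n (S P) - (sum_n b P + b (S P)))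
      with ((sum_n (a n) P - sum_n b P) + (a n (S P) - b (S P))) by ring.
    eapply Rle_lt_trans; [apply Cmod_triangle|]. lra.
Qed.

(* Tannery's theorem. *)
Lemma cvgC_series_dominated (a : nat -> nat -> C) (b A : nat -> C) (s : C)
    (M : nat -> R) :
  (forall k m, (Cmod (a k m) <= M m)%R) -> ex_series M ->
  (forall m, cvgC (fun k => a k m) (b m)) ->
  (forall k, is_series (a k) (A k)) -> is_series b s ->
  cvgC A s.
Proof.
  intros HaM [S HS] Hlim HA Hb eps He.
  (* The bound passes to the limits, so that the tail estimate applies to [b] as well. *)
  assert (HbM : forall m, (Cmod (b m) <= M m)%R).
  { intros m. apply le_epsilon. intros e Hee.
    destruct (Hlim m e Hee) as [N HN]. specialize (HN N (le_n _)).
    pose proof (HaM N m).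
    pose proof (Cmod_triangle (a N m) (- (a N m - b m))).
    replace (a N m + - (a N m - b m)) with (b m) in H0 by ring.
    rewrite Cmod_opp in H0. lra. }
  assert (He3 : (0 < eps / 3)%R) by lra.
  assert (HP : exists P, (S - sum_n M P < eps / 3)%R).
  { pose proof HS as HS'.
    apply (is_lim_seq_spec (sum_n M) S) in HS'.
    destruct (HS' (mkposreal _ He3)) as [P HP]. exists P.
    specialize (HP P (le_n _)). simpl in HP.
    apply Rabs_def2 in HP. lra. }
  destruct HP as [P HP].
  destruct (cvgC_csum a b P Hlim _ He3) as [N HN].
  exists N. intros k Hk. specialize (HN k Hk).
  pose proof (csum_tail_le (a k) M S (A k) P (HaM k) HS (HA k)).
  pose proof (csum_tail_le b M S s P HbM HS Hb).
  replace (A k - s) with ((A k - sum_n (a k) P)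
    + ((sum_n (a k) P - sum_n b P) + - (s - sum_n b P))) by ring.
  eapply Rle_lt_trans; [apply Cmod_triangle|].
  eapply Rle_lt_trans; [apply Rplus_le_compat_l, Cmod_triangle|].
  rewrite Cmod_opp. lra.
Qed.

Lemma is_series_csum (a : nat -> nat -> C) (A : nat -> C) n :
  (forall k, is_series (fun m => a m k) (A k)) ->
  is_series (fun m => sum_n (a m) n) (sum_n A n).
Proof.
  intros H. induction n.
  - rewrite csum_O. apply is_series_cext with (fun m => a m 0%nat); [|apply H].
    intros; now rewrite csum_O.
  - rewrite csum_S.
    apply is_series_cext with (fun m => sum_n (a m) n + a m (S n)).
    { intros; now rewrite csum_S. }
    now apply is_series_cplus.
Qed.

(* Fubini for absolutely convergent double series. *)
Lemma is_series_swap (a : nat -> nat -> C) (r c : nat -> C) (M : nat -> R) (s : C) :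
  (forall m n, (sum_n (fun k => Cmod (a m k)) n <= M m)%R) -> ex_series M ->
  (forall m, is_series (a m) (r m)) ->
  (forall n, is_series (fun m => a m n) (c n)) ->
  is_series r s -> is_series c s.
Proof.
  intros HM HexM Hr Hc Hs. apply is_series_cvgC.
  (* Tannery's theorem in the column index n: the terms are the partial row sums, which tend to
     [r m] under the majorant [M m], and their sums over m are the partial sums of [c]. *)
  apply (cvgC_series_dominated (fun n m => sum_n (a m) n) r (sum_n c) s M).
  - intros n m. eapply Rle_trans; [apply Cmod_csum|apply HM].
  - exact HexM.
  - intros m. now apply is_series_cvgC.
  - intros n. now apply is_series_csum.
  - exact Hs.
Qed.

Lemma Cmod_le_row (a : nat -> C) (M : R) :
  (forall n, (sum_n (fun k => Cmod (a k)) n <= M)%R) ->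
  forall n, (Cmod (a n) <= M)%R.
Proof.
  intros H n. specialize (H n). destruct n; [now rewrite rsum_O in H|].
  rewrite rsum_S in H.
  assert (0 <= sum_n (fun k => Cmod (a k)) n)%R; [|lra].
  clear. induction n; [rewrite rsum_O; apply Cmod_ge_0|].
  rewrite rsum_S. pose proof (Cmod_ge_0 (a (S n))). lra.
Qed.

Lemma ex_series_abs_bounded (a : nat -> C) (M : R) :
  (forall n, (sum_n (fun k => Cmod (a k)) n <= M)%R) -> ex_series a.
Proof.
  intros H. apply ex_series_cmod_le with (fun k => Cmod (a k)); [intros; lra|].
  destruct (ex_finite_lim_seq_incr (sum_n (fun k => Cmod (a k))) M) as [l Hl].
  - intros n. rewrite rsum_S. pose proof (Cmod_ge_0 (a (S n))). lra.
  - exact H.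
  - now exists l.
Qed.

Lemma is_series_double (a : nat -> nat -> C) (M : nat -> R) :
  (forall m n, (sum_n (fun k => Cmod (a m k)) n <= M m)%R) -> ex_series M ->
  (forall m, ex_series (a m)) /\ (forall n, ex_series (fun m => a m n)) /\
  is_series (fun n => CSeries (fun m => a m n)) (CSeries (fun m => CSeries (a m)))
  /\ ex_series (fun m => CSeries (a m)).
Proof.
  intros HM HexM.
  assert (Hr : forall m, ex_series (a m))
    by (intros m; now apply ex_series_abs_bounded with (M m)).
  assert (Hc : forall n, ex_series (fun m => a m n)).
  { intros n. apply ex_series_cmod_le with M; [|exact HexM].
    intros m. apply Cmod_le_row, HM. }
  assert (Hrr : ex_series (fun m => CSeries (a m))).
  { apply ex_series_cmod_le with M; [|exact HexM].
    intros m. apply le_epsilon. intros e He.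
    pose proof (CSeries_correct _ (Hr m)) as H. apply is_series_cvgC in H.
    destruct (H e He) as [N HN]. specialize (HN N (le_n _)).
    pose proof (Cmod_csum (a m) N). pose proof (HM m N).
    pose proof (Cmod_triangle (sum_n (a m) N) (- (sum_n (a m) N - CSeries (a m)))).
    replace (sum_n (a m) N + - (sum_n (a m) N - CSeries (a m)))
      with (CSeries (a m)) in H2 by ring.
    rewrite Cmod_opp in H2. lra. }
  repeat split; auto.
  apply is_series_swap with a (fun m => CSeries (a m)) M; auto.
  - intros m. now apply CSeries_correct.
  - intros n. now apply CSeries_correct.
  - now apply CSeries_correct.
Qed.

Lemma ex_series_pow_bound (a : nat -> R) (q K : R) :
  (0 <= q < 1)%R -> (forall n, (Rabs (a n) <= K * q ^ n)%R) -> ex_series a.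
Proof.
  intros Hq H. apply (ex_series_le (V := R_CompleteNormedModule) a (fun n => (K * q ^ n)%R) H).
  apply (ex_series_scal (V := R_NormedModule) K (fun n => (q ^ n)%R)).
  exists (/ (1 - q))%R. apply is_series_geom. rewrite Rabs_pos_eq; lra.
Qed.

Lemma ex_series_bounded (a : nat -> C) :
  ex_series a -> exists K, (0 < K)%R /\ forall n, (Cmod (a n) <= K)%R.
Proof.
  intros [l Hl]. apply is_series_cvgC in Hl.
  destruct (Hl 1%R Rlt_0_1) as [N HN].
  assert (HB : exists K, (0 < K)%R /\ forall n, (n <= N)%nat -> (Cmod (a n) <= K)%R).
  { clear. induction N.
    - exists (Cmod (a 0%nat) + 1)%R. pose proof (Cmod_ge_0 (a 0%nat)).
      split; [lra|]. intros n Hn. replace n with 0%nat by lia. lra.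
    - destruct IHN as (K & HK & H). pose proof (Cmod_ge_0 (a (S N))).
      exists (K + Cmod (a (S N)))%R. split; [lra|].
      intros n Hn. destruct (le_lt_dec n N); [specialize (H n l); lra|].
      replace n with (S N) by lia. lra. }
  (* Beyond N a term is the difference of two consecutive partial sums, each within 1 of the limit;
     hence the 2. *)
  destruct HB as (K & HK & HB). exists (K + 2)%R. split; [lra|].
  intros n. destruct (le_lt_dec n N); [specialize (HB n l0); lra|].
  destruct n; [lia|].
  pose proof (HN n ltac:(lia)). pose proof (HN (S n) ltac:(lia)).
  rewrite csum_S in H0.
  pose proof (Cmod_triangle (sum_n a n + a (S n) - l) (- (sum_n a n - l))).
  replace (sum_n a n + a (S n) - l + - (sum_n a n - l)) with (a (S n)) in H1 by ring.
  rewrite Cmod_opp in H1. lra.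
Qed.

(** * Complex powers and the binomial series *)

Lemma natC_S n : natC (S n) = natC n + 1.
Proof. unfold natC. rewrite S_INR, RtoC_plus. reflexivity. Qed.

Lemma natC_plus m n : natC (m + n) = natC m + natC n.
Proof. unfold natC. now rewrite plus_INR, RtoC_plus. Qed.

Lemma natC_mult m n : natC (m * n) = natC m * natC n.
Proof. unfold natC. now rewrite mult_INR, RtoC_mult. Qed.

Lemma natC_neq0 n : (n <> 0)%nat -> natC n <> 0.
Proof.
  intros H E. apply RtoC_inj in E. apply H. now apply INR_eq.
Qed.

Lemma natC_fact_neq0 n : natC (fact n) <> 0.
Proof. apply natC_neq0, fact_neq_0. Qed.

Lemma Cmod_natC n : Cmod (natC n) = INR n.
Proof. unfold natC. rewrite Cmod_R. apply Rabs_pos_eq, pos_INR. Qed.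

Lemma fact_natC_S n : natC (fact (S n)) = (natC n + 1) * natC (fact n).
Proof. change (fact (S n)) with (S n * fact n)%nat. now rewrite natC_mult, natC_S. Qed.

Lemma Cmod_le_abs (z : C) : (Cmod z <= Rabs (fst z) + Rabs (snd z))%R.
Proof.
  pose proof (Rabs_pos (fst z)). pose proof (Rabs_pos (snd z)).
  unfold Cmod. apply Rsqr_incr_0_var; [|lra].
  rewrite Rsqr_sqrt by nra.
  unfold Rsqr. pose proof (Rsqr_abs (fst z)). pose proof (Rsqr_abs (snd z)).
  unfold Rsqr in *. nra.
Qed.

Lemma sum_n_fst (a : nat -> C) n : fst (sum_n a n : C) = sum_n (fun k => fst (a k)) n.
Proof.
  induction n; [now rewrite csum_O, rsum_O|].
  rewrite csum_S, rsum_S, <- IHn. reflexivity.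
Qed.

Lemma sum_n_snd (a : nat -> C) n : snd (sum_n a n : C) = sum_n (fun k => snd (a k)) n.
Proof.
  induction n; [now rewrite csum_O, rsum_O|].
  rewrite csum_S, rsum_S, <- IHn. reflexivity.
Qed.

Lemma is_series_pair (a : nat -> C) (x y : R) :
  is_series (fun n => fst (a n)) x -> is_series (fun n => snd (a n)) y ->
  is_series a ((x, y) : C).
Proof.
  intros Hx Hy. apply is_series_cvgC. intros eps He.
  assert (He2 : (0 < eps / 2)%R) by lra.
  apply (is_lim_seq_spec _ (Finite x)) in Hx.
  apply (is_lim_seq_spec _ (Finite y)) in Hy.
  destruct (Hx (mkposreal _ He2)) as [N HN], (Hy (mkposreal _ He2)) as [N' HN'].
  exists (max N N'). intros n Hn.
  specialize (HN n ltac:(lia)). specialize (HN' n ltac:(lia)). simpl in *.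
  rewrite <- sum_n_fst in HN. rewrite <- sum_n_snd in HN'.
  eapply Rle_lt_trans; [apply Cmod_le_abs|].
  change (Rabs (fst (sum_n a n) - x) + Rabs (snd (sum_n a n) - y) < eps)%R. lra.
Qed.

(** The ratio test in the form used for the geometric estimates below: K absorbs the indices up to
    J, and the recursion carries the bound on from there. *)
Lemma geometric_bound (a : nat -> R) (q : R) (J : nat) :
  (0 < q)%R -> (forall j, (J <= j)%nat -> (a (S j) <= q * a j)%R) ->
  exists K, (0 < K)%R /\ forall j, (a j <= K * q ^ j)%R.
Proof.
  intros Hq H.
  assert (HB : exists K, (0 < K)%R /\ forall j, (j <= J)%nat -> (a j <= K * q ^ j)%R).
  { clear H. induction J.
    - exists (Rabs (a 0%nat) + 1)%R. pose proof (Rle_abs (a 0%nat)).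
      pose proof (Rabs_pos (a 0%nat)).
      split; [lra|]. intros j Hj. replace j with 0%nat by lia. simpl. lra.
    - destruct IHJ as (K & HK & H).
      assert (Hp : (0 < q ^ S J)%R) by now apply pow_lt.
      set (b := (Rabs (a (S J)) / q ^ S J)%R).
      assert (Hb : (0 <= b)%R).
      { apply Rmult_le_pos; [apply Rabs_pos|]. left. now apply Rinv_0_lt_compat. }
      exists (K + b)%R. split; [lra|].
      intros j Hj. destruct (Nat.eq_dec j (S J)) as [->|Hne].
      + pose proof (Rle_abs (a (S J))).
        replace (Rabs (a (S J))) with (b * q ^ S J)%R in H0 by (unfold b; field; lra).
        nra.
      + specialize (H j ltac:(lia)).
        assert (0 < q ^ j)%R by now apply pow_lt. nra. }
  destruct HB as (K & HK & HB). exists K. split; [exact HK|].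
  intros j. destruct (Nat.le_gt_cases j J) as [Hj|Hj]; [auto|].
  assert (Hj' : (J <= j)%nat) by lia. clear Hj. induction Hj'; [auto|].
  specialize (H m Hj'). simpl. nra.
Qed.

Lemma exists_nat_ge (x : R) : exists n : nat, (x <= INR n)%R.
Proof.
  destruct (nfloor_ex (Rabs x) (Rabs_pos x)) as [n [_ Hn]].
  exists (S n). rewrite S_INR. pose proof (Rle_abs x). lra.
Qed.

Lemma Cmod_plus_natC_le (a : C) n : (Cmod (a + natC n) <= Cmod a + INR n)%R.
Proof. rewrite <- Cmod_natC. apply Cmod_triangle. Qed.

Definition binomial_term (nu u : C) (j : nat) : C :=
  poch nu j / natC (fact j) * Cpow u j.

(** Coefficient form of the differential equation (1 - u s) y' = nu u y satisfied by y = (1 - u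
    s)^(- nu). *)
Lemma binomial_term_S nu u j :
  (natC j + 1) * binomial_term nu u (S j) = (nu + natC j) * u * binomial_term nu u j.
Proof.
  unfold binomial_term. rewrite fact_natC_S, Cpow_S. simpl poch.
  field. split; [apply natC_fact_neq0|]. rewrite <- natC_S. now apply natC_neq0.
Qed.

Lemma binomial_term_bound nu u q :
  (Cmod u < q)%R -> exists K, (0 < K)%R /\
  forall j, (Cmod (binomial_term nu u j) <= K * q ^ j)%R.
Proof.
  intros Hu. pose proof (Cmod_ge_0 u) as Hu0. pose proof (Cmod_ge_0 nu) as Hn0.
  (* From this J on, the ratio |nu + j| |u| / (j + 1) of consecutive terms is at most q. *)
  destruct (exists_nat_ge (Cmod nu * Cmod u / (q - Cmod u))) as [J HJ].
  apply (geometric_bound (fun j => Cmod (binomial_term nu u j)) q J); [lra|].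
  intros j Hj.
  pose proof (f_equal Cmod (binomial_term_S nu u j)) as E.
  rewrite !Cmod_mult, <- natC_S, Cmod_natC, S_INR in E.
  pose proof (Cmod_plus_natC_le nu j).
  pose proof (Cmod_ge_0 (binomial_term nu u j)).
  pose proof (pos_INR j).
  apply le_INR in Hj.
  assert (H3 : (Cmod nu * Cmod u <= INR j * (q - Cmod u))%R).
  { replace (Cmod nu * Cmod u)%R
      with (Cmod nu * Cmod u / (q - Cmod u) * (q - Cmod u))%R by (field; lra).
    apply Rmult_le_compat_r; lra. }
  assert (H4 : (Cmod (nu + natC j) * Cmod u <= (INR j + 1) * q)%R) by nra.
  apply Rmult_le_reg_l with (INR j + 1)%R; [lra|]. rewrite E.
  replace ((INR j + 1) * (q * Cmod (binomial_term nu u j)))%R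
    with ((INR j + 1) * q * Cmod (binomial_term nu u j))%R by ring.
  now apply Rmult_le_compat_r.
Qed.

(** The bases of the powers below have positive real part (mostly 1 - c with |c| < 1). There the
    argument is an arctangent, free of the case split and accessible to [auto_derive]. *)
Lemma Carg_atan (z : C) : (0 < Re z)%R -> Carg z = atan (Im z / Re z).
Proof.
  destruct z as [x y]. unfold Carg, Cmod. simpl Re. simpl Im. simpl fst. simpl snd.
  intros Hx. set (th := atan (y / x)).
  assert (Hc : (x / sqrt (x ^ 2 + y ^ 2))%R = cos th).
  { unfold th. rewrite cos_atan.
    replace (x ^ 2 + y ^ 2)%R with (x ^ 2 * (1 + (y / x)²))%R
      by (unfold Rsqr; field; lra).
    rewrite sqrt_mult_alt by nra. rewrite sqrt_pow2 by lra.
    field. split; [|lra].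
    apply Rgt_not_eq, sqrt_lt_R0. pose proof (Rle_0_sqr (y / x)). lra. }
  rewrite Hc. pose proof (atan_bound (y / x)) as Hb. fold th in Hb.
  pose proof PI_RGT_0.
  destruct (Rle_dec 0 y) as [Hy|Hy].
  - apply acos_cos. split; [|lra].
    unfold th. destruct Hy as [Hy|<-].
    + left. rewrite <- atan_0. apply atan_increasing.
      apply Rdiv_lt_0_compat; lra.
    + unfold Rdiv. rewrite Rmult_0_l, atan_0. lra.
  - assert (th < 0)%R.
    { unfold th. rewrite <- atan_0. apply atan_increasing.
      unfold Rdiv. assert (0 < / x)%R by now apply Rinv_0_lt_compat. nra. }
    rewrite <- cos_neg, acos_cos by lra. lra.
Qed.

Lemma Cexp_plus (z w : C) : Cexp (z + w) = Cexp z * Cexp w.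
Proof.
  destruct z as [a b], w as [c d]. unfold Cexp. simpl Re. simpl Im.
  rewrite exp_plus, cos_plus, sin_plus.
  apply injective_projections; simpl; ring.
Qed.

Lemma Cmod_Cexp (z : C) : Cmod (Cexp z) = exp (Re z).
Proof.
  unfold Cexp. rewrite Cmod_mult, Cmod_R, Rabs_pos_eq by (left; apply exp_pos).
  unfold Cmod. simpl fst. simpl snd.
  replace (cos (Im z) ^ 2 + sin (Im z) ^ 2)%R with 1%R.
  - rewrite sqrt_1. ring.
  - pose proof (sin2_cos2 (Im z)). unfold Rsqr in H. lra.
Qed.

Lemma Cexp_0 : Cexp 0 = 1.
Proof.
  unfold Cexp. simpl. rewrite exp_0, cos_0, sin_0.
  apply injective_projections; simpl; ring.
Qed.

Lemma Cexp_Clog (z : C) : (0 < Re z)%R -> Cexp (Clog z) = z.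
Proof.
  intros Hz. unfold Cexp, Clog. simpl Re at 1. simpl Im.
  rewrite (Carg_atan z Hz), cos_atan, sin_atan.
  destruct z as [x y]. simpl in Hz. simpl Re. simpl Im. simpl.
  assert (Hp : (0 < x ^ 2 + y ^ 2)%R) by nra.
  assert (Hm : (0 < Cmod (x, y))%R) by (unfold Cmod; now apply sqrt_lt_R0).
  rewrite exp_ln by exact Hm.
  assert (Hs : sqrt (1 + (y / x)²) = (Cmod (x, y) / x)%R).
  { unfold Cmod. simpl fst. simpl snd.
    replace (x ^ 2 + y ^ 2)%R with (x ^ 2 * (1 + (y / x)²))%R
      by (unfold Rsqr; field; lra).
    rewrite sqrt_mult_alt by nra. rewrite sqrt_pow2 by lra. field. lra. }
  rewrite Hs. apply injective_projections; simpl; field; lra.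
Qed.

Lemma Cpower_plus z a b : Cpower z (a + b) = Cpower z a * Cpower z b.
Proof. unfold Cpower. rewrite <- Cexp_plus. f_equal. ring. Qed.

Lemma Cpower_0 z : Cpower z 0 = 1.
Proof. unfold Cpower. rewrite Cmult_0_l. apply Cexp_0. Qed.

Lemma Cpower_opp z a : Cpower z a * Cpower z (- a) = 1.
Proof. rewrite <- Cpower_plus, <- (Cpower_0 z). f_equal. ring. Qed.

Lemma Cpower_natC z n : (0 < Re z)%R -> Cpower z (natC n) = Cpow z n.
Proof.
  intros Hz. induction n.
  - unfold natC. simpl. apply Cpower_0.
  - rewrite natC_S, Cpower_plus, IHn, Cpow_S. unfold Cpower at 1.
    rewrite Cmult_1_l, (Cexp_Clog z Hz). ring.
Qed.

Lemma Cneq0_Re (z : C) : (0 < Re z)%R -> z <> 0.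
Proof. intros H E. rewrite E in H. simpl in H. lra. Qed.

Lemma Cpower_opp_natC z nu n :
  (0 < Re z)%R -> Cpower z (- (nu + natC n)) = Cpower z (- nu) * / Cpow z n.
Proof.
  intros Hz.
  assert (Hz0 : Cpow z n <> 0) by now apply Cpow_nz, Cneq0_Re.
  replace (- nu) with (- (nu + natC n) + natC n) by ring.
  rewrite (Cpower_plus z _ (natC n)), (Cpower_natC z n Hz). now field.
Qed.

(** A derivative in a real parameter, taken componentwise: enough to solve a linear differential
    equation along a segment in the plane, and reducible to real calculus. *)
Definition is_deriveC (f : R -> C) (s : R) (d : C) : Prop :=
  is_derive (fun s => fst (f s)) s (fst d) /\ is_derive (fun s => snd (f s)) s (snd d).

(** Both components of a complex product have this form, with c = -1 for the real part and c = 1 for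
    the imaginary part. *)
Lemma is_derive_mult_pm (f1 f2 g1 g2 : R -> R) (s d1 d2 e1 e2 c : R) :
  is_derive f1 s d1 -> is_derive f2 s d2 -> is_derive g1 s e1 -> is_derive g2 s e2 ->
  is_derive (fun s => f1 s * g1 s + c * (f2 s * g2 s))%R s
    (d1 * g1 s + f1 s * e1 + c * (d2 * g2 s + f2 s * e2))%R.
Proof.
  intros H1 H2 H3 H4.
  assert (ex_derive f1 s) by now exists d1. assert (ex_derive f2 s) by now exists d2.
  assert (ex_derive g1 s) by now exists e1. assert (ex_derive g2 s) by now exists e2.
  auto_derive; [now repeat split|].
  change (fun x : R => f1 x) with f1. change (fun x : R => f2 x) with f2.
  change (fun x : R => g1 x) with g1. change (fun x : R => g2 x) with g2.
  rewrite (is_derive_unique _ _ _ H1), (is_derive_unique _ _ _ H2),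
    (is_derive_unique _ _ _ H3), (is_derive_unique _ _ _ H4). ring.
Qed.

Lemma is_deriveC_mult (f g : R -> C) (s : R) (df dg : C) :
  is_deriveC f s df -> is_deriveC g s dg ->
  is_deriveC (fun s => f s * g s) s (df * g s + f s * dg).
Proof.
  intros [Hf1 Hf2] [Hg1 Hg2]. split.
  - pose proof (is_derive_mult_pm _ _ _ _ s _ _ _ _ (-1) Hf1 Hf2 Hg1 Hg2) as H.
    eapply is_derive_ext; [|match type of H with is_derive _ _ ?d => match goal with |- is_derive _ _ ?e =>
      replace e with d; [exact H|] end end].
    + intros t. simpl. ring.
    + simpl. ring.
  - pose proof (is_derive_mult_pm _ _ _ _ s _ _ _ _ 1 Hf1 Hf2 Hg2 Hg1) as H.
    eapply is_derive_ext; [|match type of H with is_derive _ _ ?d => match goal with |- is_derive _ _ ?e =>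
      replace e with d; [exact H|] end end].
    + intros t. simpl. ring.
    + simpl. ring.
Qed.

Lemma is_deriveC_0_eq (f : R -> C) (a b : R) :
  (a < b)%R -> (forall s, (a <= s <= b)%R -> is_deriveC f s 0) -> f a = f b.
Proof.
  intros Hab H. apply injective_projections.
  - apply (eq_is_derive (fun s => fst (f s)) a b); [|exact Hab]. intros t Ht. apply H, Ht.
  - apply (eq_is_derive (fun s => snd (f s)) a b); [|exact Hab]. intros t Ht. apply H, Ht.
Qed.

Lemma ln_sqrt (x : R) : (0 < x)%R -> ln (sqrt x) = (ln x / 2)%R.
Proof.
  intros Hx. rewrite <- (sqrt_sqrt x) at 2 by lra.
  assert (0 < sqrt x)%R by now apply sqrt_lt_R0.
  rewrite ln_mult by assumption. field.
Qed.

Lemma Clog_explicit (x y : R) :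
  (0 < x)%R -> Clog (x, y) = ((ln (x ^ 2 + y ^ 2) / 2)%R, atan (y / x)).
Proof.
  intros Hx. unfold Clog. rewrite Carg_atan by exact Hx.
  unfold Cmod. simpl fst. simpl snd. rewrite ln_sqrt by nra. reflexivity.
Qed.

Lemma is_derive_Cpower (a d nu : C) (s : R) :
  (0 < Re (a + s * d))%R ->
  is_deriveC (fun s : R => Cpower (a + s * d) nu) s
    (nu * (d / (a + s * d)) * Cpower (a + s * d) nu).
Proof.
  destruct a as [a1 a2], d as [d1 d2], nu as [n1 n2].
  assert (E0 : forall t : R, ((a1, a2) + t * (d1, d2) : C) = (a1 + t * d1, a2 + t * d2)%R).
  { intros t. apply injective_projections; simpl; ring. }
  rewrite E0. intros Hs. simpl in Hs.
  set (X := (a1 + s * d1)%R) in *. set (Y := (a2 + s * d2)%R).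
  (* [L] and [T] are the real and imaginary parts of the principal logarithm along the line. *)
  pose (L := fun s : R => (ln ((a1 + s * d1) ^ 2 + (a2 + s * d2) ^ 2) / 2)%R).
  pose (T := fun s : R => atan ((a2 + s * d2) / (a1 + s * d1))).
  assert (HE : forall t : R, (0 < a1 + t * d1)%R ->
    Cpower ((a1, a2) + t * (d1, d2)) (n1, n2) =
    (exp (n1 * L t - n2 * T t) * cos (n1 * T t + n2 * L t),
     exp (n1 * L t - n2 * T t) * sin (n1 * T t + n2 * L t))%R).
  { intros t Ht. rewrite E0. unfold Cpower. rewrite Clog_explicit by exact Ht.
    fold (L t) (T t). unfold Cexp. simpl Re. simpl Im.
    apply injective_projections; simpl; ring. }
  assert (Hloc : locally s (fun t : R => 0 < a1 + t * d1)%R).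
  { assert (Hc : continuous (fun t : R => a1 + t * d1)%R s).
    { apply (ex_derive_continuous (fun t : R => a1 + t * d1)%R s). auto_derive. exact I. }
    apply Hc. exists (mkposreal _ Hs). intros y Hy.
    apply Rabs_def2 in Hy. unfold minus, plus, opp in Hy. simpl in Hy.
    fold X in Hy. lra. }
  assert (HLd : is_derive L s ((X * d1 + Y * d2) / (X ^ 2 + Y ^ 2))%R).
  { unfold L. auto_derive; fold X Y; [nra|]. field. nra. }
  assert (HTd : is_derive T s ((X * d2 - Y * d1) / (X ^ 2 + Y ^ 2))%R).
  { unfold T. auto_derive; fold X Y; [lra|].
    field. split; nra. }
  assert (Hd : ((d1, d2) / (X, Y) : C) = ((X * d1 + Y * d2) / (X ^ 2 + Y ^ 2),
     (X * d2 - Y * d1) / (X ^ 2 + Y ^ 2))%R).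
  { apply injective_projections; simpl; field; nra. }
  assert (HLe : ex_derive L s) by (eexists; exact HLd).
  assert (HTe : ex_derive T s) by (eexists; exact HTd).
  apply is_derive_unique in HLd. apply is_derive_unique in HTd.
  assert (Es : ((X, Y) : C) = (a1, a2) + s * (d1, d2)) by (symmetry; apply E0).
  rewrite Hd, Es, (HE s Hs).
  rewrite <- HLd, <- HTd.
  split.
  - apply is_derive_ext_loc with
      (fun t => exp (n1 * L t - n2 * T t) * cos (n1 * T t + n2 * L t))%R.
    + eapply filter_imp; [|exact Hloc]. intros t Ht. now rewrite (HE t Ht).
    + simpl fst. auto_derive; [now repeat split|].
      change (fun x : R => L x) with L; change (fun x : R => T x) with T;
      unfold Rminus; ring.
  - apply is_derive_ext_loc with
      (fun t => exp (n1 * L t - n2 * T t) * sin (n1 * T t + n2 * L t))%R.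
    + eapply filter_imp; [|exact Hloc]. intros t Ht. now rewrite (HE t Ht).
    + simpl snd. auto_derive; [now repeat split|].
      change (fun x : R => L x) with L; change (fun x : R => T x) with T;
      unfold Rminus; ring.
Qed.

Lemma CV_radius_gt (a : nat -> R) (q K : R) (x : R) :
  (0 < q)%R -> (forall n, (Rabs (a n) <= K * q ^ n)%R) -> (Rabs x * q < 1)%R ->
  Rbar_lt (Rabs x) (CV_radius a).
Proof.
  intros Hq Ha Hx.
  assert (Hx' : (Rabs x < / q)%R).
  { apply Rmult_lt_reg_r with q; [exact Hq|]. rewrite Rinv_l by lra. exact Hx. }
  apply Rbar_lt_le_trans with (Finite (/ q)%R); [exact Hx'|].
  apply (proj1 (CV_radius_bounded a)). exists K. intros n.
  rewrite Rabs_mult, <- RPow_abs, (Rabs_pos_eq (/ q)) by (left; now apply Rinv_0_lt_compat).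
  rewrite pow_inv.
  apply Rmult_le_reg_r with (q ^ n)%R; [now apply pow_lt|].
  rewrite Rmult_assoc, Rinv_l by (apply pow_nonzero; lra). rewrite Rmult_1_r. apply Ha.
Qed.

Lemma is_series_PSeries (a : nat -> R) (x : R) :
  Rbar_lt (Rabs x) (CV_radius a) -> is_series (fun n => (a n * x ^ n)%R) (PSeries a x).
Proof.
  intros H. apply Series_correct.
  apply ex_series_ext with (fun n => scal (pow_n x n) (a n)).
  - intros n. rewrite pow_n_pow. apply Rmult_comm.
  - now apply CV_radius_inside.
Qed.

Lemma fst_RtoC_mult_r (z : C) (x : R) : fst (z * x) = (fst z * x)%R.
Proof. simpl. ring. Qed.

Lemma snd_RtoC_mult_r (z : C) (x : R) : snd (z * x) = (snd z * x)%R.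
Proof. simpl. ring. Qed.

Lemma fst_natC_mult n (z : C) : fst (natC n * z) = (INR n * fst z)%R.
Proof. unfold natC. simpl. ring. Qed.

Lemma snd_natC_mult n (z : C) : snd (natC n * z) = (INR n * snd z)%R.
Proof. unfold natC. simpl. ring. Qed.

Lemma fst_abs_le (z : C) : (Rabs (fst z) <= Cmod z)%R.
Proof. eapply Rle_trans; [apply Rmax_l|apply Rmax_Cmod]. Qed.

Lemma snd_abs_le (z : C) : (Rabs (snd z) <= Cmod z)%R.
Proof. eapply Rle_trans; [apply Rmax_r|apply Rmax_Cmod]. Qed.

(** Summing the recurrence [binomial_term_S] against s^j gives the differential equation. The
    components are real power series of radius greater than 1, so they may be differentiated term by
    term on the closed segment. *)
Lemma binomial_series_derive (nu u : C) (s : R) :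
  (Cmod u < 1)%R -> (0 <= s <= 1)%R ->
  let A := fun s => PSeries (fun j => fst (binomial_term nu u j)) s in
  let B := fun s => PSeries (fun j => snd (binomial_term nu u j)) s in
  is_series (fun j => binomial_term nu u j * Cpow s j) (A s, B s) /\
  exists D : C, is_deriveC (fun s => (A s, B s)) s D /\
    (1 - u * s) * D = nu * u * (A s, B s).
Proof.
  intros Hu Hs A B.
  set (q := ((Cmod u + 1) / 2)%R).
  pose proof (Cmod_ge_0 u) as Hu0.
  destruct (binomial_term_bound nu u q) as (K & HK & Hb); [unfold q; lra|].
  assert (Hq : (0 < q)%R) by (unfold q; lra).
  assert (Hsq : (Rabs s * q < 1)%R).
  { rewrite Rabs_pos_eq by lra. unfold q. nra. }
  assert (Ha : Rbar_lt (Rabs s) (CV_radius (fun j => fst (binomial_term nu u j)))).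
  { apply CV_radius_gt with q K; auto. intros n.
    eapply Rle_trans; [apply fst_abs_le|apply Hb]. }
  assert (Hbb : Rbar_lt (Rabs s) (CV_radius (fun j => snd (binomial_term nu u j)))).
  { apply CV_radius_gt with q K; auto. intros n.
    eapply Rle_trans; [apply snd_abs_le|apply Hb]. }
  assert (HS : is_series (fun j => binomial_term nu u j * Cpow s j) (A s, B s)).
  { apply is_series_pair.
    - eapply is_series_ext; [|apply (is_series_PSeries _ _ Ha)].
      intros n. cbv beta. now rewrite <- RtoC_pow, fst_RtoC_mult_r.
    - eapply is_series_ext; [|apply (is_series_PSeries _ _ Hbb)].
      intros n. cbv beta. now rewrite <- RtoC_pow, snd_RtoC_mult_r. }
  split; [exact HS|].
  exists (PSeries (PS_derive (fun j => fst (binomial_term nu u j))) s,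
     PSeries (PS_derive (fun j => snd (binomial_term nu u j))) s).
  split; [split; now apply is_derive_PSeries|].
  set (D := (_, _) : C).
  assert (HD : is_series (fun j => natC (S j) * binomial_term nu u (S j) * Cpow s j) D).
  { apply is_series_pair.
    - eapply is_series_ext; [|apply is_series_PSeries; now rewrite CV_radius_derive].
      intros n. cbv beta.
      now rewrite <- RtoC_pow, fst_RtoC_mult_r, fst_natC_mult.
    - eapply is_series_ext; [|apply is_series_PSeries; now rewrite CV_radius_derive].
      intros n. cbv beta.
      now rewrite <- RtoC_pow, snd_RtoC_mult_r, snd_natC_mult. }
  (* Multiplication by s shifts the index by one; the term added at j = 0 vanishes through its
     factor j. *)
  assert (HsD : is_series (fun j => natC j * binomial_term nu u j * Cpow s j) (s * D)).
  { apply (is_series_decr_1 (V := C_NormedModule)).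
    replace (natC 0) with (RtoC 0) by reflexivity.
    match goal with |- is_series _ ?l => replace l with (s * D) end.
    - eapply is_series_cext; [|apply (is_series_cmult_l s), HD].
      intros n. cbv beta. rewrite Cpow_S. ring.
    - change (s * D = s * D + - (0 * binomial_term nu u 0 * Cpow s 0)). ring. }
  assert (E : D = nu * u * (A s, B s) + u * (s * D)).
  { apply (is_series_cunique _ _ _ HD).
    eapply is_series_cext; [|apply is_series_cplus; apply is_series_cmult_l; [exact HS|exact HsD]].
    intros n. cbv beta. rewrite natC_S, binomial_term_S. ring. }
  transitivity (D - u * (s * D)); [ring|]. rewrite E at 1. ring.
Qed.

(* The product of the series with [b ^ nu] is constant along the segment from [a]
   to [b], since both factors satisfy the same first-order linear equation. *)
Lemma binomial_series_Cpower (a b nu : C) :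
  (0 < Re a)%R -> (0 < Re b)%R -> (Cmod (a - b) < Cmod a)%R ->
  is_series (fun j => Cpower a (- nu) * binomial_term nu ((a - b) / a) j) (Cpower b (- nu)).
Proof.
  intros Ha Hb Hab.
  assert (Ha0 : a <> 0) by now apply Cneq0_Re.
  (* Chosen so that 1 - u s = (a + s (b - a)) / a: the parameter s runs through the segment from a
     to b. *)
  set (u := (a - b) / a).
  assert (Hu : (Cmod u < 1)%R).
  { unfold u. rewrite Cmod_div by exact Ha0.
    apply Rmult_lt_reg_r with (Cmod a); [now apply Cmod_gt_0|].
    unfold Rdiv. rewrite Rmult_assoc, Rinv_l; [lra|].
    apply Rgt_not_eq. now apply Cmod_gt_0. }
  pose (A := fun s => PSeries (fun j => fst (binomial_term nu u j)) s).
  pose (B := fun s => PSeries (fun j => snd (binomial_term nu u j)) s).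
  assert (HD := fun s Hs => binomial_series_derive nu u s Hu Hs).
  fold A B in HD. cbv zeta in HD.
  pose (P := fun s : R => Cpower (a + s * (b - a)) nu).
  assert (Hre : forall s : R, (0 <= s <= 1)%R -> (0 < Re (a + s * (b - a)))%R).
  { intros s Hs. replace (Re (a + s * (b - a))) with ((1 - s) * Re a + s * Re b)%R
      by (destruct a, b; simpl; ring).
    destruct (Req_dec s 0); [subst; lra|].
    assert (0 < s * Re b)%R by (apply Rmult_lt_0_compat; lra). nra. }
  assert (HP := fun s Hs => is_derive_Cpower a (b - a) nu s (Hre s Hs)).
  fold (P : R -> C) in HP.
  (* The logarithmic derivatives nu u / (1 - u s) of the series and nu (b - a) / (a + s (b - a)) of
     the power are opposite, by the choice of u. *)
  assert (Hz : forall s, (0 <= s <= 1)%R -> forall D : C,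
    (1 - u * s) * D = nu * u * (A s, B s) ->
    D * P s + (A s, B s) * (nu * ((b - a) / (a + s * (b - a))) * P s) = 0).
  { intros s Hs D E.
    assert (Hne : a + s * (b - a) <> 0) by (apply Cneq0_Re; now apply Hre).
    assert (E1 : 1 - u * s = (a + s * (b - a)) / a) by (unfold u; now field).
    assert (E2 : D = a / (a + s * (b - a)) * (nu * u * (A s, B s))).
    { rewrite <- E, E1. field. now split. }
    rewrite E2. unfold u. field. now split. }
  assert (H1 : forall s, (0 <= s <= 1)%R -> is_deriveC (fun s => (A s, B s) * P s) s 0).
  { intros s Hs. destruct (HD s Hs) as (_ & D & HA & E).
    rewrite <- (Hz s Hs D E).
    apply (is_deriveC_mult (fun s => (A s, B s)) P); [exact HA|]. apply HP, Hs. }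
  pose proof (is_deriveC_0_eq _ 0 1 Rlt_0_1 H1) as E. cbv beta in E.
  destruct (HD 0%R ltac:(lra)) as [H0 _]. destruct (HD 1%R ltac:(lra)) as [H1' _].
  assert (E0 : (A 0%R, B 0%R) = (1 : C)).
  { unfold A, B. rewrite !PSeries_0. unfold binomial_term. simpl.
    apply injective_projections; simpl; field. }
  rewrite E0 in E.
  assert (E1 : Cpower b (- nu) = Cpower a (- nu) * (A 1%R, B 1%R)).
  { unfold P in E. replace (a + 0%R * (b - a)) with a in E by ring.
    replace (a + 1%R * (b - a)) with b in E by ring.
    pose proof (Cpower_opp a nu) as Ea. pose proof (Cpower_opp b nu) as Eb.
    transitivity (Cpower a nu * Cpower a (- nu) * Cpower b (- nu)); [rewrite Ea; ring|].
    replace (Cpower a nu) with (1 * Cpower a nu) by ring. rewrite E.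
    transitivity (Cpower b nu * Cpower b (- nu) * (Cpower a (- nu) * (A 1%R, B 1%R)));
      [ring|rewrite Eb; ring]. }
  rewrite E1. apply is_series_cmult_l.
  eapply is_series_cext; [|exact H1'].
  intros n. cbv beta. rewrite Cpow_1_l. ring.
Qed.

(** * Taylor expansion of both sides *)

(** Divided powers turn the binomial theorem into a plain convolution, and Taylor coefficients into
    the derivatives themselves. *)
Definition divpow (x : C) (n : nat) : C := Cpow x n / natC (fact n).

Lemma divpow_S x n : (natC n + 1) * divpow x (S n) = x * divpow x n.
Proof.
  unfold divpow. rewrite fact_natC_S, Cpow_S.
  field. split; [apply natC_fact_neq0|]. rewrite <- natC_S. now apply natC_neq0.
Qed.

Lemma divpow_0 x : divpow x 0 = 1.
Proof. unfold divpow. simpl. unfold natC. simpl. field. Qed.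

Lemma Cmod_divpow x n : Cmod (divpow x n) = (Cmod x ^ n / INR (fact n))%R.
Proof.
  unfold divpow. rewrite Cmod_div by apply natC_fact_neq0.
  now rewrite Cmod_pow, Cmod_natC.
Qed.

Lemma divpow_plus (c h : C) n :
  sum_n (fun k => divpow c (n - k) * divpow h k) n = divpow (c + h) n :> C.
Proof.
  induction n.
  - rewrite csum_O. simpl. rewrite !divpow_0. ring.
  - set (T := fun k => divpow c (n - k) * divpow h k) in *.
    (* Splitting n + 1 as (n + 1 - k) + k turns the k-th product into c T(k) + h T(k - 1); up to k =
       m the second part therefore lacks its last term h T(m). *)
    assert (Hlow : forall m, (m <= n)%nat ->
      (natC n + 1) * sum_n (fun k => divpow c (S n - k) * divpow h k) m
      = c * sum_n T m + h * sum_n T m - h * T m).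
    { induction m; intros Hm.
      - rewrite !csum_O. unfold T. rewrite !Nat.sub_0_r, !divpow_0.
        transitivity ((natC n + 1) * divpow c (S n)); [ring|]. rewrite divpow_S. ring.
      - rewrite !csum_S. rewrite Cmult_plus_distr_l, IHm by lia.
        replace (S n - S m)%nat with (S (n - S m)) by lia.
        assert (E1 := divpow_S c (n - S m)). assert (E2 := divpow_S h m).
        assert (En : natC n + 1 = (natC (n - S m) + 1) + (natC m + 1)).
        { rewrite <- !natC_S, <- natC_plus. f_equal. lia. }
        assert (ET : T m = divpow c (S (n - S m)) * divpow h m)
          by (unfold T; do 2 f_equal; lia).
        assert (EX : (natC n + 1) * (divpow c (S (n - S m)) * divpow h (S m))
          = c * T (S m) + h * T m).
        { rewrite ET. unfold T. rewrite En.
          transitivity ((natC (n - S m) + 1) * divpow c (S (n - S m)) * divpow h (S m)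
            + divpow c (S (n - S m)) * ((natC m + 1) * divpow h (S m))); [ring|].
          rewrite E1, E2. ring. }
        rewrite EX. ring. }
    assert (Hn : natC n + 1 <> 0) by (rewrite <- natC_S; now apply natC_neq0).
    assert (E : (natC n + 1) * sum_n (fun k => divpow c (S n - k) * divpow h k) (S n)
      = (natC n + 1) * divpow (c + h) (S n)).
    { rewrite divpow_S, <- IHn, csum_S, Cmult_plus_distr_l, (Hlow n (le_n _)).
      replace (S n - S n)%nat with 0%nat by lia. rewrite divpow_0.
      assert (E2 := divpow_S h n).
      replace ((natC n + 1) * (1 * divpow h (S n))) with (h * divpow h n)
        by (rewrite <- E2; ring).
      assert (ET : T n = divpow h n)
        by (unfold T; rewrite Nat.sub_diag, divpow_0; ring).
      rewrite ET. ring. }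
    apply (f_equal (Cmult (/ (natC n + 1)))) in E.
    rewrite !Cmult_assoc, Cinv_l, !Cmult_1_l in E by exact Hn. exact E.
Qed.

Lemma sum_n_RtoC (a : nat -> R) n : RtoC (sum_n a n) = sum_n (fun k => RtoC (a k)) n.
Proof.
  induction n; [now rewrite rsum_O, csum_O|].
  now rewrite rsum_S, csum_S, RtoC_plus, IHn.
Qed.

(** The binomial theorem for the moduli. It is the majorant behind the interchange of sums when a
    power series is re-expanded about c. *)
Lemma Cmod_divpow_plus (c h : C) n :
  sum_n (fun k => Cmod (divpow c (n - k)) * Cmod (divpow h k))%R n
  = ((Cmod c + Cmod h) ^ n / INR (fact n))%R :> R.
Proof.
  apply RtoC_inj. rewrite sum_n_RtoC.
  pose proof (divpow_plus (Cmod c) (Cmod h) n) as E.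
  replace (RtoC ((Cmod c + Cmod h) ^ n / INR (fact n)))
    with (divpow (Cmod c + Cmod h) n).
  - rewrite <- E. apply csum_ext. intros k _. rewrite RtoC_mult, !Cmod_divpow.
    unfold divpow, natC. now rewrite !RtoC_div, !RtoC_pow by apply INR_fact_neq_0.
  - unfold divpow, natC. now rewrite RtoC_div, RtoC_pow, RtoC_plus by apply INR_fact_neq_0.
Qed.

Lemma is_series_finite (a : nat -> C) n :
  (forall k, (n < k)%nat -> a k = 0) -> is_series a (sum_n a n).
Proof.
  intros H. apply is_series_cvgC. intros eps He. exists n. intros m Hm.
  assert (E : sum_n a m - sum_n a n = 0); [|now rewrite E, Cmod_0].
  induction Hm; [ring|]. rewrite csum_S, H by lia.
  transitivity (sum_n a m - sum_n a n); [ring|exact IHHm].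
Qed.

Lemma is_series_shift (a : nat -> C) j (l : C) :
  (forall k, (k < j)%nat -> a k = 0) -> is_series (fun n => a (n + j)%nat) l ->
  is_series a l.
Proof.
  revert a l. induction j; intros a l H0 H.
  - eapply is_series_cext; [|exact H]. intros n. cbv beta. f_equal. lia.
  - apply (is_series_decr_1 (V := C_NormedModule)).
    rewrite (H0 0%nat) by lia.
    match goal with |- is_series _ ?l' => replace l' with l end.
    + apply IHj; [intros k Hk; apply H0; lia|].
      eapply is_series_cext; [|exact H]. intros n. cbv beta. f_equal. lia.
    + change (l = l + - 0 :> C). ring.
Qed.

(* The power series with coefficients [e n / n!] has radius of convergence at least [r]. *)
Definition egf_radius_ge (e : nat -> C) (r : R) : Prop :=
  forall q, (0 < q < r)%R -> exists M, (0 < M)%R /\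
    forall n, (Cmod (e n) / INR (fact n) * q ^ n <= M)%R.

(** The ratio q (j + 2) / (j + 1) is eventually at most the midpoint of q and 1. This absorbs the
    linear factors that differentiation produces. *)
Lemma linear_geometric_bounded (q : R) :
  (0 <= q < 1)%R -> exists K, (0 < K)%R /\ forall n, (INR (S n) * q ^ n <= K)%R.
Proof.
  intros Hq. set (q' := ((q + 1) / 2)%R).
  destruct (exists_nat_ge (q / (q' - q))) as [J HJ].
  destruct (geometric_bound (fun n => INR (S n) * q ^ n)%R q' J) as (K & HK & H);
    [unfold q'; lra| |].
  - intros j Hj. cbv beta. apply le_INR in Hj.
    assert (q <= INR j * (q' - q))%R.
    { replace q with (q / (q' - q) * (q' - q))%R at 1 by (field; unfold q'; lra).
      apply Rmult_le_compat_r; [unfold q'|]; lra. }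
    simpl pow. pose proof (pow_le q j ltac:(lra)).
    rewrite <- !Rmult_assoc. apply Rmult_le_compat_r; [assumption|].
    rewrite !S_INR. assert (q <= q')%R by (unfold q'; lra). clearbody q'. nra.
  - exists K. split; [exact HK|]. intros n.
    eapply Rle_trans; [apply H|].
    assert (q' ^ n <= 1)%R; [|nra].
    rewrite <- (pow1 n). apply pow_incr. unfold q'; lra.
Qed.

Lemma pow_div (x y : R) n : (y <> 0)%R -> ((x / y) ^ n = x ^ n / y ^ n)%R.
Proof. intros Hy. unfold Rdiv. now rewrite Rpow_mult_distr, pow_inv. Qed.

(** Shifting the coefficients differentiates an exponential generating function. The extra factor n
    + 1 is absorbed by comparing q with the larger radius (q + r) / 2. *)
Lemma egf_radius_ge_S e r : egf_radius_ge e r -> egf_radius_ge (fun n => e (S n)) r.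
Proof.
  intros H q Hq. destruct (H ((q + r) / 2)%R ltac:(lra)) as (M & HM & Hb).
  set (q' := ((q + r) / 2)%R) in *. assert (Hq' : (q < q')%R) by (unfold q'; lra).
  assert (Hqq : (0 <= q / q' < 1)%R).
  { split; [apply Rmult_le_pos; [lra|]; left; apply Rinv_0_lt_compat; lra|].
    apply Rmult_lt_reg_r with q'; [lra|]. unfold Rdiv.
    rewrite Rmult_assoc, Rinv_l; lra. }
  destruct (linear_geometric_bounded _ Hqq) as (K & HK & Hl).
  exists (M / q' * K)%R. split.
  { apply Rmult_lt_0_compat; [apply Rdiv_lt_0_compat|]; lra. }
  intros n. specialize (Hb (S n)). specialize (Hl n).
  pose proof (INR_fact_lt_0 n) as Hf. pose proof (INR_fact_lt_0 (S n)) as Hf'.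
  assert (Hp : (0 < q' ^ n)%R) by (apply pow_lt; lra).
  assert (Hs : (0 < INR (S n))%R) by (apply lt_0_INR; lia).
  replace (Cmod (e (S n)) / INR (fact n) * q ^ n)%R
    with (Cmod (e (S n)) / INR (fact (S n)) * q' ^ (S n) / q'
       * (INR (S n) * (q / q') ^ n))%R.
  - apply Rmult_le_compat.
    + apply Rmult_le_pos; [|left; apply Rinv_0_lt_compat; lra].
      apply Rmult_le_pos; [|apply pow_le; lra].
      apply Rmult_le_pos; [apply Cmod_ge_0|]. left. now apply Rinv_0_lt_compat.
    + apply Rmult_le_pos; [lra|]. apply pow_le. lra.
    + apply Rmult_le_compat_r; [|exact Hb]. left. apply Rinv_0_lt_compat. lra.
    + exact Hl.
  - change (fact (S n)) with (S n * fact n)%nat. rewrite mult_INR.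
    rewrite pow_div by lra. simpl pow. field. repeat split; lra.
Qed.

Lemma egf_radius_ge_shift e r k : egf_radius_ge e r -> egf_radius_ge (fun n => e (n + k)%nat) r.
Proof.
  revert e. induction k; intros e H.
  - intros q Hq. destruct (H q Hq) as (M & HM & Hb). exists M. split; [exact HM|].
    intros n. rewrite Nat.add_0_r. apply Hb.
  - intros q Hq. destruct (IHk _ (egf_radius_ge_S e r H) q Hq) as (M & HM & Hb).
    exists M. split; [exact HM|]. intros n. rewrite Nat.add_succ_r. apply Hb.
Qed.

Lemma egf_radius_ge_dominated e r x :
  egf_radius_ge e r -> (0 <= x < r)%R ->
  ex_series (fun n => Cmod (e n) / INR (fact n) * x ^ n)%R.
Proof.
  intros H Hx. destruct (H ((x + r) / 2)%R ltac:(lra)) as (M & HM & Hb).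
  set (q := ((x + r) / 2)%R) in *. assert (Hq : (x < q)%R) by (unfold q; lra).
  apply ex_series_pow_bound with (x / q)%R M.
  - split; [apply Rmult_le_pos; [lra|]; left; apply Rinv_0_lt_compat; lra|].
    apply Rmult_lt_reg_r with q; [lra|]. unfold Rdiv.
    rewrite Rmult_assoc, Rinv_l; lra.
  - intros n. specialize (Hb n).
    assert (H0 : (0 <= Cmod (e n) / INR (fact n))%R).
    { apply Rmult_le_pos; [apply Cmod_ge_0|]. left. apply Rinv_0_lt_compat, INR_fact_lt_0. }
    rewrite Rabs_pos_eq by (apply Rmult_le_pos; [lra|apply pow_le; lra]).
    assert (Hp : (0 < q ^ n)%R) by (apply pow_lt; lra).
    rewrite pow_div by lra.
    replace (Cmod (e n) / INR (fact n) * x ^ n)%R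
      with (Cmod (e n) / INR (fact n) * q ^ n * (x ^ n / q ^ n))%R by (field; split; try apply INR_fact_neq_0; apply Rgt_not_eq, Hp).
    apply Rmult_le_compat_r; [|exact Hb].
    apply Rmult_le_pos; [apply pow_le; lra|]. left. now apply Rinv_0_lt_compat.
Qed.

Lemma Cmod_mult_divpow e x n :
  Cmod (e * divpow x n) = (Cmod e / INR (fact n) * Cmod x ^ n)%R.
Proof. rewrite Cmod_mult, Cmod_divpow. field. apply INR_fact_neq_0. Qed.

Lemma ex_series_power e r c :
  egf_radius_ge e r -> (Cmod c < r)%R -> ex_series (fun n => e n * divpow c n).
Proof.
  intros H Hc. eapply ex_series_cmod_le;
    [|apply (egf_radius_ge_dominated e r (Cmod c) H); split; [apply Cmod_ge_0|exact Hc]].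
  intros n. rewrite Cmod_mult_divpow. lra.
Qed.

(** The k-th derivative at c of the function sum_n e_n c^n / n!. *)
Definition power_jet (e : nat -> C) (k : nat) (c : C) : C :=
  CSeries (fun n => e (n + k)%nat * divpow c n).

Lemma power_jet_taylor0 e r c h :
  egf_radius_ge e r -> (Cmod c + Cmod h < r)%R ->
  is_series (fun j => power_jet e j c * divpow h j) (power_jet e 0 (c + h)).
Proof.
  intros He Hch. pose proof (Cmod_ge_0 c). pose proof (Cmod_ge_0 h).
  (* The triangular array of the binomial expansions of (c + h)^n / n!, padded with zeros to a full
     double series. *)
  pose (a := fun n k => if le_dec k n then e n * (divpow c (n - k) * divpow h k) else 0).
  assert (Ha : forall n k, (k <= n)%nat ->
    sum_n (a n) k = e n * sum_n (fun k => divpow c (n - k) * divpow h k) k).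
  { intros n k Hk. rewrite <- csum_mult_l. apply csum_ext. intros i Hi. unfold a.
    destruct (le_dec i n); [reflexivity|lia]. }
  assert (Hrow : forall n, is_series (a n) (e n * divpow (c + h) n)).
  { intros n. rewrite <- divpow_plus, <- Ha by lia. apply is_series_finite.
    intros k Hk. unfold a. destruct (le_dec k n); [lia|reflexivity]. }
  assert (Habs : forall n k, (sum_n (fun k => Cmod (a n k)) k
    <= Cmod (e n) / INR (fact n) * (Cmod c + Cmod h) ^ n)%R).
  { intros n.
    assert (Hle : forall k, (k <= n)%nat -> (sum_n (fun k => Cmod (a n k)) k <=
      Cmod (e n) * sum_n (fun k => Cmod (divpow c (n - k)) * Cmod (divpow h k)) k)%R).
    { intros k Hk. rewrite <- rsum_mult_l. apply rsum_le. intros i Hi. unfold a.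
      destruct (le_dec i n); [|lia]. rewrite !Cmod_mult. lra. }
    pose proof (Hle n (le_n _)) as Hn. rewrite Cmod_divpow_plus in Hn.
    replace (Cmod (e n) / INR (fact n) * (Cmod c + Cmod h) ^ n)%R
      with (Cmod (e n) * ((Cmod c + Cmod h) ^ n / INR (fact n)))%R
      by (field; apply INR_fact_neq_0).
    intros k. eapply Rle_trans; [|exact Hn].
    destruct (Nat.le_ge_cases k n) as [Hk|Hk].
    - clear - Hk. generalize (a n). intros f.
      induction Hk as [|m Hm IH]; [lra|]. rewrite rsum_S.
      pose proof (Cmod_ge_0 (f (S m))). lra.
    - induction Hk as [|m Hm IH]; [lra|]. rewrite rsum_S.
      unfold a at 2. destruct (le_dec (S m) n); [lia|]. rewrite Cmod_0. lra. }
  destruct (is_series_double a _ Habs) as (_ & _ & Hs & _).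
  { apply egf_radius_ge_dominated with r; [exact He|lra]. }
  assert (Ep : power_jet e 0 (c + h) = CSeries (fun m => CSeries (a m))).
  { unfold power_jet. symmetry.
    assert (Hr : ex_series (fun n => e (n + 0)%nat * divpow (c + h) n)).
    { apply (ex_series_power (fun n => e (n + 0)%nat) r); [now apply egf_radius_ge_shift|].
      eapply Rle_lt_trans; [apply Cmod_triangle|exact Hch]. }
    apply CSeries_unique. eapply is_series_cext; [|apply (CSeries_correct _ Hr)].
    intros n. cbv beta. rewrite Nat.add_0_r. symmetry. apply CSeries_unique, Hrow. }
  rewrite Ep. eapply is_series_cext; [|exact Hs].
  (* Column j is zero above n = j; re-indexed from there it is h^j / j! times the series of the j-th
     derivative at c. *)
  intros j. cbv beta. apply CSeries_unique. apply is_series_shift with j.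
  { intros k Hk. unfold a. destruct (le_dec j k); [lia|reflexivity]. }
  unfold power_jet. rewrite Cmult_comm.
  eapply is_series_cext; [|apply is_series_cmult_l, CSeries_correct,
    (ex_series_power (fun n => e (n + j)%nat) r)].
  - intros n. cbv beta. unfold a. destruct (le_dec j (n + j)); [|lia].
    replace (n + j - j)%nat with n by lia. ring.
  - now apply egf_radius_ge_shift.
  - lra.
Qed.

(** The case of order zero for the sequence n -> e (n + k), whose derivatives are those of the
    original function with order raised by k. *)
Lemma power_jet_taylor e r c h k :
  egf_radius_ge e r -> (Cmod c + Cmod h < r)%R ->
  is_series (fun j => power_jet e (k + j) c * divpow h j) (power_jet e k (c + h)).
Proof.
  intros He Hch.
  pose proof (power_jet_taylor0 _ r c h (egf_radius_ge_shift e r k He) Hch) as H.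
  assert (E : forall j x, power_jet (fun n => e (n + k)%nat) j x = power_jet e (k + j) x).
  { intros j x. unfold power_jet. f_equal. apply FunctionalExtensionality.functional_extensionality.
    intros n. f_equal. f_equal. lia. }
  rewrite E, Nat.add_0_r in H.
  eapply is_series_cext; [|exact H]. intros j. cbv beta. now rewrite E.
Qed.

(** * The right-hand side: majorants and re-expansion *)

Lemma Cmod_poch_S a n : Cmod (poch a (S n)) = (Cmod (poch a n) * Cmod (a + natC n))%R.
Proof. simpl. apply Cmod_mult. Qed.

Lemma poch_nonneg (M j : nat) : poch (natC M) j = Cmod (poch (natC M) j).
Proof.
  induction j; [simpl; now rewrite Cmod_1|].
  rewrite Cmod_poch_S, RtoC_mult, <- IHj, <- natC_plus, Cmod_natC. simpl.
  now rewrite <- natC_plus.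
Qed.

Lemma Cmod_poch_le nu M j :
  (Cmod nu <= INR M)%R -> (Cmod (poch nu j) <= Cmod (poch (natC M) j))%R.
Proof.
  intros H. induction j; [simpl; lra|]. rewrite !Cmod_poch_S.
  apply Rmult_le_compat; try apply Cmod_ge_0; [exact IHj|].
  rewrite <- natC_plus, Cmod_natC, plus_INR.
  pose proof (Cmod_plus_natC_le nu j). lra.
Qed.

(** Since |(nu)_j| <= (M)_j, the sum is majorized by the binomial series of (1 - |u|)^(- M). An
    integer M makes the bound an ordinary power, hence geometric in m when M = L + N m. *)
Lemma binomial_term_abs_sum nu u M n :
  (Cmod u < 1)%R -> (Cmod nu <= INR M)%R ->
  (sum_n (fun j => Cmod (binomial_term nu u j)) n <= / (1 - Cmod u) ^ M)%R.
Proof.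
  intros Hu HM. pose proof (Cmod_ge_0 u).
  pose (x := fun j => (Cmod (poch (natC M) j) / INR (fact j) * Cmod u ^ j)%R).
  apply Rle_trans with (sum_n x n).
  { apply rsum_le. intros j _. unfold binomial_term, x.
    rewrite Cmod_mult, Cmod_div, Cmod_natC, Cmod_pow by apply natC_fact_neq0.
    apply Rmult_le_compat_r; [now apply pow_le|].
    apply Rmult_le_compat_r; [left; apply Rinv_0_lt_compat, INR_fact_lt_0|].
    now apply Cmod_poch_le. }
  assert (Hs : is_series x (/ (1 - Cmod u) ^ M)%R).
  { pose proof (binomial_series_Cpower 1 (1 - Cmod u) (natC M)) as B.
    assert (H1 : (0 < Re 1)%R) by (simpl; lra).
    assert (H2 : (0 < Re (1 - Cmod u))%R) by (simpl; lra).
    assert (E : 1 - (1 - Cmod u) = Cmod u) by ring.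
    rewrite E, Cmod_1, Cmod_R, Rabs_pos_eq in B by assumption.
    specialize (B H1 H2 Hu). apply is_series_cvgC in B.
    apply (is_lim_seq_spec _ (Finite _)). intros eps.
    destruct (B eps (cond_pos eps)) as [N HN]. exists N. intros k Hk.
    specialize (HN k Hk).
    assert (E2 : forall w nn, (0 < Re w)%R -> Cpower w (- natC nn) = / Cpow w nn).
    { intros w nn Hw. pose proof (Cpower_opp_natC w 0 nn Hw) as E2.
      rewrite Cplus_0_l in E2. rewrite E2.
      replace (- 0) with (RtoC 0) by ring. rewrite Cpower_0. ring. }
    rewrite !E2, Cpow_1_l in HN by assumption.
    rewrite <- Cmod_R. rewrite RtoC_minus, sum_n_RtoC, RtoC_inv.
    rewrite RtoC_pow, RtoC_minus.
    replace (sum_n (fun j => RtoC (x j)) k) with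
      (sum_n (fun j => / 1 * binomial_term (natC M) (Cmod u / 1) j) k); [exact HN|].
    apply csum_ext. intros j _. unfold x, binomial_term.
    rewrite RtoC_mult, RtoC_div, RtoC_pow, <- poch_nonneg.
    replace (Cmod u / 1) with (RtoC (Cmod u)) by field.
    unfold natC at 2. field. apply natC_fact_neq0.
    { apply INR_fact_neq_0. }
    apply pow_nonzero. lra. }
  apply is_series_partial_le; [|exact Hs].
  intros k. unfold x. apply Rmult_le_pos; [|now apply pow_le].
  apply Rmult_le_pos; [apply Cmod_ge_0|]. left. apply Rinv_0_lt_compat, INR_fact_lt_0.
Qed.

(** The power series with coefficients [B] has radius of convergence at least W, expressed by
    bounded terms strictly inside. *)
Definition radius_ge (B : nat -> C) (W : R) : Prop :=
  forall v, (0 < v < W)%R -> exists M, (0 < M)%R /\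
    forall m, (Cmod (B m) * v ^ m <= M)%R.

Lemma radius_ge_dominated B W v :
  radius_ge B W -> (0 <= v < W)%R -> ex_series (fun m => Cmod (B m) * v ^ m)%R.
Proof.
  intros H Hx. destruct (H ((v + W) / 2)%R ltac:(lra)) as (M & HM & Hb).
  set (q := ((v + W) / 2)%R) in *. assert (Hq : (v < q)%R) by (unfold q; lra).
  assert (Hq0 : (0 < q)%R) by lra. clearbody q.
  apply ex_series_pow_bound with (v / q)%R M.
  - split; [apply Rmult_le_pos; [lra|]; left; apply Rinv_0_lt_compat; lra|].
    apply Rmult_lt_reg_r with q; [lra|]. unfold Rdiv.
    rewrite Rmult_assoc, Rinv_l; lra.
  - intros n. specialize (Hb n). pose proof (Cmod_ge_0 (B n)).
    rewrite Rabs_pos_eq by (apply Rmult_le_pos; [lra|apply pow_le; lra]).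
    assert (Hp : (0 < q ^ n)%R) by (apply pow_lt; lra).
    rewrite pow_div by lra.
    replace (Cmod (B n) * v ^ n)%R
      with (Cmod (B n) * q ^ n * (v ^ n / q ^ n))%R by (field; lra).
    apply Rmult_le_compat_r; [|exact Hb].
    apply Rmult_le_pos; [apply pow_le; lra|]. left. now apply Rinv_0_lt_compat.
Qed.

(** Each differentiation in c brings down a factor linear in m, which a slightly larger v
    absorbs. *)
Lemma radius_ge_linear B W a N k :
  radius_ge B W -> radius_ge (fun m => B m * (a + natC (N * m) + natC k)) W.
Proof.
  intros H v Hv. destruct (H ((v + W) / 2)%R ltac:(lra)) as (M & HM & Hb).
  set (q := ((v + W) / 2)%R) in *. assert (Hq : (v < q)%R) by (unfold q; lra).
  assert (Hq0 : (0 < q)%R) by lra. clearbody q.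
  assert (Hqq : (0 <= v / q < 1)%R).
  { split; [apply Rmult_le_pos; [lra|]; left; apply Rinv_0_lt_compat; lra|].
    apply Rmult_lt_reg_r with q; [lra|]. unfold Rdiv.
    rewrite Rmult_assoc, Rinv_l; lra. }
  destruct (linear_geometric_bounded _ Hqq) as (K & HK & Hl).
  set (L := (Cmod a + INR N + INR k + 1)%R).
  pose proof (Cmod_ge_0 a). pose proof (pos_INR N). pose proof (pos_INR k).
  assert (HL : (0 < L)%R) by (unfold L; lra).
  exists (M * (L * K))%R. split; [repeat apply Rmult_lt_0_compat; assumption|].
  intros m. specialize (Hb m). specialize (Hl m).
  assert (Hp : (0 < q ^ m)%R) by (apply pow_lt; lra).
  assert (Hpv : (0 <= (v / q) ^ m)%R) by (apply pow_le; lra).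
  assert (Ha : (Cmod (a + natC (N * m) + natC k) <= L * INR (S m))%R).
  { eapply Rle_trans; [apply Cmod_plus_natC_le|].
    pose proof (Cmod_plus_natC_le a (N * m)) as H3.
    rewrite mult_INR in H3. rewrite S_INR. pose proof (pos_INR m). unfold L. nra. }
  rewrite Cmod_mult.
  replace (Cmod (B m) * Cmod (a + natC (N * m) + natC k) * v ^ m)%R
    with (Cmod (B m) * q ^ m * (Cmod (a + natC (N * m) + natC k) * (v / q) ^ m))%R
    by (rewrite pow_div by lra; field; lra).
  pose proof (Cmod_ge_0 (B m)). pose proof (Cmod_ge_0 (a + natC (N * m) + natC k)).
  apply Rmult_le_compat; [apply Rmult_le_pos; lra|apply Rmult_le_pos; lra|exact Hb|].
  apply Rle_trans with (L * INR (S m) * (v / q) ^ m)%R.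
  - now apply Rmult_le_compat_r.
  - rewrite Rmult_assoc. apply Rmult_le_compat_l; lra.
Qed.

Lemma radius_ge_poch B W a N k :
  radius_ge B W -> radius_ge (fun m => B m * poch (a + natC (N * m)) k) W.
Proof.
  intros H. induction k.
  - intros v Hv. destruct (H v Hv) as (M & HM & Hb). exists M. split; [exact HM|].
    intros m. simpl. now rewrite Cmult_1_r.
  - apply (radius_ge_linear _ W a N k) in IHk.
    intros v Hv. destruct (IHk v Hv) as (M & HM & Hb). exists M. split; [exact HM|].
    intros m. simpl. now rewrite Cmult_assoc.
Qed.

Lemma poch_add a m n : poch a (m + n) = poch a m * poch (a + natC m) n.
Proof.
  induction n.
  - rewrite Nat.add_0_r. simpl. ring.
  - rewrite Nat.add_succ_r. simpl. rewrite IHn, natC_plus. ring.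
Qed.

(* [k]-th derivative in [c] of [sum_m B m * (1 - c) ^ (- (lambda + N m))]. *)
Definition shifted_jet (B : nat -> C) (lambda : C) (N k : nat) (c : C) : C :=
  CSeries (fun m => B m * poch (lambda + natC (N * m)) k
    * Cpower (1 - c) (- (lambda + natC (N * m) + natC k))).

Lemma Re_1_minus_pos (c : C) : (Cmod c < 1)%R -> (0 < Re (1 - c))%R.
Proof.
  intros H. pose proof (re_le_Cmod c) as Hr. pose proof (Rle_abs (Re c)).
  destruct c as [x y]. simpl in *. lra.
Qed.

(** The modulus is geometric in m with ratio |1 - c|^(- N), which is why W |1 - c|^N > 1 is the
    convergence condition on the right. *)
Lemma Cmod_Cpower_shift (c lambda : C) (N m : nat) :
  (Cmod c < 1)%R ->
  Cmod (Cpower (1 - c) (- (lambda + natC (N * m))))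
  = (Cmod (Cpower (1 - c) (- lambda)) * (/ Cmod (1 - c) ^ N) ^ m)%R.
Proof.
  intros Hc. pose proof (Re_1_minus_pos c Hc) as Hre.
  rewrite Cpower_opp_natC, Cmod_mult by exact Hre.
  rewrite Cmod_inv by (now apply Cpow_nz, Cneq0_Re).
  rewrite Cmod_pow, pow_inv, <- pow_mult. reflexivity.
Qed.

Lemma ex_series_shifted B W lambda N c :
  radius_ge B W -> (Cmod c < 1)%R -> (1 < W * Cmod (1 - c) ^ N)%R ->
  ex_series (fun m => B m * Cpower (1 - c) (- (lambda + natC (N * m)))).
Proof.
  intros HB Hc HW.
  assert (Hg : (0 < Cmod (1 - c) ^ N)%R).
  { apply pow_lt. apply Cmod_gt_0. now apply Cneq0_Re, Re_1_minus_pos. }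
  set (v := (/ Cmod (1 - c) ^ N)%R).
  assert (Hv : (0 <= v < W)%R).
  { split; [left; now apply Rinv_0_lt_compat|].
    apply Rmult_lt_reg_r with (Cmod (1 - c) ^ N)%R; [exact Hg|].
    unfold v. rewrite Rinv_l; lra. }
  eapply ex_series_cmod_le;
    [|apply (ex_series_scal (V := R_NormedModule) (Cmod (Cpower (1 - c) (- lambda))));
      exact (radius_ge_dominated B W v HB Hv)].
  intros m. rewrite Cmod_mult, Cmod_Cpower_shift by exact Hc.
  fold v. unfold scal. simpl. unfold mult. simpl. right. ring.
Qed.

(** Each power of 1 - c - h is expanded by the binomial series about 1 - c, with u = h / (1 - c),
    and the sums are interchanged. The absolute majorant is geometric in m with ratio (|1 - c| -
    |h|)^(- N), whence the last hypothesis. *)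
Lemma shifted_jet_taylor0 B W lambda N c h :
  radius_ge B W -> (Cmod c < 1)%R -> (Cmod (c + h) < 1)%R ->
  (Cmod h < Cmod (1 - c))%R -> (1 < W * (Cmod (1 - c) - Cmod h) ^ N)%R ->
  is_series (fun j => shifted_jet B lambda N j c * divpow h j)
    (shifted_jet B lambda N 0 (c + h)).
Proof.
  intros HB Hc Hch Hh HW.
  pose proof (Re_1_minus_pos c Hc) as Hre. pose proof (Re_1_minus_pos _ Hch) as Hre'.
  assert (Hne : 1 - c <> 0) by now apply Cneq0_Re.
  assert (Hg : (0 < Cmod (1 - c))%R) by now apply Cmod_gt_0.
  pose proof (Cmod_ge_0 h) as Hh0.
  set (u := h / (1 - c)).
  assert (Eu : Cmod u = (Cmod h / Cmod (1 - c))%R) by now apply Cmod_div.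
  assert (Hu : (Cmod u < 1)%R).
  { rewrite Eu. apply Rmult_lt_reg_r with (Cmod (1 - c)); [exact Hg|].
    unfold Rdiv. rewrite Rmult_assoc, Rinv_l; lra. }
  pose (mu := fun m => lambda + natC (N * m)).
  pose (P := fun m => Cpower (1 - c) (- mu m)).
  pose (a := fun m j => B m * P m * binomial_term (mu m) u j).
  assert (Ea : forall m j, a m j = B m * poch (mu m) j
    * Cpower (1 - c) (- (mu m + natC j)) * divpow h j).
  { intros m j. unfold a, P, binomial_term, divpow, u.
    rewrite (Cpower_opp_natC (1 - c) (mu m) j Hre).
    unfold Cdiv at 2. rewrite Cpow_mult_l, Cpow_inv by exact Hne.
    field. split; [apply natC_fact_neq0|]. now apply Cpow_nz. }
  assert (Hrow : forall m, is_series (a m) (B m * Cpower (1 - (c + h)) (- mu m))).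
  { intros m.
    pose proof (binomial_series_Cpower (1 - c) (1 - (c + h)) (mu m) Hre Hre') as H.
    replace (1 - c - (1 - (c + h))) with h in H by ring.
    specialize (H Hh). fold u in H. fold (P m) in H.
    eapply is_series_cext; [|apply is_series_cmult_l, H].
    intros j. unfold a. cbv beta. ring. }
  (* L + N m is then an integer bound for the modulus of the exponent [mu m]. *)
  destruct (exists_nat_ge (Cmod lambda)) as [L HL].
  set (v := (/ (Cmod (1 - c) - Cmod h) ^ N)%R).
  assert (Hp : (0 < (Cmod (1 - c) - Cmod h) ^ N)%R) by (apply pow_lt; lra).
  assert (Hv : (0 <= v < W)%R).
  { split; [left; now apply Rinv_0_lt_compat|].
    apply Rmult_lt_reg_r with ((Cmod (1 - c) - Cmod h) ^ N)%R; [exact Hp|].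
    unfold v. rewrite Rinv_l; lra. }
  set (K := (Cmod (Cpower (1 - c) (- lambda)) * / (1 - Cmod u) ^ L)%R).
  assert (HM : forall m n, (sum_n (fun k => Cmod (a m k)) n <= K * (Cmod (B m) * v ^ m))%R).
  { intros m n.
    rewrite (sum_n_ext _ (fun k => Cmod (B m * P m) * Cmod (binomial_term (mu m) u k))%R)
      by (intros k; unfold a; apply Cmod_mult).
    rewrite rsum_mult_l.
    apply Rle_trans with (Cmod (B m * P m) * / (1 - Cmod u) ^ (L + N * m))%R.
    - apply Rmult_le_compat_l; [apply Cmod_ge_0|].
      apply binomial_term_abs_sum; [exact Hu|].
      unfold mu. eapply Rle_trans; [apply Cmod_plus_natC_le|].
      rewrite plus_INR. lra.
    (* Because |1 - c| (1 - |u|) = |1 - c| - |h|, the factors with exponent N m combine to v^m; the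
       others form K. *)
    - right. rewrite Cmod_mult. unfold P, mu. rewrite Cmod_Cpower_shift by exact Hc.
      unfold K, v. rewrite pow_add, pow_mult.
      replace (Cmod (1 - c) - Cmod h)%R with (Cmod (1 - c) * (1 - Cmod u))%R
        by (rewrite Eu; field; lra).
      rewrite Rpow_mult_distr, Rinv_mult, Rinv_mult, Rpow_mult_distr.
      rewrite <- !pow_inv. ring. }
  destruct (is_series_double a _ HM) as (_ & _ & Hs & _).
  { apply (ex_series_scal (V := R_NormedModule) K).
    now apply radius_ge_dominated with W. }
  assert (Ep : shifted_jet B lambda N 0 (c + h) = CSeries (fun m => CSeries (a m))).
  { unfold shifted_jet. f_equal. apply functional_extensionality. intros m.
    rewrite (CSeries_unique _ _ (Hrow m)). simpl.
    fold (mu m). replace (mu m + natC 0) with (mu m) by (unfold natC; simpl; ring).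
    ring. }
  rewrite Ep. eapply is_series_cext; [|exact Hs].
  intros j. cbv beta. apply CSeries_unique.
  rewrite Cmult_comm. unfold shifted_jet.
  eapply is_series_cext; [|apply is_series_cmult_l, CSeries_correct].
  - intros m. cbv beta. rewrite Ea. unfold mu. ring.
  - pose proof (ex_series_shifted (fun m => B m * poch (mu m) j) W (lambda + natC j) N c) as H.
    destruct H as [l H].
    + now apply radius_ge_poch.
    + exact Hc.
    + eapply Rlt_le_trans; [exact HW|]. apply Rmult_le_compat_l; [lra|].
      apply pow_incr. lra.
    + exists l. eapply is_series_cext; [|exact H]. intros m. cbv beta. unfold mu.
      do 3 f_equal. ring.
Qed.

(** By (mu)_(k+j) = (mu)_k (mu + k)_j, the k-th derivative is a series of the same kind, with
    coefficients B_m (mu_m)_k and parameter lambda + k; the case of order zero applies to it. *)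
Lemma shifted_jet_taylor B W lambda N c h k :
  radius_ge B W -> (Cmod c < 1)%R -> (Cmod (c + h) < 1)%R ->
  (Cmod h < Cmod (1 - c))%R -> (1 < W * (Cmod (1 - c) - Cmod h) ^ N)%R ->
  is_series (fun j => shifted_jet B lambda N (k + j) c * divpow h j)
    (shifted_jet B lambda N k (c + h)).
Proof.
  intros HB Hc Hch Hh HW.
  assert (E : forall j x, shifted_jet (fun m => B m * poch (lambda + natC (N * m)) k)
    (lambda + natC k) N j x = shifted_jet B lambda N (k + j) x).
  { intros j x. unfold shifted_jet. f_equal. apply functional_extensionality.
    intros m. rewrite poch_add.
    replace (lambda + natC k + natC (N * m)) with (lambda + natC (N * m) + natC k) by ring.
    rewrite natC_plus.
    replace (lambda + natC (N * m) + (natC k + natC j))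
      with (lambda + natC (N * m) + natC k + natC j) by ring. ring. }
  pose proof (shifted_jet_taylor0 _ W (lambda + natC k) N c h
    (radius_ge_poch B W lambda N k HB) Hc Hch Hh HW) as H.
  rewrite E, Nat.add_0_r in H.
  eapply is_series_cext; [|exact H]. intros j. cbv beta. now rewrite E.
Qed.

(** * Analytic continuation *)

(** Equality is carried in all orders at once: the values alone at c + h would not suffice for the
    next step. *)
Lemma taylor_propagate (phi psi : nat -> C -> C) (c h : C) :
  (forall k, is_series (fun j => phi (k + j)%nat c * divpow h j) (phi k (c + h))) ->
  (forall k, is_series (fun j => psi (k + j)%nat c * divpow h j) (psi k (c + h))) ->
  (forall k, phi k c = psi k c) -> forall k, phi k (c + h) = psi k (c + h).
Proof.
  intros Hf Hg E k. apply (is_series_cunique _ _ _ (Hf k)).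
  eapply is_series_cext; [|apply Hg]. intros j. cbv beta. now rewrite E.
Qed.

Lemma taylor_continue (phi psi : nat -> C -> C) (a b : C) (delta : R) :
  (0 < delta)%R ->
  (forall s h, (0 <= s <= 1)%R -> (Cmod h < delta)%R ->
    (forall k, is_series (fun j => phi (k + j)%nat (a + RtoC s * (b - a)) * divpow h j)
      (phi k (a + RtoC s * (b - a) + h))) /\
    (forall k, is_series (fun j => psi (k + j)%nat (a + RtoC s * (b - a)) * divpow h j)
      (psi k (a + RtoC s * (b - a) + h)))) ->
  (forall k, phi k a = psi k a) -> forall k, phi k b = psi k b.
Proof.
  intros Hd H Ha.
  (* The summand 1 makes n positive and the step |b - a| / n strictly shorter than [delta]. *)
  destruct (exists_nat_ge (Cmod (b - a) / delta + 1)) as [n Hn].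
  pose proof (Cmod_ge_0 (b - a)) as Hba.
  assert (H0 : (0 <= Cmod (b - a) / delta)%R).
  { apply Rmult_le_pos; [lra|]. left. now apply Rinv_0_lt_compat. }
  assert (Hn0 : (0 < INR n)%R) by lra.
  assert (Hstep : (Cmod (/ natC n * (b - a)) < delta)%R).
  { rewrite Cmod_mult, Cmod_inv, Cmod_natC.
    2:{ intros E. apply RtoC_inj in E. lra. }
    apply Rmult_lt_reg_l with (INR n); [lra|].
    rewrite <- Rmult_assoc, Rinv_r, Rmult_1_l by lra.
    replace (Cmod (b - a)) with (Cmod (b - a) / delta * delta)%R by (field; lra).
    apply Rmult_lt_compat_r; lra. }
  assert (HnC : natC n <> 0) by (intros E; apply RtoC_inj in E; lra).
  assert (Hi : forall i, (i <= n)%nat -> forall k,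
    phi k (a + RtoC (INR i / INR n) * (b - a)) = psi k (a + RtoC (INR i / INR n) * (b - a))).
  { induction i; intros Hi.
    - intros k. replace (a + RtoC (INR 0 / INR n) * (b - a)) with a; [apply Ha|].
      simpl INR. unfold Rdiv. rewrite Rmult_0_l. ring.
    - specialize (IHi ltac:(lia)).
      destruct (H (INR i / INR n)%R (/ natC n * (b - a))) as [H1 H2]; [|exact Hstep|].
      { apply le_INR in Hi. rewrite S_INR in Hi. pose proof (pos_INR i).
        split; [apply Rmult_le_pos; [lra|]; left; now apply Rinv_0_lt_compat|].
        apply Rmult_le_reg_r with (INR n); [lra|]. unfold Rdiv.
        rewrite Rmult_assoc, Rinv_l; lra. }
      pose proof (taylor_propagate phi psi _ _ H1 H2 IHi) as H3.
      replace (a + RtoC (INR (S i) / INR n) * (b - a))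
        with (a + RtoC (INR i / INR n) * (b - a) + / natC n * (b - a)); [exact H3|].
      rewrite !RtoC_div by lra. fold (natC i) (natC n) (natC (S i)).
      rewrite natC_S. field. exact HnC. }
  intros k. specialize (Hi n (le_n _) k).
  replace (INR n / INR n)%R with 1%R in Hi by (field; lra).
  replace (a + 1%R * (b - a)) with b in Hi by ring. exact Hi.
Qed.

Lemma Cpower_1_l nu : Cpower 1 nu = 1.
Proof.
  unfold Cpower. change (RtoC 1) with ((1, 0)%R : C) at 1.
  rewrite Clog_explicit by lra.
  replace (ln (1 ^ 2 + 0 ^ 2) / 2)%R with 0%R
    by (replace (1 ^ 2 + 0 ^ 2)%R with 1%R by ring; rewrite ln_1; field).
  replace (0 / 1)%R with 0%R by field. rewrite atan_0.
  change ((0, 0)%R : C) with (RtoC 0). rewrite Cmult_0_r. apply Cexp_0.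
Qed.

Lemma power_jet_0 e k : power_jet e k 0 = e k.
Proof.
  apply CSeries_unique.
  replace (e k) with (sum_n (fun n => e (n + k)%nat * divpow 0 n) 0 : C).
  - apply is_series_finite. intros n Hn. destruct n; [lia|].
    unfold divpow. rewrite Cpow_S. unfold Cdiv. ring.
  - rewrite csum_O. rewrite divpow_0. simpl. ring.
Qed.

Lemma shifted_jet_0 B lambda N k :
  shifted_jet B lambda N k 0 = CSeries (fun m => B m * poch (lambda + natC (N * m)) k).
Proof.
  unfold shifted_jet. f_equal. apply functional_extensionality. intros m.
  replace (1 - 0) with (RtoC 1) by ring. rewrite Cpower_1_l. ring.
Qed.

Lemma Cmod_sqr (z : C) : (Cmod z ^ 2 = Re z ^ 2 + Im z ^ 2)%R.
Proof. apply Cmod2_alt. Qed.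

Lemma Cmod_le_sqr (z w : C) :
  (Re z ^ 2 + Im z ^ 2 <= Re w ^ 2 + Im w ^ 2)%R -> (Cmod z <= Cmod w)%R.
Proof.
  intros H. rewrite <- !Cmod_sqr in H.
  apply Rsqr_incr_0_var; [unfold Rsqr; lra|apply Cmod_ge_0].
Qed.

(** Continuity leaves room below the distance g; this margin becomes the uniform step length on the
    path. *)
Lemma pow_gt1_margin (W g : R) N :
  (0 < g)%R -> (1 < W * g ^ N)%R ->
  exists d, (0 < d < g)%R /\ (1 < W * (g - d) ^ N)%R.
Proof.
  intros Hg HW.
  assert (Hc : continuous (fun x : R => W * x ^ N)%R g).
  { apply (ex_derive_continuous (fun x : R => W * x ^ N)%R g). auto_derive. exact I. }
  assert (He : (0 < W * g ^ N - 1)%R) by lra.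
  specialize (Hc (fun y => 1 < y)%R).
  assert (Hl : locally (W * g ^ N)%R (fun y => 1 < y)%R).
  { exists (mkposreal _ He). intros y Hy. apply Rabs_def2 in Hy.
    unfold minus, plus, opp in Hy. simpl in Hy. lra. }
  destruct (Hc Hl) as [d Hd].
  pose proof (cond_pos d) as Hd0.
  exists (Rmin (d / 2) (g / 2)).
  assert (0 < Rmin (d / 2) (g / 2))%R by (apply Rmin_pos; lra).
  pose proof (Rmin_l (d / 2) (g / 2)). pose proof (Rmin_r (d / 2) (g / 2)).
  split; [lra|]. apply Hd. apply Rabs_def1; unfold minus, plus, opp; simpl; lra.
Qed.

(* Both sides are continued analytically from [0] along the polygon with vertices
   [0], [- |tau|], [tau]; on it [|c| <= |tau|] and [|1 - c| >= min 1 |1 - tau|]. *)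
Lemma jets_agree e B lambda N W r tau :
  (forall n, e n = CSeries (fun m => B m * poch (lambda + natC (N * m)) n)) ->
  egf_radius_ge e r -> (r <= 1)%R -> radius_ge B W -> (1 < W)%R ->
  (Cmod tau < r)%R -> (1 < W * Cmod (1 - tau) ^ N)%R ->
  forall k, power_jet e k tau = shifted_jet B lambda N k tau.
Proof.
  intros He Hr Hr1 HB HW Htau HWt.
  set (rho := Cmod tau). assert (Hrho : (0 <= rho)%R) by apply Cmod_ge_0.
  (* Lower bound for the distance to 1: the value 1 serves the first edge, where c <= 0, and |1 -
     tau| the second. *)
  set (g := Rmin 1 (Cmod (1 - tau))).
  assert (Hg : (0 < g)%R).
  { apply Rmin_pos; [lra|]. apply Cmod_gt_0, Cneq0_Re, Re_1_minus_pos. unfold rho in *. lra. }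
  assert (HWg : (1 < W * g ^ N)%R).
  { unfold g, Rmin. destruct (Rle_dec 1 (Cmod (1 - tau))); [|exact HWt].
    rewrite pow1. lra. }
  destruct (pow_gt1_margin W g N Hg HWg) as (d0 & Hd0 & HWd).
  set (delta := Rmin d0 (r - rho)).
  assert (Hdelta : (0 < delta)%R) by (apply Rmin_pos; unfold rho; lra).
  assert (Hd1 : (delta <= d0)%R) by apply Rmin_l.
  assert (Hd2 : (delta <= r - rho)%R) by apply Rmin_r.
  assert (Hloc : forall c h, (Cmod c <= rho)%R -> (g <= Cmod (1 - c))%R ->
    (Cmod h < delta)%R ->
    (forall k, is_series (fun j => power_jet e (k + j) c * divpow h j)
      (power_jet e k (c + h))) /\
    (forall k, is_series (fun j => shifted_jet B lambda N (k + j) c * divpow h j)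
      (shifted_jet B lambda N k (c + h)))).
  { intros c h Hc Hgc Hh. pose proof (Cmod_triangle c h). split; intros k.
    - apply power_jet_taylor with r; [exact Hr|lra].
    - apply shifted_jet_taylor with W; [exact HB|lra|lra|lra|].
      eapply Rlt_le_trans; [exact HWd|]. apply Rmult_le_compat_l; [lra|].
      apply pow_incr. lra. }
  assert (Hmid : forall k, power_jet e k (RtoC (- rho)) = shifted_jet B lambda N k (RtoC (- rho))).
  { apply taylor_continue with (RtoC 0) delta; [exact Hdelta| |].
    - intros s h Hs Hh.
      replace (0 + s * (RtoC (- rho) - 0)) with (RtoC (- (s * rho)))
        by (rewrite !RtoC_opp, RtoC_mult; ring).
      apply Hloc; [| |exact Hh].
      + rewrite Cmod_R, Rabs_Ropp, Rabs_pos_eq by nra. nra.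
      + rewrite <- RtoC_minus, Cmod_R, Rabs_pos_eq by nra.
        pose proof (Rmin_l 1 (Cmod (1 - tau))). unfold g. nra.
    - intros k. now rewrite power_jet_0, shifted_jet_0, He. }
  apply taylor_continue with (RtoC (- rho)) delta; [exact Hdelta| |exact Hmid].
  intros s h Hs Hh.
  pose proof (Cmod_sqr tau) as Hsq. fold rho in Hsq.
  assert (Hrho1 : (rho < 1)%R) by (unfold rho; lra).
  assert (Hre : (- rho <= Re tau <= rho)%R).
  { pose proof (re_le_Cmod tau) as H. fold rho in H. apply Rabs_le_between in H. lra. }
  apply Hloc; [| |exact Hh].
  - apply Rle_trans with (Cmod tau); [|apply Rle_refl].
    apply Cmod_le_sqr. destruct tau as [x y]. simpl in *. clearbody rho. clear - Hs Hsq Hre Hrho.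
    assert (0 <= s * (1 - s))%R by nra.
    assert (0 <= s * (1 - s) * (rho * (x + rho)))%R
      by (apply Rmult_le_pos; [assumption|]; apply Rmult_le_pos; lra). nra.
  (* At c = s tau - (1 - s) rho the difference |1 - c|^2 - |1 - tau|^2 equals 2 (1 - s) (Re tau +
     rho) (1 - rho) + (1 - s)^2 |tau + rho|^2, a sum of nonnegative terms. *)
  - apply Rle_trans with (Cmod (1 - tau)); [apply Rmin_r|].
    apply Cmod_le_sqr. destruct tau as [x y]. simpl in *. clearbody rho.
    clear - Hs Hsq Hre Hrho Hrho1.
    assert (0 <= (1 - s) * ((x + rho) * (1 - rho)))%R
      by (apply Rmult_le_pos; [lra|]; apply Rmult_le_pos; lra).
    assert (0 <= (1 - s) * (1 - s) * ((x + rho) * (x + rho) + y * y))%R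
      by (apply Rmult_le_pos; nra). nra.
Qed.

(** * Boundary values *)

Lemma geom_sum_le (v : R) n :
  (0 <= v < 1)%R -> (sum_n (fun k => v ^ k)%R n <= / (1 - v))%R.
Proof.
  intros Hv. apply is_series_partial_le.
  - intros k. apply pow_le. lra.
  - apply is_series_geom. rewrite Rabs_pos_eq; lra.
Qed.

(** Summation by parts, with the remainders s_k - s in place of the partial sums s_k, so that the
    factors are small for large k. *)
Lemma abel_partial (c : nat -> C) (s V : C) n :
  sum_n (fun k => c k * Cpow V k) n - s
  = (1 - V) * sum_n (fun k => (sum_n c k - s) * Cpow V k) n
    + (sum_n c n - s) * Cpow V (S n).
Proof.
  induction n.
  - rewrite !csum_O. simpl. ring.
  - rewrite !csum_S in *.
    transitivity (sum_n (fun k => c k * Cpow V k) n - s + c (S n) * Cpow V (S n)); [ring|].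
    rewrite IHn. rewrite !Cpow_S. ring.
Qed.

(** Abel's limit theorem in a Stolz angle. After summation by parts the first remainders contribute
    at most A |1 - V|, which tends to 0, and the later ones at most e1 |1 - V| / (1 - |V|) <= e1
    K. *)
Lemma abel_stolz (c V S : nat -> C) (s : C) (K : R) :
  is_series c s -> (forall i, is_series (fun n => c n * Cpow (V i) n) (S i)) ->
  (0 <= K)%R -> (forall i, (Cmod (V i) < 1)%R) ->
  (forall i, (Cmod (1 - V i) <= K * (1 - Cmod (V i)))%R) ->
  cvgC V 1 -> cvgC S s.
Proof.
  intros Hc HS HK HV1 HVK HV eps He.
  apply is_series_cvgC in Hc.
  (* The tail costs e1 K and the last boundary term e1, together eps / 3. *)
  set (e1 := (eps / (3 * (K + 1)))%R).
  assert (He1 : (0 < e1)%R) by (apply Rdiv_lt_0_compat; lra).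
  assert (Ee1 : (e1 * (K + 1) = eps / 3)%R) by (unfold e1; field; lra).
  destruct (Hc e1 He1) as [N0 HN0].
  assert (HR0 : exists R0, (0 < R0)%R /\ forall n, (Cmod (sum_n c n - s) <= R0)%R).
  { clear - HN0 He1.
    assert (HB : exists M, (0 < M)%R /\ forall n, (n <= N0)%nat -> (Cmod (sum_n c n - s) <= M)%R).
    { clear HN0 He1. induction N0.
      - exists (Cmod (sum_n c 0 - s) + 1)%R. pose proof (Cmod_ge_0 (sum_n c 0 - s)).
        split; [lra|]. intros n Hn. replace n with 0%nat by lia. lra.
      - destruct IHN0 as (M & HM & H). pose proof (Cmod_ge_0 (sum_n c (Datatypes.S N0) - s)).
        exists (M + Cmod (sum_n c (Datatypes.S N0) - s))%R. split; [lra|].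
        intros n Hn. destruct (Nat.eq_dec n (Datatypes.S N0)) as [->|]; [lra|].
        specialize (H n ltac:(lia)). lra. }
    destruct HB as (M & HM & HB). exists (M + e1)%R. split; [lra|].
    intros n. destruct (Nat.le_ge_cases n N0) as [Hn|Hn].
    - specialize (HB n Hn). lra.
    - specialize (HN0 n Hn). lra. }
  destruct HR0 as (R0 & HR0p & HR0).
  set (A := (R0 * INR (Datatypes.S N0))%R).
  assert (HA : (0 < A)%R) by (apply Rmult_lt_0_compat; [exact HR0p|apply lt_0_INR; lia]).
  assert (Hsum : forall i n, (sum_n (fun k => Cmod ((sum_n c k - s) * Cpow (V i) k)) n
    <= A + e1 * / (1 - Cmod (V i)))%R).
  { intros i n. pose proof (HV1 i) as Hv. pose proof (Cmod_ge_0 (V i)) as Hv0.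
    (* The minimum counts the indices k <= n with k <= N0, where only the crude bound R0 is
       available. *)
    apply Rle_trans with (R0 * INR (min (Datatypes.S n) (Datatypes.S N0))
      + e1 * sum_n (fun k => Cmod (V i) ^ k)%R n)%R.
    - assert (Hterm : forall k, (Cmod ((sum_n c k - s) * Cpow (V i) k) <=
        (if le_dec k N0 then R0 else 0) + e1 * Cmod (V i) ^ k)%R).
      { intros k. rewrite Cmod_mult, Cmod_pow.
        assert (Hp : (0 <= Cmod (V i) ^ k <= 1)%R).
        { split; [now apply pow_le|]. rewrite <- (pow1 k). apply pow_incr. lra. }
        specialize (HR0 k). pose proof (Cmod_ge_0 (sum_n c k - s)).
        destruct (le_dec k N0) as [Hk|Hk]; [nra|].
        specialize (HN0 k ltac:(lia)). nra. }
      induction n.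
      + rewrite !rsum_O. specialize (Hterm 0%nat).
        destruct (le_dec 0 N0); [|lia]. simpl in *. lra.
      + rewrite !rsum_S. specialize (Hterm (Datatypes.S n)).
        destruct (le_dec (Datatypes.S n) N0).
        * replace (min (Datatypes.S (Datatypes.S n)) (Datatypes.S N0))
            with (Datatypes.S (Datatypes.S n)) by lia.
          replace (min (Datatypes.S n) (Datatypes.S N0)) with (Datatypes.S n) in IHn by lia.
          rewrite (S_INR (Datatypes.S n)). lra.
        * replace (min (Datatypes.S (Datatypes.S n)) (Datatypes.S N0))
            with (Datatypes.S N0) by lia.
          replace (min (Datatypes.S n) (Datatypes.S N0)) with (Datatypes.S N0) in IHn by lia.
          lra.
    - apply Rplus_le_compat.
      + unfold A. apply Rmult_le_compat_l; [lra|]. apply le_INR. lia.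
      + apply Rmult_le_compat_l; [lra|]. apply geom_sum_le. lra. }
  assert (HeA : (0 < eps / (3 * A))%R) by (apply Rdiv_lt_0_compat; lra).
  destruct (HV _ HeA) as [N1 HN1]. exists N1. intros i Hi.
  specialize (HN1 i Hi).
  assert (Hb : (Cmod (S i - s) <= Cmod (1 - V i) * A + e1 * (K + 1))%R).
  { apply le_epsilon. intros e Hee.
    pose proof (HS i) as H. apply is_series_cvgC in H.
    destruct (H e Hee) as [P HP]. specialize (HP (max P N0) ltac:(lia)).
    set (n := max P N0) in *.
    pose proof (HV1 i) as Hv. pose proof (Cmod_ge_0 (V i)) as Hv0.
    specialize (HN0 n ltac:(lia)). specialize (HVK i).
    pose proof (Hsum i n) as Hs1.
    pose proof (Cmod_csum (fun k => (sum_n c k - s) * Cpow (V i) k) n) as Hs2.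
    replace (S i - s) with (- (sum_n (fun k => c k * Cpow (V i) k) n - S i)
      + (sum_n (fun k => c k * Cpow (V i) k) n - s)) by ring.
    eapply Rle_trans; [apply Cmod_triangle|]. rewrite Cmod_opp.
    rewrite (abel_partial c s).
    assert (Hx : (Cmod ((1 - V i) * sum_n (fun k => ((sum_n c k - s) * Cpow (V i) k)%C) n
       + (sum_n c n - s) * Cpow (V i) (Datatypes.S n)) <=
       Cmod (1 - V i) * (A + e1 * / (1 - Cmod (V i))) + e1)%R).
    { eapply Rle_trans; [apply Cmod_triangle|]. rewrite !Cmod_mult.
      apply Rplus_le_compat.
      - apply Rmult_le_compat_l; [apply Cmod_ge_0|]. lra.
      - rewrite Cmod_pow. rewrite <- (Rmult_1_r e1).
        apply Rmult_le_compat; [apply Cmod_ge_0|now apply pow_le|lra|].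
        rewrite <- (pow1 (Datatypes.S n)). apply pow_incr. lra. }
    assert (Hy : (Cmod (1 - V i) * (e1 * / (1 - Cmod (V i))) <= e1 * K)%R).
    { apply Rle_trans with (K * (1 - Cmod (V i)) * (e1 * / (1 - Cmod (V i))))%R.
      - apply Rmult_le_compat_r; [|exact HVK].
        apply Rmult_le_pos; [lra|]. left. apply Rinv_0_lt_compat. lra.
      - right. field. lra. }
    rewrite Rmult_plus_distr_l in Hx. lra. }
  assert (Hlast : (Cmod (1 - V i) * A < eps / 3)%R).
  { replace (1 - V i) with (- (V i - 1)) by ring. rewrite Cmod_opp.
    apply Rmult_lt_compat_r with (r := A) in HN1; [|exact HA].
    replace (eps / (3 * A) * A)%R with (eps / 3)%R in HN1 by (field; lra). exact HN1. }
  lra.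
Qed.

Lemma cvgC_Cpower_line (a b nu : C) (x : nat -> R) :
  (0 < Re a)%R ->
  (forall d, (0 < d)%R -> exists N, forall i, (N <= i)%nat -> (Rabs (x i) < d)%R) ->
  cvgC (fun i => Cpower (a + x i * b) nu) (Cpower a nu).
Proof.
  intros Ha Hx eps He.
  assert (Ea : a + 0%R * b = a) by ring.
  assert (Ha' : (0 < Re (a + 0%R * b))%R) by now rewrite Ea.
  destruct (is_derive_Cpower a b nu 0 Ha') as [H1 H2].
  assert (C1 : continuous (fun s : R => fst (Cpower (a + s * b) nu)) 0%R)
    by (apply (ex_derive_continuous (fun s : R => fst (Cpower (a + s * b) nu)) 0%R); eexists; exact H1).
  assert (C2 : continuous (fun s : R => snd (Cpower (a + s * b) nu)) 0%R)
    by (apply (ex_derive_continuous (fun s : R => snd (Cpower (a + s * b) nu)) 0%R); eexists; exact H2).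
  assert (He2 : (0 < eps / 2)%R) by lra.
  destruct (proj1 (filterlim_locally _ _) C1 (mkposreal _ He2)) as [d1 Hd1].
  destruct (proj1 (filterlim_locally _ _) C2 (mkposreal _ He2)) as [d2 Hd2].
  destruct (Hx d1 (cond_pos d1)) as [N1 HN1], (Hx d2 (cond_pos d2)) as [N2 HN2].
  exists (max N1 N2). intros i Hi.
  specialize (HN1 i ltac:(lia)). specialize (HN2 i ltac:(lia)).
  specialize (Hd1 (x i)). specialize (Hd2 (x i)).
  rewrite Ea in Hd1, Hd2.
  eapply Rle_lt_trans; [apply Cmod_le_abs|].
  assert (B1 : (Rabs (fst (Cpower (a + x i * b) nu) - fst (Cpower a nu)) < eps / 2)%R).
  { apply Hd1. unfold ball, AbsRing_ball; simpl; unfold AbsRing_ball, abs, minus, plus, opp; simpl.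
    now rewrite Ropp_0, Rplus_0_r. }
  assert (B2 : (Rabs (snd (Cpower (a + x i * b) nu) - snd (Cpower a nu)) < eps / 2)%R).
  { apply Hd2. unfold ball, AbsRing_ball; simpl; unfold AbsRing_ball, abs, minus, plus, opp; simpl.
    now rewrite Ropp_0, Rplus_0_r. }
  change (Rabs (fst (Cpower (a + x i * b) nu) - fst (Cpower a nu))
    + Rabs (snd (Cpower (a + x i * b) nu) - snd (Cpower a nu)) < eps)%R. lra.
Qed.

(** Re d > 0 makes t - x d t move into the disc |c| < |t|; since 1 - (t - x d t) = (1 - t) (1 + x d
    t / (1 - t)), the second condition makes it move away from 1. With k = t / (1 - t) the witness
    is d = |k| + conj k, for which d k has real part |k| (|k| + Re k). It fails only if k is real
    and nonpositive, that is, for real t <= 0. *)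
Lemma exists_transversal_direction (t : C) :
  (Cmod t < 1)%R -> ~ (Im t = 0%R /\ (Re t <= 0)%R) ->
  exists d : C, (0 < Re d)%R /\ (0 < Re (d * t / (1 - t)))%R.
Proof.
  intros Ht Hneg.
  assert (Hne : 1 - t <> 0) by now apply Cneq0_Re, Re_1_minus_pos.
  set (k := t / (1 - t)).
  assert (Hk : (0 < Cmod k + Re k)%R).
  { pose proof (Cmod_ge_0 k) as Hk0. pose proof (re_le_Cmod k) as Hk1.
    destruct (Rtotal_order (Cmod k + Re k) 0) as [H|[H|H]]; [| |exact H].
    - apply Rabs_le_between in Hk1. lra.
    - exfalso.
      pose proof (Cmod_sqr k) as Hsq.
      assert (Hr : Re k = (- Cmod k)%R) by lra.
      assert (Hi : Im k = 0%R) by (rewrite Hr in Hsq; nra).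
      assert (Ek : k = RtoC (- Cmod k)).
      { destruct k as [k1 k2]. simpl in *. subst k2. rewrite <- Hr. reflexivity. }
      assert (Et : k * (1 - t) = t) by (unfold k; field; exact Hne).
      rewrite Ek in Et. clearbody k. clear Ek Hne.
      destruct t as [x y]. simpl in Hneg.
      pose proof (re_le_Cmod (x, y)) as Hx. simpl in Hx. apply Rabs_le_between in Hx.
      pose proof (f_equal fst Et) as E1. pose proof (f_equal snd Et) as E2. simpl in E1, E2.
      apply Hneg. generalize dependent (Cmod k). intros K. intros.
      assert (K <> 1)%R by nra. split; nra. }
  exists (Cmod k + Re k, - Im k)%R. split; [exact Hk|].
  replace ((Cmod k + Re k, - Im k)%R * t / (1 - t)) with (((Cmod k + Re k)%R, (- Im k)%R) * k)
    by (unfold k, Cdiv; ring).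
  pose proof (Cmod_sqr k) as Hsq. pose proof (Cmod_ge_0 k) as Hk0.
  pose proof (re_le_Cmod k) as Hk1. apply Rabs_le_between in Hk1.
  destruct k as [k1 k2]. simpl in *.
  generalize dependent (Cmod (k1, k2)). intros K. intros.
  replace ((K + k1) * k1 - - k2 * k2)%R with (K * (K + k1))%R by nra.
  apply Rmult_lt_0_compat; lra.
Qed.

(** |1 - x d|^2 = 1 - 2 x Re d + x^2 |d|^2 is at most 1 - x Re d, which is at most (1 - x Re d /
    2)^2. The linear gain gives the Stolz condition on the left. *)
Lemma Cmod_segment_le (d : C) (x : R) :
  (0 < Re d)%R -> (0 < x)%R -> (x * Cmod d ^ 2 <= Re d)%R ->
  (Cmod (1 - x * d) <= 1 - x * Re d / 2)%R.
Proof.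
  intros Hd Hx H. pose proof (Cmod_sqr d) as Hsq. rewrite Hsq in H.
  assert (Hxd : (x * Re d <= 1)%R) by nra.
  replace (1 - x * Re d / 2)%R with (Cmod (RtoC (1 - x * Re d / 2)))
    by (rewrite Cmod_R; apply Rabs_pos_eq; lra).
  apply Cmod_le_sqr. destruct d as [a b]. simpl in *. nra.
Qed.

Lemma pow_le_1 (x : R) n : (0 <= x <= 1)%R -> (x ^ n <= 1)%R.
Proof. intros H. rewrite <- (pow1 n). now apply pow_incr. Qed.

(** Induction through 1 - v^(n+1) = (1 - v) + v (1 - v^n). It transfers a Stolz condition from v to
    v^N. *)
Lemma Cmod_1_minus_pow (v : C) n :
  (Cmod v <= 1)%R -> (Cmod (1 - Cpow v n) <= INR n * Cmod (1 - v))%R.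
Proof.
  intros Hv. induction n.
  - simpl Cpow. replace (1 - 1) with (RtoC 0) by ring. rewrite Cmod_0. simpl. lra.
  - rewrite Cpow_S, S_INR.
    replace (1 - v * Cpow v n) with ((1 - v) + v * (1 - Cpow v n)) by ring.
    eapply Rle_trans; [apply Cmod_triangle|]. rewrite Cmod_mult.
    pose proof (Cmod_ge_0 (1 - Cpow v n)). pose proof (Cmod_ge_0 v). nra.
Qed.

(** From 1 - v = x w v and |v| (1 + x Re w) <= 1 one gets 1 - |v| >= x Re w |v|, so that v lies in a
    Stolz angle with constant |w| / Re w. *)
Lemma Cmod_inv_1_plus (w : C) (x : R) :
  (0 < Re w)%R -> (0 < x)%R ->
  let v := / (1 + x * w) in
  1 + x * w <> 0 /\ (Cmod v < 1)%R /\
  (Cmod (1 - v) <= x * Cmod w)%R /\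
  (Cmod (1 - v) <= Cmod w / Re w * (1 - Cmod v))%R.
Proof.
  intros Hw Hx v.
  assert (Hre : Re (1 + x * w) = (1 + x * Re w)%R) by (destruct w; simpl; ring).
  assert (Hp : (0 < x * Re w)%R) by now apply Rmult_lt_0_compat.
  assert (Hne : 1 + x * w <> 0) by (apply Cneq0_Re; lra).
  assert (Hge : (1 + x * Re w <= Cmod (1 + x * w))%R).
  { pose proof (re_le_Cmod (1 + x * w)) as H. rewrite Hre in H.
    apply Rabs_le_between in H. lra. }
  assert (Ev : Cmod v = (/ Cmod (1 + x * w))%R) by (apply Cmod_inv; exact Hne).
  assert (Hv0 : (0 < Cmod v)%R) by (rewrite Ev; apply Rinv_0_lt_compat; lra).
  assert (Hv1 : (Cmod v * (1 + x * Re w) <= 1)%R).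
  { rewrite Ev. apply Rle_trans with (/ Cmod (1 + x * w) * Cmod (1 + x * w))%R.
    - apply Rmult_le_compat_l; [left; rewrite <- Ev; exact Hv0|exact Hge].
    - rewrite Rinv_l; lra. }
  assert (E1 : Cmod (1 - v) = (x * Cmod w * Cmod v)%R).
  { replace (1 - v) with (x * w * v) by (unfold v; field; exact Hne).
    rewrite !Cmod_mult, Cmod_R, Rabs_pos_eq by lra. reflexivity. }
  pose proof (Cmod_ge_0 w) as Hw0.
  split; [exact Hne|]. split; [nra|]. split.
  - rewrite E1. rewrite <- (Rmult_1_r (x * Cmod w)) at 2.
    apply Rmult_le_compat_l; [apply Rmult_le_pos; lra|nra].
  - rewrite E1. apply Rmult_le_reg_r with (Re w); [exact Hw|].
    replace (Cmod w / Re w * (1 - Cmod v) * Re w)%R with (Cmod w * (1 - Cmod v))%R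
      by (field; lra).
    replace (x * Cmod w * Cmod v * Re w)%R with (Cmod w * (Cmod v * (x * Re w)))%R by ring.
    apply Rmult_le_compat_l; [exact Hw0|]. lra.
Qed.

Lemma ex_series_shifted_0 B W N tau :
  radius_ge B W -> (Cmod tau < 1)%R -> (1 < W * Cmod (1 - tau) ^ N)%R ->
  ex_series (fun m => B m / Cpow (1 - tau) (N * m)).
Proof.
  intros HB Ht HW.
  destruct (ex_series_shifted B W 0 N tau HB Ht HW) as [l Hl].
  exists l. eapply is_series_cext; [|exact Hl].
  intros m. cbv beta. rewrite Cpower_opp_natC by now apply Re_1_minus_pos.
  replace (- 0) with (RtoC 0) by ring. rewrite Cpower_0. unfold Cdiv. ring.
Qed.

Lemma shifted_jet_eq B lambda N tau :
  (Cmod tau < 1)%R -> ex_series (fun m => B m / Cpow (1 - tau) (N * m)) ->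
  shifted_jet B lambda N 0 tau
  = Cpower (1 - tau) (- lambda) * CSeries (fun m => B m / Cpow (1 - tau) (N * m)).
Proof.
  intros Ht He. apply CSeries_unique.
  eapply is_series_cext; [|apply is_series_cmult_l, CSeries_correct, He].
  intros m. cbv beta. simpl poch.
  replace (lambda + natC (N * m) + natC 0) with (lambda + natC (N * m))
    by (unfold natC; simpl; ring).
  rewrite Cpower_opp_natC by now apply Re_1_minus_pos. unfold Cdiv. ring.
Qed.

Lemma egf_radius_ge_of_ex_series e (t : C) :
  t <> 0 -> ex_series (fun n => e n * divpow t n) -> egf_radius_ge e (Cmod t).
Proof.
  intros Ht H. destruct (ex_series_bounded _ H) as (K & HK & Hb).
  intros v Hv. exists K. split; [exact HK|]. intros n. specialize (Hb n).
  rewrite Cmod_mult_divpow in Hb. eapply Rle_trans; [|exact Hb].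
  apply Rmult_le_compat_l.
  - apply Rmult_le_pos; [apply Cmod_ge_0|]. left. apply Rinv_0_lt_compat, INR_fact_lt_0.
  - apply pow_incr. lra.
Qed.

Lemma radius_ge_of_bounded B W M :
  (0 < M)%R -> (forall m, (Cmod (B m) * W ^ m <= M)%R) -> radius_ge B W.
Proof.
  intros HM H v Hv. exists M. split; [exact HM|]. intros m.
  eapply Rle_trans; [|apply (H m)].
  apply Rmult_le_compat_l; [apply Cmod_ge_0|]. apply pow_incr. lra.
Qed.

Lemma small_sequence (eta : R) (x : nat -> R) :
  (0 < eta)%R -> (forall i, x i = (eta / INR (S i))%R) ->
  (forall i, (0 < x i <= eta)%R) /\
  forall d, (0 < d)%R -> exists N, forall i, (N <= i)%nat -> (Rabs (x i) < d)%R.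
Proof.
  intros He Ex.
  assert (Hx : forall i, (0 < x i <= eta)%R).
  { intros i. rewrite Ex, S_INR. pose proof (pos_INR i). split.
    - apply Rdiv_lt_0_compat; lra.
    - apply Rmult_le_reg_r with (INR i + 1)%R; [lra|].
      unfold Rdiv. rewrite Rmult_assoc, Rinv_l by lra. nra. }
  split; [exact Hx|]. intros d Hd. destruct (exists_nat_ge (eta / d)) as [n Hn].
  exists n. intros i Hi. rewrite Rabs_pos_eq by (left; apply Hx).
  apply le_INR in Hi. rewrite Ex, S_INR. pose proof (pos_INR i).
  apply Rmult_lt_reg_r with (INR i + 1)%R; [lra|].
  unfold Rdiv at 1. rewrite Rmult_assoc, Rinv_l by lra.
  replace (eta * 1)%R with (eta / d * d)%R by (field; lra). nra.
Qed.

(* Abel summation of both sides at [t]: the points [t - x i * d * t] approach [t]. *)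
Lemma boundary_value e B lambda N W (t d : C) (eta : R) :
  (forall n, e n = CSeries (fun m => B m * poch (lambda + natC (N * m)) n)) ->
  t <> 0 -> (Cmod t < 1)%R ->
  ex_series (fun n => e n * divpow t n) -> radius_ge B W -> (1 < W)%R ->
  (0 < Re d)%R -> (0 < eta)%R -> (eta * Cmod d ^ 2 <= Re d)%R ->
  let tau := fun i : nat => t - RtoC (eta / INR (S i)) * (d * t) in
  (forall i, (1 < W * Cmod (1 - tau i) ^ N)%R) ->
  cvgC (fun i => CSeries (fun m => B m / Cpow (1 - tau i) (N * m)))
    (CSeries (fun m => B m / Cpow (1 - t) (N * m))) ->
  CSeries (fun n => e n * divpow t n)
  = Cpower (1 - t) (- lambda) * CSeries (fun m => B m / Cpow (1 - t) (N * m)).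
Proof.
  intros He Ht0 Ht1 Hex HB HW Hd Heta Hetad tau Htau HG.
  set (x := fun i : nat => (eta / INR (S i))%R).
  destruct (small_sequence eta x Heta (fun i => eq_refl)) as [Hx Hx0].
  assert (Hr : (0 < Cmod t)%R) by now apply Cmod_gt_0.
  (* The quotient of [tau i] by t, which is the variable of Abel's theorem for the left-hand
     series. *)
  pose (V := fun i => 1 - RtoC (x i) * d).
  assert (HVt : forall i, tau i = t * V i) by (intros i; unfold tau, V; fold (x i); ring).
  pose proof (Cmod_ge_0 d) as Hd0.
  assert (HV : forall i, (Cmod (V i) <= 1 - x i * Re d / 2)%R).
  { intros i. apply Cmod_segment_le; [exact Hd|apply Hx|].
    eapply Rle_trans; [|exact Hetad]. apply Rmult_le_compat_r; [apply pow2_ge_0|apply Hx]. }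
  assert (HV1 : forall i, (Cmod (V i) < 1)%R).
  { intros i. specialize (HV i). destruct (Hx i) as [Hxi _].
    assert (0 < x i * Re d)%R by now apply Rmult_lt_0_compat. lra. }
  assert (Htau1 : forall i, (Cmod (tau i) < Cmod t)%R).
  { intros i. rewrite HVt, Cmod_mult. specialize (HV1 i). nra. }
  assert (Hrad : egf_radius_ge e (Cmod t)) by now apply egf_radius_ge_of_ex_series.
  assert (E1V : forall i, Cmod (1 - V i) = (x i * Cmod d)%R).
  { intros i. replace (1 - V i) with (x i * d) by (unfold V; ring).
    rewrite Cmod_mult, Cmod_R, Rabs_pos_eq; [reflexivity|]. left. apply Hx. }
  assert (Hf : cvgC (fun i => power_jet e 0 (tau i)) (CSeries (fun n => e n * divpow t n))).
  { apply (abel_stolz (fun n => e n * divpow t n) V _ _ (2 * Cmod d / Re d)).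
    - now apply CSeries_correct.
    - intros i. eapply is_series_cext;
        [|apply CSeries_correct, (ex_series_power (fun n => e (n + 0)%nat) (Cmod t))].
      + intros n. cbv beta. rewrite Nat.add_0_r, HVt. unfold divpow.
        rewrite Cpow_mult_l. unfold Cdiv. ring.
      + now apply egf_radius_ge_shift.
      + apply Htau1.
    - apply Rmult_le_pos; [lra|]. left. now apply Rinv_0_lt_compat.
    - exact HV1.
    - intros i. rewrite E1V. specialize (HV i).
      apply Rle_trans with (2 * Cmod d / Re d * (x i * Re d / 2))%R; [right; field; lra|].
      apply Rmult_le_compat_l; [|lra].
      apply Rmult_le_pos; [lra|]. left. now apply Rinv_0_lt_compat.
    - intros eps Heps. destruct (Hx0 (eps / (Cmod d + 1))%R) as [n Hn].
      { apply Rdiv_lt_0_compat; lra. }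
      exists n. intros i Hi. specialize (Hn i Hi).
      replace (V i - 1) with (- (1 - V i)) by ring. rewrite Cmod_opp, E1V.
      destruct (Hx i) as [Hxi _]. rewrite Rabs_pos_eq in Hn by lra.
      apply Rmult_lt_compat_r with (r := (Cmod d + 1)%R) in Hn; [|lra].
      replace (eps / (Cmod d + 1) * (Cmod d + 1))%R with eps in Hn by (field; lra).
      rewrite Rmult_plus_distr_l, Rmult_1_r in Hn. lra. }
  (* The points [tau i] lie strictly inside both regions, where the two sides already agree; only
     the passage to the limit on the right remains. *)
  assert (HF : cvgC (fun i => power_jet e 0 (tau i))
    (Cpower (1 - t) (- lambda) * CSeries (fun m => B m / Cpow (1 - t) (N * m)))).
  { apply cvgC_ext with (fun i => Cpower (1 - tau i) (- lambda)
      * CSeries (fun m => B m / Cpow (1 - tau i) (N * m))).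
    { intros i. specialize (Htau1 i).
      rewrite (jets_agree e B lambda N W (Cmod t) (tau i)) by (auto; lra).
      symmetry. apply shifted_jet_eq; [lra|].
      apply ex_series_shifted_0 with W; [exact HB|lra|apply Htau]. }
    apply cvgC_mult; [|exact HG].
    apply cvgC_ext with (fun i => Cpower (1 - t + x i * (d * t)) (- lambda)).
    { intros i. f_equal. unfold tau. fold (x i). ring. }
    apply cvgC_Cpower_line; [now apply Re_1_minus_pos|exact Hx0]. }
  exact (cvgC_unique _ _ _ Hf HF).
Qed.

Lemma resummation e B lambda N (t : C) (q M : R) :
  (forall n, e n = CSeries (fun m => B m * poch (lambda + natC (N * m)) n)) ->
  (1 <= N)%nat -> (Cmod t < 1)%R ->
  ex_series (fun n => e n * divpow t n) ->
  (1 < q)%R -> (forall m, (Cmod (B m) * q ^ m <= M)%R) ->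
  ex_series (fun m => B m / Cpow (1 - t) (N * m)) ->
  CSeries (fun n => e n * divpow t n)
  = Cpower (1 - t) (- lambda) * CSeries (fun m => B m / Cpow (1 - t) (N * m)).
Proof.
  intros He HN Ht Hex Hq HM Hexw.
  assert (Hre := Re_1_minus_pos t Ht). assert (Hne := Cneq0_Re _ Hre).
  assert (Hg : (0 < Cmod (1 - t))%R) by now apply Cmod_gt_0.
  assert (HgN : (0 < Cmod (1 - t) ^ N)%R) by now apply pow_lt.
  destruct (ex_series_bounded _ Hexw) as (M2 & HM2 & Hb2).
  (* Two lower bounds for the radius are at hand: q from the decay of B, and |1 - t|^(- N) from
     convergence on the right at t. The first gives W > 1, the second W |1 - t|^N >= 1. *)
  set (W := Rmax q (/ Cmod (1 - t) ^ N)).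
  assert (HWq : (q <= W)%R) by apply Rmax_l.
  assert (HWg : (1 <= W * Cmod (1 - t) ^ N)%R).
  { apply Rle_trans with (/ Cmod (1 - t) ^ N * Cmod (1 - t) ^ N)%R.
    - rewrite Rinv_l; lra.
    - apply Rmult_le_compat_r; [lra|apply Rmax_r]. }
  assert (HB : radius_ge B W).
  { unfold W, Rmax. destruct (Rle_dec q (/ Cmod (1 - t) ^ N)).
    - apply radius_ge_of_bounded with M2; [exact HM2|]. intros m.
      specialize (Hb2 m). rewrite Cmod_div, Cmod_pow in Hb2 by now apply Cpow_nz.
      rewrite pow_inv, <- pow_mult. exact Hb2.
    - apply radius_ge_of_bounded with (Rabs M + 1)%R.
      + pose proof (Rabs_pos M). lra.
      + intros m. specialize (HM m). pose proof (Rle_abs M). lra. }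
  (* At t = 0 nothing has to be approached: both sides are the values at the starting point. *)
  destruct (Ceq_dec t 0) as [->|Ht0].
  { replace (CSeries (fun n => e n * divpow 0 n)) with (power_jet e 0 0).
    - rewrite power_jet_0, He, <- shifted_jet_0. apply shifted_jet_eq; [|exact Hexw].
      rewrite Cmod_0. lra.
    - unfold power_jet. f_equal. apply functional_extensionality. intros n.
      now rewrite Nat.add_0_r. }
  destruct (excluded_middle_informative (Im t = 0%R /\ (Re t <= 0)%R)) as [[Hi Hr]|Hneg].
  - assert (Et : t = RtoC (Re t)).
    { destruct t as [a b]. simpl in *. now subst b. }
    (* Radial approach, d = 1 and eta = 1: for t <= 0 the points t (1 - x i) satisfy |1 - c| >= 1,
       so |B_m| is a common majorant, summable because W > 1. *)
    pose (x := fun i : nat => (1 / INR (S i))%R).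
    destruct (small_sequence 1 x Rlt_0_1 (fun i => eq_refl)) as [Hx Hx0].
    assert (Hge : forall i, (1 <= Cmod (1 - (t - RtoC (x i) * (1 * t))))%R).
    { intros i. rewrite Et.
      replace (1 - (RtoC (Re t) - RtoC (x i) * (1 * RtoC (Re t))))
        with (RtoC (1 - Re t * (1 - x i)))
        by (rewrite RtoC_minus, RtoC_mult, RtoC_minus; ring).
      rewrite Cmod_R. destruct (Hx i). rewrite Rabs_pos_eq; nra. }
    apply boundary_value with W (RtoC 1) 1%R; auto; try (simpl; lra).
    { rewrite Cmod_1. simpl. lra. }
    + intros i. fold (x i). specialize (Hge i).
      pose proof (pow_R1_Rle _ N Hge). nra.
    + assert (Hsub : forall i, (Cmod (t - RtoC (x i) * (1 * t)) < 1)%R).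
      { intros i. replace (t - x i * (1 * t)) with (RtoC (1 - x i) * t)
          by (rewrite RtoC_minus; ring).
        destruct (Hx i). rewrite Cmod_mult, Cmod_R, Rabs_pos_eq by lra.
        pose proof (Cmod_ge_0 t). nra. }
      apply cvgC_series_dominated with
        (fun i m => B m / Cpow (1 - (t - RtoC (x i) * (1 * t))) (N * m))
        (fun m => B m / Cpow (1 - t) (N * m)) (fun m => Cmod (B m) * 1 ^ m)%R.
      * intros i m. rewrite Cmod_div.
        2:{ apply Cpow_nz, Cneq0_Re, Re_1_minus_pos, Hsub. }
        rewrite pow1. apply Rmult_le_compat_l; [apply Cmod_ge_0|].
        rewrite Cmod_pow. rewrite <- Rinv_1 at 3. apply Rinv_le_contravar; [lra|].
        apply pow_R1_Rle, Hge.
      * apply radius_ge_dominated with W; [exact HB|lra].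
      * intros m.
        (* The integer power is written as a principal power with parameter 0, so that continuity
           along a line applies. *)
        apply cvgC_ext with (fun i => B m * Cpower (1 - t + x i * t) (- (0 + natC (N * m)))).
        { intros i. replace (1 - t + x i * t) with (1 - (t - x i * (1 * t))) by ring.
          rewrite Cpower_opp_natC by apply Re_1_minus_pos, Hsub.
          replace (- 0) with (RtoC 0) by ring. rewrite Cpower_0. unfold Cdiv. ring. }
        replace (B m / Cpow (1 - t) (N * m))
          with (B m * Cpower (1 - t) (- (0 + natC (N * m)))).
        2:{ rewrite Cpower_opp_natC by exact Hre.
          replace (- 0) with (RtoC 0) by ring. rewrite Cpower_0. unfold Cdiv. ring. }
        apply cvgC_mult.
        { intros eps Heps. exists 0%nat. intros n _.
          replace (B m - B m) with (RtoC 0) by ring. now rewrite Cmod_0. }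
        now apply cvgC_Cpower_line.
      * intros i. apply CSeries_correct, ex_series_shifted_0 with W; [exact HB|apply Hsub|].
        fold (x i). specialize (Hge i). pose proof (pow_R1_Rle _ N Hge). nra.
      * now apply CSeries_correct.
  - destruct (exists_transversal_direction t Ht Hneg) as (d & Hd & Hdw).
    set (w := d * t / (1 - t)) in *.
    assert (Hd2 : (0 < Cmod d ^ 2)%R).
    { apply pow_lt, Cmod_gt_0. now apply Cneq0_Re. }
    (* The largest scale for which [Cmod_segment_le] covers all x i. *)
    set (eta := (Re d / Cmod d ^ 2)%R).
    assert (Heta : (0 < eta)%R) by now apply Rdiv_lt_0_compat.
    pose (x := fun i : nat => (eta / INR (S i))%R).
    destruct (small_sequence eta x Heta (fun i => eq_refl)) as [Hx Hx0].
    assert (Hv := fun i => Cmod_inv_1_plus w (x i) Hdw (proj1 (Hx i))).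
    cbv zeta in Hv.
    assert (E1 : forall i, 1 - (t - RtoC (x i) * (d * t)) = (1 - t) * (1 + x i * w)).
    { intros i. unfold w. field. exact Hne. }
    assert (Hlt : forall i, (Cmod (1 - t) < Cmod (1 - (t - RtoC (x i) * (d * t))))%R).
    { intros i. destruct (Hv i) as (Hn & Hv1 & _). rewrite Cmod_inv in Hv1 by exact Hn.
      rewrite E1, Cmod_mult. apply Cmod_gt_0 in Hn.
      rewrite <- (Rmult_1_r (Cmod (1 - t))) at 1.
      apply Rmult_lt_compat_l; [exact Hg|].
      apply Rmult_lt_compat_r with (r := Cmod (1 + x i * w)) in Hv1; [|exact Hn].
      rewrite Rinv_l in Hv1; lra. }
    assert (HWx : forall i, (1 < W * Cmod (1 - (t - RtoC (x i) * (d * t))) ^ N)%R).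
    { intros i. eapply Rle_lt_trans; [exact HWg|]. apply Rmult_lt_compat_l; [lra|].
      (* N >= 1 preserves the strict inequality of the distances to 1 under N-th powers. *)
      destruct N as [|N']; [lia|]. simpl pow. specialize (Hlt i).
      assert (Hp : (Cmod (1 - t) ^ N' <= Cmod (1 - (t - RtoC (x i) * (d * t))) ^ N')%R)
        by (apply pow_incr; lra).
      assert (0 < Cmod (1 - t) ^ N')%R by now apply pow_lt. nra. }
    apply boundary_value with W d eta; auto; try lra.
    { right. unfold eta, Rdiv. rewrite Rmult_assoc, Rinv_l; lra. }
    (* The right-hand series at [tau i] is the one at t with its m-th term multiplied by V^m, where
       V = (1 + x w)^(- N). *)
    apply (abel_stolz (fun m => B m / Cpow (1 - t) (N * m))
      (fun i => Cpow (/ (1 + x i * w)) N) _ _ (INR N * (Cmod w / Re w))).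
    + now apply CSeries_correct.
    + intros i. destruct (Hv i) as (Hn & _). fold (x i).
      eapply is_series_cext; [|apply CSeries_correct, ex_series_shifted_0 with W;
        [exact HB| |apply HWx]].
      * intros m. cbv beta. rewrite E1, Cpow_mult_l.
        rewrite <- Cpow_mult_r, Cpow_inv by exact Hn.
        field. split; now apply Cpow_nz.
      * replace (t - x i * (d * t)) with ((1 - x i * d) * t) by ring.
        destruct (Hx i) as [Hx1 Hx2].
        rewrite Cmod_mult.
        assert (Hs : (Cmod (1 - x i * d) <= 1 - x i * Re d / 2)%R).
        { apply Cmod_segment_le; [exact Hd|exact Hx1|].
          apply Rle_trans with (eta * Cmod d ^ 2)%R; [apply Rmult_le_compat_r; lra|].
          right. unfold eta, Rdiv. rewrite Rmult_assoc, Rinv_l; lra. }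
        assert (0 < x i * Re d)%R by now apply Rmult_lt_0_compat.
        pose proof (Cmod_ge_0 t). nra.
    + apply Rmult_le_pos; [apply pos_INR|].
      apply Rmult_le_pos; [apply Cmod_ge_0|]. left. now apply Rinv_0_lt_compat.
    + intros i. destruct (Hv i) as (Hn & Hv1 & _). rewrite Cmod_pow.
      pose proof (Cmod_ge_0 (/ (1 + x i * w))).
      apply pow_lt_1_compat; [lra|lia].
    (* With v = 1 / (1 + x w): |1 - v^N| <= N |1 - v| <= N (|w| / Re w) (1 - |v|), and 1 - |v| <= 1
       - |v|^N as N >= 1. *)
    + intros i. destruct (Hv i) as (Hn & Hv1 & _ & Hv2). cbv beta.
      eapply Rle_trans; [apply Cmod_1_minus_pow; lra|].
      rewrite Rmult_assoc. apply Rmult_le_compat_l; [apply pos_INR|].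
      eapply Rle_trans; [exact Hv2|]. apply Rmult_le_compat_l.
      { apply Rmult_le_pos; [apply Cmod_ge_0|]. left. now apply Rinv_0_lt_compat. }
      rewrite Cmod_pow. pose proof (Cmod_ge_0 (/ (1 + x i * w))).
      destruct N as [|N']; [lia|]. simpl pow.
      assert (Cmod (/ (1 + x i * w)) ^ N' <= 1)%R; [|nra].
      now apply pow_le_1; split; [|left].
    + intros eps Heps.
      pose proof (Cmod_ge_0 w) as Hw0. pose proof (pos_INR N) as HN0.
      assert (HK : (0 < INR N * Cmod w + 1)%R) by nra.
      destruct (Hx0 (eps / (INR N * Cmod w + 1))%R) as [n Hn].
      { now apply Rdiv_lt_0_compat. }
      exists n. intros i Hi. specialize (Hn i Hi).
      destruct (Hv i) as (_ & Hv1 & Hv2 & _). destruct (Hx i) as [Hx1 _].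
      rewrite Rabs_pos_eq in Hn by lra.
      replace (Cpow (/ (1 + x i * w)) N - 1) with (- (1 - Cpow (/ (1 + x i * w)) N)) by ring.
      rewrite Cmod_opp.
      eapply Rle_lt_trans; [apply Cmod_1_minus_pow; lra|].
      apply Rmult_lt_compat_r with (r := (INR N * Cmod w + 1)%R) in Hn; [|exact HK].
      replace (eps / (INR N * Cmod w + 1) * (INR N * Cmod w + 1))%R with eps in Hn
        by (field; lra).
      apply Rle_lt_trans with (INR N * (x i * Cmod w))%R; [|nra].
      now apply Rmult_le_compat_l.
Qed.

(** * Improper integrals and the incomplete Gamma function *)

(* [L] is the improper integral of [f] over the open half-line (x, oo). *)
Definition is_improper (f : R -> R) (x L : R) : Prop :=
  forall eps, (0 < eps)%R -> exists d M, (0 < d)%R /\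
    forall y Y, (x < y < x + d)%R -> (M < Y)%R -> (Rabs (RInt f y Y - L) < eps)%R.

Definition cont_on (f : R -> R) (x : R) : Prop := forall u, (x < u)%R -> continuous f u.

Lemma cont_ex_RInt f x y Y : cont_on f x -> (x < y)%R -> (x < Y)%R -> ex_RInt f y Y.
Proof.
  intros H Hy HY. apply (ex_RInt_continuous (V := R_CompleteNormedModule)).
  intros u [Hu _]. apply H. eapply Rlt_le_trans; [|exact Hu]. now apply Rmin_glb_lt.
Qed.

Lemma RInt_subinterval_le f x y y' Y' Y :
  cont_on f x -> (forall u, (x < u)%R -> (0 <= f u)%R) ->
  (x < y)%R -> (y <= y')%R -> (y' <= Y')%R -> (Y' <= Y)%R ->
  (RInt f y' Y' <= RInt f y Y)%R.
Proof.
  intros Hc H0 Hx H1 H2 H3.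
  rewrite <- (RInt_Chasles f y y' Y) by (apply cont_ex_RInt with x; auto; lra).
  rewrite <- (RInt_Chasles f y' Y' Y) by (apply cont_ex_RInt with x; auto; lra).
  assert (0 <= RInt f y y')%R.
  { apply RInt_ge_0; [lra|apply cont_ex_RInt with x; auto; lra|]. intros u Hu. apply H0. lra. }
  assert (0 <= RInt f Y' Y)%R.
  { apply RInt_ge_0; [lra|apply cont_ex_RInt with x; auto; lra|]. intros u Hu. apply H0. lra. }
  unfold plus; simpl. lra.
Qed.

(** For a nonnegative integrand the supremum of the integrals over compact subintervals is the
    limit, by monotonicity in both end points. *)
Lemma is_improper_exists f x B :
  cont_on f x -> (forall u, (x < u)%R -> (0 <= f u)%R) ->
  (forall y Y, (x < y)%R -> (y <= Y)%R -> (RInt f y Y <= B)%R) ->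
  exists L, is_improper f x L /\ forall y Y, (x < y)%R -> (y <= Y)%R -> (RInt f y Y <= L)%R.
Proof.
  intros Hc H0 HB.
  destruct (completeness (fun v => exists y Y, (x < y)%R /\ (y <= Y)%R /\ v = RInt f y Y))
    as [L [HL1 HL2]].
  - exists B. intros v (y & Y & H1 & H2 & ->). now apply HB.
  - exists (RInt f (x + 1) (x + 1))%R, (x + 1)%R, (x + 1)%R. repeat split; lra.
  - assert (Hle : forall y Y, (x < y)%R -> (y <= Y)%R -> (RInt f y Y <= L)%R).
    { intros y Y H1 H2. apply HL1. now exists y, Y. }
    exists L. split; [|exact Hle]. intros eps He.
    destruct (classic (exists y Y, (x < y)%R /\ (y <= Y)%R /\ (L - eps < RInt f y Y)%R))
      as [(y0 & Y0 & H1 & H2 & H3)|Hn].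
    + exists (y0 - x)%R, Y0. split; [lra|]. intros y Y Hy HY.
      pose proof (RInt_subinterval_le f x y y0 Y0 Y Hc H0
        ltac:(lra) ltac:(lra) ltac:(lra) ltac:(lra)).
      pose proof (Hle y Y ltac:(lra) ltac:(lra)). apply Rabs_def1; lra.
    + exfalso. assert (L <= L - eps)%R; [|lra]. apply HL2.
      intros v (y & Y & H1 & H2 & ->). apply Rnot_lt_le. intros H.
      apply Hn. now exists y, Y.
Qed.

(** Real combinations f + c g suffice, since both components of a complex sum or multiple are built
    from them. *)
Lemma is_improper_lin f g x c Lf Lg :
  cont_on f x -> cont_on g x -> is_improper f x Lf -> is_improper g x Lg ->
  is_improper (fun u => f u + c * g u)%R x (Lf + c * Lg)%R.
Proof.
  intros Cf Cg Hf Hg eps He.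
  pose proof (Rabs_pos c) as Hc.
  destruct (Hf (eps / 2)%R ltac:(lra)) as (d1 & M1 & Hd1 & H1).
  destruct (Hg (eps / (2 * (Rabs c + 1)))%R) as (d2 & M2 & Hd2 & H2).
  { apply Rdiv_lt_0_compat; lra. }
  exists (Rmin d1 d2), (Rmax (Rmax M1 M2) x). split; [now apply Rmin_pos|].
  intros y Y Hy HY.
  pose proof (Rmin_l d1 d2). pose proof (Rmin_r d1 d2).
  pose proof (Rmax_l (Rmax M1 M2) x). pose proof (Rmax_r (Rmax M1 M2) x).
  pose proof (Rmax_l M1 M2). pose proof (Rmax_r M1 M2).
  specialize (H1 y Y ltac:(lra) ltac:(lra)). specialize (H2 y Y ltac:(lra) ltac:(lra)).
  assert (Ef : ex_RInt f y Y) by (apply cont_ex_RInt with x; auto; lra).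
  assert (Eg : ex_RInt g y Y) by (apply cont_ex_RInt with x; auto; lra).
  assert (E : RInt (fun u => f u + c * g u)%R y Y = (RInt f y Y + c * RInt g y Y)%R).
  { apply is_RInt_unique.
    apply (is_RInt_plus (V := R_NormedModule)); [now apply (RInt_correct (V := R_CompleteNormedModule))|].
    apply (is_RInt_scal (V := R_NormedModule)). now apply (RInt_correct (V := R_CompleteNormedModule)). }
  rewrite E.
  replace (RInt f y Y + c * RInt g y Y - (Lf + c * Lg))%R
    with ((RInt f y Y - Lf) + c * (RInt g y Y - Lg))%R by ring.
  eapply Rle_lt_trans; [apply Rabs_triang|]. rewrite Rabs_mult.
  pose proof (Rabs_pos (RInt g y Y - Lg)).
  apply Rmult_lt_compat_r with (r := (2 * (Rabs c + 1))%R) in H2; [|lra].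
  replace (eps / (2 * (Rabs c + 1)) * (2 * (Rabs c + 1)))%R with eps in H2 by (field; lra).
  nra.
Qed.

Lemma is_improper_ext f g x L :
  (forall u, (x < u)%R -> f u = g u) -> is_improper f x L -> is_improper g x L.
Proof.
  intros E H eps He. destruct (H eps He) as (d & M & Hd & HM).
  exists d, (Rmax M x). split; [exact Hd|]. intros y Y Hy HY.
  pose proof (Rmax_l M x). pose proof (Rmax_r M x).
  rewrite <- (RInt_ext f g y Y); [apply HM; lra|].
  intros u Hu. apply E. eapply Rlt_trans; [|apply Hu]. apply Rmin_glb_lt; lra.
Qed.

Definition contC (f : R -> C) (x : R) : Prop :=
  cont_on (fun u => fst (f u)) x /\ cont_on (fun u => snd (f u)) x.

Definition is_improperC (f : R -> C) (x : R) (L : C) : Prop :=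
  is_improper (fun u => fst (f u)) x (fst L) /\ is_improper (fun u => snd (f u)) x (snd L).

Lemma is_improperC_ext f g x L :
  (forall u, (x < u)%R -> f u = g u) -> is_improperC f x L -> is_improperC g x L.
Proof.
  intros E [H1 H2]. split; (eapply is_improper_ext; [|eassumption]); intros u Hu; simpl; now rewrite E.
Qed.

Lemma cont_on_lin f g x c :
  cont_on f x -> cont_on g x -> cont_on (fun u => f u + c * g u)%R x.
Proof.
  intros Hf Hg u Hu.
  apply (continuous_plus (V := R_NormedModule)); [now apply Hf|].
  apply (continuous_scal_r (V := R_NormedModule) c). now apply Hg.
Qed.

Lemma contC_plus f g x : contC f x -> contC g x -> contC (fun u => f u + g u) x.
Proof.
  intros [F1 F2] [G1 G2].
  split; intros u Hu; (apply (continuous_plus (V := R_NormedModule)); auto).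
Qed.

Lemma cont_on_ext f g x :
  (forall u, f u = g u) -> cont_on f x -> cont_on g x.
Proof. intros E H u Hu. apply continuous_ext with f; auto. Qed.

Lemma contC_scal c f x : contC f x -> contC (fun u => c * f u) x.
Proof.
  intros [F1 F2].
  assert (Hz : cont_on (fun _ => 0%R) x) by (intros u _; apply continuous_const).
  pose proof (cont_on_lin _ _ x (fst c) Hz F1) as A1.
  pose proof (cont_on_lin _ _ x (snd c) Hz F1) as A2.
  pose proof (cont_on_lin _ _ x (- snd c) A1 F2) as A3.
  pose proof (cont_on_lin _ _ x (fst c) A2 F2) as A4.
  split; [eapply cont_on_ext; [|exact A3]|eapply cont_on_ext; [|exact A4]];
    intros u; simpl; ring.
Qed.

Lemma is_improperC_plus f g x Lf Lg :
  contC f x -> contC g x -> is_improperC f x Lf -> is_improperC g x Lg ->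
  is_improperC (fun u => f u + g u) x (Lf + Lg).
Proof.
  intros [F1 F2] [G1 G2] [A1 A2] [B1 B2].
  pose proof (is_improper_lin _ _ x 1 _ _ F1 G1 A1 B1) as H1.
  pose proof (is_improper_lin _ _ x 1 _ _ F2 G2 A2 B2) as H2.
  rewrite Rmult_1_l in H1, H2.
  split; [eapply is_improper_ext; [|exact H1]|eapply is_improper_ext; [|exact H2]];
    intros u _; simpl; ring.
Qed.

Lemma is_improper_0 x : is_improper (fun _ => 0%R) x 0.
Proof.
  intros eps He. exists 1%R, 0%R. split; [lra|]. intros y Y _ _.
  rewrite RInt_const. unfold scal; simpl; unfold mult; simpl.
  rewrite Rmult_0_r, Rminus_0_r, Rabs_R0. exact He.
Qed.

Lemma is_improperC_scal c f x L : contC f x -> is_improperC f x L -> is_improperC (fun u => c * f u) x (c * L).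
Proof.
  intros [F1 F2] [A1 A2].
  assert (Hz : cont_on (fun _ => 0%R) x) by (intros u _; apply continuous_const).
  pose proof (cont_on_lin _ _ x (fst c) Hz F1) as C1.
  pose proof (cont_on_lin _ _ x (snd c) Hz F1) as C2.
  pose proof (is_improper_lin _ _ x (fst c) _ _ Hz F1 (is_improper_0 x) A1) as B1.
  pose proof (is_improper_lin _ _ x (snd c) _ _ Hz F1 (is_improper_0 x) A1) as B2.
  pose proof (is_improper_lin _ _ x (- snd c) _ _ C1 F2 B1 A2) as B3.
  pose proof (is_improper_lin _ _ x (fst c) _ _ C2 F2 B2 A2) as B4.
  split.
  - replace (fst (c * L)) with (0 + fst c * fst L + - snd c * snd L)%R by (simpl; ring).
    eapply is_improper_ext; [|exact B3]. intros u _. simpl. ring.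
  - replace (snd (c * L)) with (0 + snd c * fst L + fst c * snd L)%R by (simpl; ring).
    eapply is_improper_ext; [|exact B4]. intros u _. simpl. ring.
Qed.

Lemma is_improperC_RInt_gen f x L :
  contC f x -> is_improperC f x L ->
  RInt_gen (V := C_R_CompleteNormedModule) f (at_right x) (Rbar_locally p_infty) = L.
Proof.
  intros [F1 F2] [A1 A2]. apply is_RInt_gen_unique.
  intros P [eps HP].
  destruct (A1 eps (cond_pos eps)) as (d1 & M1 & Hd1 & H1).
  destruct (A2 eps (cond_pos eps)) as (d2 & M2 & Hd2 & H2).
  assert (Hd : (0 < Rmin d1 d2)%R) by now apply Rmin_pos.
  apply Filter_prod with (fun y => (x < y < x + Rmin d1 d2)%R)
    (fun Y => (Rmax (Rmax M1 M2) x < Y)%R).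
  - exists (mkposreal _ Hd). intros y Hy Hxy.
    unfold ball in Hy; simpl in Hy; unfold AbsRing_ball, abs, minus, plus, opp in Hy; simpl in Hy.
    apply Rabs_def2 in Hy. simpl in Hy. lra.
  - exists (Rmax (Rmax M1 M2) x). auto.
  - intros y Y Hy HY.
    pose proof (Rmin_l d1 d2). pose proof (Rmin_r d1 d2).
    pose proof (Rmax_l (Rmax M1 M2) x). pose proof (Rmax_r (Rmax M1 M2) x).
    pose proof (Rmax_l M1 M2). pose proof (Rmax_r M1 M2).
    exists (RInt (fun u => fst (f u)) y Y, RInt (fun u => snd (f u)) y Y). split.
    + apply (is_RInt_fct_extend_pair (U := R_NormedModule) (V := R_NormedModule));
        apply (RInt_correct (V := R_CompleteNormedModule));
        apply cont_ex_RInt with x; auto; simpl; lra.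
    + apply HP. split.
      * apply H1; lra.
      * apply H2; lra.
Qed.

Definition gamma_integrand (nu : C) (p u : R) : C :=
  Cpower (RtoC u) (nu - 1) * RtoC (exp (- u - p / u)).

(** u^(b-1) e^(-u) for u > 0, written as a single exponential: its positivity is immediate. *)
Definition gamma_real_integrand (b u : R) : R := exp ((b - 1) * ln u - u).

Lemma Clog_RtoC (u : R) : (0 < u)%R -> Clog (RtoC u) = RtoC (ln u).
Proof.
  intros Hu. unfold RtoC at 1. rewrite Clog_explicit by exact Hu.
  replace (u ^ 2 + 0 ^ 2)%R with (u * u)%R by ring. rewrite ln_mult by exact Hu.
  unfold Rdiv at 2. rewrite Rmult_0_l, atan_0. unfold RtoC. f_equal. field.
Qed.

Lemma Cmod_Cpower_RtoC (u : R) nu :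
  (0 < u)%R -> Cmod (Cpower (RtoC u) nu) = exp (Re nu * ln u).
Proof.
  intros Hu. unfold Cpower. rewrite Cmod_Cexp, Clog_RtoC by exact Hu.
  f_equal. destruct nu. simpl. ring.
Qed.

Lemma Cpower_RtoC_real (u b : R) :
  (0 < u)%R -> Cpower (RtoC u) (RtoC b) = RtoC (exp (b * ln u)).
Proof.
  intros Hu. unfold Cpower. rewrite Clog_RtoC, <- RtoC_mult by exact Hu.
  unfold Cexp. simpl. rewrite cos_0, sin_0. apply injective_projections; simpl; ring.
Qed.

Lemma is_deriveC_Cpower_RtoC nu u :
  (0 < u)%R ->
  is_deriveC (fun u : R => Cpower (RtoC u) nu) u (nu * Cpower (RtoC u) (nu - 1)).
Proof.
  intros Hu.
  assert (E : forall s : R, 0 + s * 1 = RtoC s) by (intros; ring).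
  assert (H : (0 < Re (0 + u * 1))%R) by (rewrite E; exact Hu).
  pose proof (is_derive_Cpower 0 1 nu u H) as D. rewrite E in D.
  assert (Hu0 : RtoC u <> 0) by (intros X; apply RtoC_inj in X; lra).
  assert (E2 : nu * (1 / RtoC u) * Cpower (RtoC u) nu = nu * Cpower (RtoC u) (nu - 1)).
  { replace nu with (nu - 1 + natC 1) at 2 by (unfold natC; simpl; ring).
    rewrite Cpower_plus, Cpower_natC by exact Hu. simpl Cpow. field. exact Hu0. }
  rewrite E2 in D. destruct D as [D1 D2]. split.
  - eapply is_derive_ext; [|exact D1]. intros s. simpl. now rewrite E.
  - eapply is_derive_ext; [|exact D2]. intros s. simpl. now rewrite E.
Qed.

Lemma is_deriveC_RtoC (f : R -> R) (u d : R) :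
  is_derive f u d -> is_deriveC (fun u => RtoC (f u)) u (RtoC d).
Proof. intros H. split; simpl; [exact H|]. exact (is_derive_const 0%R u). Qed.

Lemma contC_of_deriveC f x :
  (forall u, (x < u)%R -> exists d, is_deriveC f u d) -> contC f x.
Proof.
  intros H. split; intros u Hu; destruct (H u Hu) as [d [D1 D2]].
  - apply (ex_derive_continuous (fun u => fst (f u)) u). now exists (fst d).
  - apply (ex_derive_continuous (fun u => snd (f u)) u). now exists (snd d).
Qed.

Lemma contC_gamma_integrand nu p x : (0 <= x)%R -> contC (gamma_integrand nu p) x.
Proof.
  intros Hx. apply contC_of_deriveC. intros u Hu.
  assert (Hu0 : (0 < u)%R) by lra.
  eexists. unfold gamma_integrand. apply is_deriveC_mult.
  - now apply is_deriveC_Cpower_RtoC.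
  - apply (is_deriveC_RtoC (fun u => exp (- u - p / u))). auto_derive; [lra|reflexivity].
Qed.

Lemma cont_gamma_real_integrand b x : (0 <= x)%R -> cont_on (gamma_real_integrand b) x.
Proof.
  intros Hx u Hu. apply (ex_derive_continuous (gamma_real_integrand b) u). unfold gamma_real_integrand.
  auto_derive. lra.
Qed.

Lemma gamma_real_integrand_pos b u : (0 < gamma_real_integrand b u)%R.
Proof. apply exp_pos. Qed.

Lemma Cmod_gamma_integrand_0 nu u : (0 < u)%R -> Cmod (gamma_integrand nu 0 u) = gamma_real_integrand (Re nu) u.
Proof.
  intros Hu. unfold gamma_integrand, gamma_real_integrand.
  rewrite Cmod_mult, Cmod_Cpower_RtoC, Cmod_R, Rabs_pos_eq, <- exp_plus
    by (try exact Hu; left; apply exp_pos).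
  f_equal. replace (0 / u)%R with 0%R by (field; lra). destruct nu; simpl. ring.
Qed.

Lemma gamma_integrand_p nu p u : gamma_integrand nu p u = gamma_integrand nu 0 u * RtoC (exp (- (p / u))).
Proof.
  unfold gamma_integrand. rewrite <- Cmult_assoc, <- RtoC_mult, <- exp_plus. do 3 f_equal.
  unfold Rdiv. ring.
Qed.

Lemma gamma_integrand_real b u : (0 < u)%R -> gamma_integrand (RtoC b) 0 u = RtoC (gamma_real_integrand b u).
Proof.
  intros Hu. unfold gamma_integrand, gamma_real_integrand. rewrite <- RtoC_minus, Cpower_RtoC_real by exact Hu.
  rewrite <- RtoC_mult, <- exp_plus. do 2 f_equal.
  replace (0 / u)%R with 0%R by (field; lra). ring.
Qed.

Lemma ln_le_linear (c u : R) : (0 < c)%R -> (0 < u)%R -> (ln u <= ln c + u / c - 1)%R.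
Proof.
  intros Hc Hu.
  assert (H : (0 < u / c)%R) by now apply Rdiv_lt_0_compat.
  replace u with (c * (u / c))%R at 1 by (field; lra).
  rewrite ln_mult by assumption.
  pose proof (exp_ineq1_le (ln (u / c))). rewrite exp_ln in H0 by exact H. lra.
Qed.

(** The tangent bound for ln at 2 b + 2 has slope small enough that b ln u is at most a constant
    plus u / 2. *)
Lemma exp_ln_minus_le (b : R) :
  (0 <= b)%R -> exists K, (0 < K)%R /\
  forall u, (0 < u)%R -> (exp (b * ln u - u) <= K * exp (- u / 2))%R.
Proof.
  intros Hb. exists (exp (b * ln (2 * b + 2))). split; [apply exp_pos|].
  intros u Hu. rewrite <- exp_plus.
  pose proof (ln_le_linear (2 * b + 2) u ltac:(lra) Hu) as H.
  assert (H2 : (b * ln u - u <= b * ln (2 * b + 2) + - u / 2)%R).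
  { apply Rmult_le_compat_l with (r := b) in H; [|exact Hb].
    assert (b * (u / (2 * b + 2)) <= u / 2)%R; [|lra].
    apply Rmult_le_reg_r with (2 * b + 2)%R; [lra|].
    replace (b * (u / (2 * b + 2)) * (2 * b + 2))%R with (b * u)%R by (field; lra). nra. }
  destruct H2 as [H2|H2]; [left; now apply exp_increasing|rewrite H2; right; reflexivity].
Qed.

Lemma RInt_exp_half (K y Y : R) :
  is_RInt (fun u => K * exp (- u / 2))%R y Y (2 * K * (exp (- y / 2) - exp (- Y / 2)))%R.
Proof.
  replace (2 * K * (exp (- y / 2) - exp (- Y / 2)))%R
    with (minus (- 2 * K * exp (- Y / 2)) (- 2 * K * exp (- y / 2)))%R
    by (unfold minus, plus, opp; simpl; ring).
  apply (is_RInt_derive (fun u => - 2 * K * exp (- u / 2))%R).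
  - intros u _. auto_derive; [exact I|]. unfold Rdiv. field.
  - intros u _. apply (ex_derive_continuous (fun u => K * exp (- u / 2))%R u). auto_derive. exact I.
Qed.

Lemma RInt_gamma_real_integrand_bounded b :
  (1 <= b)%R -> exists M, forall y Y, (0 < y)%R -> (y <= Y)%R -> (RInt (gamma_real_integrand b) y Y <= M)%R.
Proof.
  intros Hb. destruct (exp_ln_minus_le (b - 1)) as (K & HK & H); [lra|].
  exists (2 * K)%R. intros y Y Hy HY.
  pose proof (RInt_exp_half K y Y) as HI.
  apply Rle_trans with (RInt (fun u => K * exp (- u / 2))%R y Y).
  - apply RInt_le; [exact HY| |eexists; exact HI|].
    + apply cont_ex_RInt with 0%R; [apply cont_gamma_real_integrand| |]; lra.
    + intros u Hu. apply H. lra.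
  - rewrite (is_RInt_unique _ _ _ _ HI). pose proof (exp_pos (- Y / 2)).
    assert (exp (- y / 2) <= 1)%R; [|nra].
    rewrite <- exp_0. left. apply exp_increasing. lra.
Qed.

Lemma RInt_mult_l (f : R -> R) (c a b : R) :
  ex_RInt f a b -> (RInt (fun u => c * f u) a b = c * RInt f a b)%R.
Proof. exact (RInt_scal (V := R_CompleteNormedModule) f a b c). Qed.

(** For a component h with |h| <= g, the function h + g is nonnegative with integrals at most 2 M,
    hence integrable; subtracting g returns to h. *)
Lemma is_improperC_dominated f x g M :
  contC f x -> cont_on g x -> (forall u, (x < u)%R -> (0 <= g u)%R) ->
  (forall u, (x < u)%R -> (Cmod (f u) <= g u)%R) ->
  (forall y Y, (x < y)%R -> (y <= Y)%R -> (RInt g y Y <= M)%R) ->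
  exists L, is_improperC f x L.
Proof.
  intros [F1 F2] Cg g0 Hfg HM.
  destruct (is_improper_exists g x M Cg g0 HM) as (G & HG & _).
  assert (Hcomp : forall h, cont_on h x -> (forall u, (x < u)%R -> (Rabs (h u) <= g u)%R) ->
    exists L, is_improper h x L).
  { intros h Ch Hh.
    assert (Cs : cont_on (fun u => h u + 1 * g u)%R x) by now apply cont_on_lin.
    destruct (is_improper_exists (fun u => h u + 1 * g u)%R x (2 * M)) as (L & HL & _).
    - exact Cs.
    - intros u Hu. specialize (Hh u Hu). apply Rabs_le_between in Hh. lra.
    - intros y Y Hy HY. eapply Rle_trans; [|apply Rmult_le_compat_l, (HM y Y Hy HY); lra].
      rewrite <- RInt_mult_l by (apply cont_ex_RInt with x; auto; lra).
      apply RInt_le; [exact HY|apply cont_ex_RInt with x; auto; lra| |].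
      + apply (ex_RInt_scal (V := R_NormedModule)). apply cont_ex_RInt with x; auto; lra.
      + intros u Hu. specialize (Hh u ltac:(lra)). apply Rabs_le_between in Hh. lra.
    - exists (L + -1 * G)%R. pose proof (is_improper_lin _ _ x (-1) _ _ Cs Cg HL HG) as H.
      eapply is_improper_ext; [|exact H]. intros u _. simpl. ring. }
  destruct (Hcomp _ F1) as [L1 H1].
  { intros u Hu. eapply Rle_trans; [apply fst_abs_le|now apply Hfg]. }
  destruct (Hcomp _ F2) as [L2 H2].
  { intros u Hu. eapply Rle_trans; [apply snd_abs_le|now apply Hfg]. }
  exists (L1, L2). now split.
Qed.

Lemma iGamma_unique nu x p L :
  (0 <= x)%R -> is_improperC (gamma_integrand nu p) x L -> iGamma nu x p = L.
Proof. intros Hx H. apply is_improperC_RInt_gen; [now apply contC_gamma_integrand|exact H]. Qed.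

Lemma exp_neg_le_1 (v : R) : (0 <= v)%R -> (exp (- v) <= 1)%R.
Proof.
  intros [Hv|<-]; [|rewrite Ropp_0, exp_0; lra].
  rewrite <- exp_0. left. apply exp_increasing. lra.
Qed.

Lemma is_improperC_gamma_ge_1 nu x p :
  (1 <= Re nu)%R -> (0 <= x)%R -> (0 <= p)%R -> is_improperC (gamma_integrand nu p) x (iGamma nu x p).
Proof.
  intros Hnu Hx Hp.
  destruct (RInt_gamma_real_integrand_bounded (Re nu) Hnu) as [M HM].
  destruct (is_improperC_dominated (gamma_integrand nu p) x (gamma_real_integrand (Re nu)) M) as [L HL].
  - now apply contC_gamma_integrand.
  - now apply cont_gamma_real_integrand.
  - intros u _. left. apply gamma_real_integrand_pos.
  - intros u Hu. rewrite gamma_integrand_p, Cmod_mult, Cmod_gamma_integrand_0, Cmod_R by lra.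
    rewrite Rabs_pos_eq by (left; apply exp_pos).
    rewrite <- (Rmult_1_r (gamma_real_integrand (Re nu) u)) at 2.
    apply Rmult_le_compat_l; [left; apply gamma_real_integrand_pos|].
    apply exp_neg_le_1. apply Rmult_le_pos; [exact Hp|]. left. apply Rinv_0_lt_compat. lra.
  - intros y Y Hy HY. apply HM; lra.
  - now rewrite (iGamma_unique nu x p L Hx HL).
Qed.

(** The boundary term u^nu e^(-u) in the integration by parts for the recurrence of Gamma. *)
Definition gamma_boundary (nu : C) (u : R) : C := Cpower (RtoC u) nu * RtoC (exp (- u)).

Lemma gamma_boundary_integrand nu u : (0 < u)%R -> gamma_boundary nu u = gamma_integrand (nu + 1) 0 u.
Proof.
  intros Hu. unfold gamma_boundary, gamma_integrand. f_equal; [f_equal; ring|].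
  do 2 f_equal. field. lra.
Qed.

Lemma is_deriveC_gamma_boundary nu u :
  (0 < u)%R ->
  is_deriveC (gamma_boundary nu) u (nu * gamma_integrand nu 0 u + - (1) * gamma_integrand (nu + 1) 0 u).
Proof.
  intros Hu. rewrite <- gamma_boundary_integrand by exact Hu.
  replace (nu * gamma_integrand nu 0 u + - (1) * gamma_boundary nu u) with
    (nu * Cpower (RtoC u) (nu - 1) * RtoC (exp (- u))
     + Cpower (RtoC u) nu * RtoC (- exp (- u))).
  - apply (is_deriveC_mult (fun u : R => Cpower (RtoC u) nu) (fun u : R => RtoC (exp (- u)))).
    + now apply is_deriveC_Cpower_RtoC.
    + apply (is_deriveC_RtoC (fun u => exp (- u))). auto_derive; [exact I|ring].
  - unfold gamma_boundary, gamma_integrand. replace (- u - 0 / u)%R with (- u)%R by (field; lra).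
    rewrite RtoC_opp. ring.
Qed.

Lemma gamma_boundary_small nu :
  (0 < Re nu)%R -> forall eps, (0 < eps)%R -> exists d M, (0 < d)%R /\
  (forall u, (0 < u < d)%R -> (Cmod (gamma_boundary nu u) < eps)%R) /\
  (forall u, (0 < u)%R -> (M < u)%R -> (Cmod (gamma_boundary nu u) < eps)%R).
Proof.
  intros Hnu eps He.
  assert (E : forall u, (0 < u)%R -> Cmod (gamma_boundary nu u) = exp (Re nu * ln u - u)).
  { intros u Hu. unfold gamma_boundary. rewrite Cmod_mult, Cmod_Cpower_RtoC, Cmod_R by exact Hu.
    rewrite Rabs_pos_eq by (left; apply exp_pos). rewrite <- exp_plus. f_equal. }
  destruct (exp_ln_minus_le (Re nu)) as (K & HK & H); [lra|].
  exists (exp (ln eps / Re nu)), (- 2 * ln (eps / K))%R.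
  split; [apply exp_pos|]. split.
  - intros u [Hu1 Hu2]. rewrite E by exact Hu1. rewrite <- (exp_ln eps) by exact He.
    apply exp_increasing.
    apply ln_increasing in Hu2; [|exact Hu1]. rewrite ln_exp in Hu2.
    apply Rmult_lt_compat_l with (r := Re nu) in Hu2; [|exact Hnu].
    replace (Re nu * (ln eps / Re nu))%R with (ln eps) in Hu2 by (field; lra). lra.
  - intros u Hu HM. rewrite E by exact Hu. eapply Rle_lt_trans; [now apply H|].
    assert (HeK : (0 < eps / K)%R) by now apply Rdiv_lt_0_compat.
    replace eps with (K * (eps / K))%R by (field; lra).
    apply Rmult_lt_compat_l; [exact HK|]. rewrite <- (exp_ln (eps / K)) by exact HeK.
    apply exp_increasing. lra.
Qed.

Lemma is_improperC_gamma_boundary_derive nu :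
  (0 < Re nu)%R -> is_improperC (fun u => nu * gamma_integrand nu 0 u + - (1) * gamma_integrand (nu + 1) 0 u) 0 0.
Proof.
  intros Hnu.
  assert (Hc : contC (fun u => nu * gamma_integrand nu 0 u + - (1) * gamma_integrand (nu + 1) 0 u) 0).
  { apply contC_plus; apply contC_scal; apply contC_gamma_integrand; lra. }
  destruct Hc as [C1 C2].
  assert (Hcomp : forall (pr : C -> R) (f : R -> R),
    (forall z, (Rabs (pr z) <= Cmod z)%R) -> cont_on f 0 ->
    (forall u, (0 < u)%R -> is_derive (fun u => pr (gamma_boundary nu u)) u (f u)) -> is_improper f 0 0).
  { intros pr f Hpr Cf Hd eps He.
    destruct (gamma_boundary_small nu Hnu (eps / 2)%R ltac:(lra)) as (d & M & Hd0 & H1 & H2).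
    exists d, (Rmax M 0). split; [exact Hd0|]. intros y Y Hy HY.
    pose proof (Rmax_l M 0). pose proof (Rmax_r M 0).
    specialize (H1 y ltac:(lra)). specialize (H2 Y ltac:(lra) ltac:(lra)).
    rewrite (is_RInt_unique f y Y (minus (pr (gamma_boundary nu Y)) (pr (gamma_boundary nu y)))).
    - unfold minus, plus, opp; simpl. rewrite Rminus_0_r.
      eapply Rle_lt_trans; [apply Rabs_triang|]. rewrite Rabs_Ropp.
      pose proof (Hpr (gamma_boundary nu Y)). pose proof (Hpr (gamma_boundary nu y)). lra.
    - apply (is_RInt_derive (fun u => pr (gamma_boundary nu u))).
      + intros u [Hu _]. apply Hd. eapply Rlt_le_trans; [|exact Hu]. apply Rmin_glb_lt; lra.
      + intros u [Hu _]. apply Cf. eapply Rlt_le_trans; [|exact Hu]. apply Rmin_glb_lt; lra. }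
  split.
  - apply (Hcomp fst); [apply fst_abs_le|exact C1|]. intros u Hu.
    apply (is_deriveC_gamma_boundary nu u Hu).
  - apply (Hcomp snd); [apply snd_abs_le|exact C2|]. intros u Hu.
    apply (is_deriveC_gamma_boundary nu u Hu).
Qed.

(** The boundary term vanishes at both ends, so its derivative has integral 0. This yields
    convergence for 0 < Re nu < 1 and the recurrence at the same time. *)
Lemma is_improperC_gamma_step nu L :
  (0 < Re nu)%R -> is_improperC (gamma_integrand (nu + 1) 0) 0 L -> is_improperC (gamma_integrand nu 0) 0 (L / nu).
Proof.
  intros Hnu H.
  assert (Hn0 : nu <> 0) by now apply Cneq0_Re.
  pose proof (is_improperC_gamma_boundary_derive nu Hnu) as H'.
  assert (C0 : forall mu, contC (gamma_integrand mu 0) 0) by (intros; apply contC_gamma_integrand; lra).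
  assert (C1 : contC (fun u => nu * gamma_integrand nu 0 u + - (1) * gamma_integrand (nu + 1) 0 u) 0).
  { apply contC_plus; apply contC_scal; apply C0. }
  pose proof (is_improperC_plus _ _ 0 _ _ C1 (C0 (nu + 1)) H' H) as H2.
  pose proof (is_improperC_scal (/ nu) _ 0 _ (contC_plus _ _ 0 C1 (C0 (nu + 1))) H2) as H3.
  replace (L / nu) with (/ nu * (0 + L)) by (unfold Cdiv; ring).
  eapply is_improperC_ext; [|exact H3]. intros u _. simpl. field. exact Hn0.
Qed.

Lemma is_improperC_gamma nu : (0 < Re nu)%R -> is_improperC (gamma_integrand nu 0) 0 (iGamma nu 0 0).
Proof.
  intros Hnu.
  assert (H1 : (1 <= Re (nu + 1))%R) by (destruct nu; simpl in *; lra).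
  pose proof (is_improperC_gamma_step nu _ Hnu (is_improperC_gamma_ge_1 (nu + 1) 0 0 H1 (Rle_refl _) (Rle_refl _))) as H.
  now rewrite (iGamma_unique nu 0 0 _ (Rle_refl _) H).
Qed.

Lemma iGamma_rec nu : (0 < Re nu)%R -> iGamma (nu + 1) 0 0 = nu * iGamma nu 0 0.
Proof.
  intros Hnu.
  assert (H1 : (0 < Re (nu + 1))%R) by (destruct nu; simpl in *; lra).
  pose proof (is_improperC_gamma_step nu _ Hnu (is_improperC_gamma (nu + 1) H1)) as H.
  rewrite (iGamma_unique nu 0 0 _ (Rle_refl _) H). field. now apply Cneq0_Re.
Qed.

Lemma Re_plus_natC nu n : Re (nu + natC n) = (Re nu + INR n)%R.
Proof. destruct nu. reflexivity. Qed.

Lemma iGamma_poch nu n :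
  (0 < Re nu)%R -> iGamma (nu + natC n) 0 0 = poch nu n * iGamma nu 0 0.
Proof.
  intros Hnu. induction n.
  - replace (nu + natC 0) with nu by (unfold natC; simpl; ring). simpl. ring.
  - rewrite natC_S, Cplus_assoc, iGamma_rec, IHn.
    + simpl. ring.
    + rewrite Re_plus_natC. pose proof (pos_INR n). lra.
Qed.

Lemma iGamma_real_bound b :
  (1 <= b)%R -> exists G, (0 < G)%R /\ iGamma (RtoC b) 0 0 = RtoC G /\
  forall y Y, (0 < y)%R -> (y <= Y)%R -> (RInt (gamma_real_integrand b) y Y <= G)%R.
Proof.
  intros Hb. destruct (RInt_gamma_real_integrand_bounded b Hb) as [M HM].
  destruct (is_improper_exists (gamma_real_integrand b) 0 M) as (G & HG & HGle).
  - apply cont_gamma_real_integrand. lra.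
  - intros u _. left. apply gamma_real_integrand_pos.
  - exact HM.
  - exists G. split; [|split; [|exact HGle]].
    + apply Rlt_le_trans with (RInt (gamma_real_integrand b) 1 2); [|apply HGle; lra].
      apply RInt_gt_0; [lra|intros; apply gamma_real_integrand_pos|].
      intros u Hu. apply (cont_gamma_real_integrand b 0); lra.
    + apply iGamma_unique; [lra|].
      apply is_improperC_ext with (fun u => RtoC (gamma_real_integrand b u)).
      * intros u Hu. symmetry. now apply gamma_integrand_real.
      * split; simpl; [exact HG|apply is_improper_0].
Qed.

(** The integrand of Gamma(nu) has modulus u g(u) with g(u) = u^(b-1) e^(-u). Near and below x one
    has u <= x + 1, and the factor e^(-p/u) changes it by at most u g(u) (p / u) = p g(u). So each
    component differs by at most (x + 1 + p) G; the 2 counts the components. *)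
Lemma iGamma_compare nu x p b G :
  Re nu = (b + 1)%R -> (1 <= b)%R -> (0 <= x)%R -> (0 <= p)%R ->
  (forall y Y, (0 < y)%R -> (y <= Y)%R -> (RInt (gamma_real_integrand b) y Y <= G)%R) ->
  (Cmod (iGamma nu x p - iGamma nu 0 0) <= 2 * (x + 1 + p) * G)%R.
Proof.
  intros Hnu Hb Hx Hp HG.
  destruct (is_improperC_gamma_ge_1 nu x p) as [A1 A2]; [lra|exact Hx|exact Hp|].
  destruct (is_improperC_gamma_ge_1 nu 0 0) as [B1 B2]; [lra|lra|lra|].
  assert (Hle : forall u, (0 < u)%R -> Cmod (gamma_integrand nu 0 u) = (u * gamma_real_integrand b u)%R).
  { intros u Hu. rewrite Cmod_gamma_integrand_0, Hnu by exact Hu. unfold gamma_real_integrand.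
    rewrite <- (exp_ln u) at 3 by exact Hu. rewrite <- exp_plus. f_equal. ring. }
  assert (Hdiff : forall u, (0 < u)%R ->
    (Cmod (gamma_integrand nu p u - gamma_integrand nu 0 u) <= p * gamma_real_integrand b u)%R).
  { intros u Hu. rewrite gamma_integrand_p.
    replace (gamma_integrand nu 0 u * RtoC (exp (- (p / u))) - gamma_integrand nu 0 u)
      with (gamma_integrand nu 0 u * RtoC (exp (- (p / u)) - 1)) by (rewrite RtoC_minus; ring).
    rewrite Cmod_mult, Hle, Cmod_R by exact Hu.
    assert (Hpu : (0 <= p / u)%R).
    { apply Rmult_le_pos; [exact Hp|]. left. now apply Rinv_0_lt_compat. }
    pose proof (exp_neg_le_1 _ Hpu). pose proof (exp_ineq1_le (- (p / u))).
    rewrite Rabs_left1 by lra. pose proof (gamma_real_integrand_pos b u).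
    apply Rle_trans with (u * gamma_real_integrand b u * (p / u))%R.
    - apply Rmult_le_compat_l; [apply Rmult_le_pos; lra|lra].
    - right. field. lra. }
  assert (Hcomp : forall (f1 f0 : R -> R) L1 L0,
    cont_on f1 x -> cont_on f0 0 -> is_improper f1 x L1 -> is_improper f0 0 L0 ->
    (forall u, (0 < u)%R -> (Rabs (f0 u) <= u * gamma_real_integrand b u)%R) ->
    (forall u, (0 < u)%R -> (Rabs (f1 u - f0 u) <= p * gamma_real_integrand b u)%R) ->
    (Rabs (L1 - L0) <= (x + 1 + p) * G)%R).
  { intros f1 f0 L1 L0 Cf1 Cf0 H1 H0 Hf0 Hf10. apply le_epsilon. intros eps He.
    destruct (H1 (eps / 2)%R ltac:(lra)) as (d1 & M1 & Hd1 & I1).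
    destruct (H0 (eps / 2)%R ltac:(lra)) as (d0 & M0 & Hd0 & I0).
    (* The cap at 1 keeps y <= x + 1, so that the piece below y is controlled by (x + 1) g. *)
    set (y := (x + Rmin (d1 / 2) 1)%R).
    assert (Hy : (x < y < x + d1)%R).
    { unfold y. pose proof (Rmin_l (d1 / 2) 1).
      assert (0 < Rmin (d1 / 2) 1)%R by (apply Rmin_pos; lra). lra. }
    assert (Hy1 : (y <= x + 1)%R) by (unfold y; pose proof (Rmin_r (d1 / 2) 1); lra).
    set (y' := (Rmin (d0 / 2) (y / 2))%R).
    assert (Hy'0 : (0 < y')%R) by (apply Rmin_pos; lra).
    assert (Hy'1 : (y' < d0)%R) by (unfold y'; pose proof (Rmin_l (d0 / 2) (y / 2)); lra).
    assert (Hy'2 : (y' < y)%R) by (unfold y'; pose proof (Rmin_r (d0 / 2) (y / 2)); lra).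
    set (Y := (Rmax (Rmax M1 M0) y + 1)%R).
    pose proof (Rmax_l (Rmax M1 M0) y). pose proof (Rmax_r (Rmax M1 M0) y).
    pose proof (Rmax_l M1 M0). pose proof (Rmax_r M1 M0).
    specialize (I1 y Y Hy ltac:(unfold Y; lra)).
    specialize (I0 y' Y ltac:(lra) ltac:(unfold Y; lra)).
    assert (HYy : (y < Y)%R) by (unfold Y; lra). clearbody Y y' y.
    assert (E1 : ex_RInt f1 y Y) by (apply cont_ex_RInt with x; auto; lra).
    assert (E0 : forall a c, (0 < a)%R -> (0 < c)%R -> ex_RInt f0 a c)
      by (intros; apply cont_ex_RInt with 0%R; auto; lra).
    assert (Eg : forall a c, (0 < a)%R -> (0 < c)%R -> ex_RInt (gamma_real_integrand b) a c)
      by (intros; apply cont_ex_RInt with 0%R; auto; apply cont_gamma_real_integrand; lra).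
    assert (Ch : RInt f0 y' Y = (RInt f0 y' y + RInt f0 y Y)%R).
    { symmetry. apply (RInt_Chasles f0 y' y Y); apply E0; lra. }
    assert (Cg : (RInt (gamma_real_integrand b) y' y + RInt (gamma_real_integrand b) y Y <= G)%R).
    { eapply Rle_trans; [|apply (HG y' Y); lra]. right.
      apply (RInt_Chasles (gamma_real_integrand b) y' y Y); apply Eg; lra. }
    assert (T1 : (Rabs (RInt f0 y' y) <= (x + 1) * RInt (gamma_real_integrand b) y' y)%R).
    { rewrite <- RInt_mult_l by (apply Eg; lra).
      apply (norm_RInt_le (V := R_NormedModule) f0 (fun u => ((x + 1) * gamma_real_integrand b u)%R) y' y);
        [lra| |apply (RInt_correct (V := R_CompleteNormedModule)), E0; lra
        |apply (RInt_correct (V := R_CompleteNormedModule)),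
          (ex_RInt_scal (V := R_NormedModule)), Eg; lra].
      intros u Hu. eapply Rle_trans; [apply Hf0; lra|].
      apply Rmult_le_compat_r; [left; apply gamma_real_integrand_pos|lra]. }
    assert (T2 : (Rabs (RInt f1 y Y - RInt f0 y Y) <= p * RInt (gamma_real_integrand b) y Y)%R).
    { rewrite <- RInt_mult_l by (apply Eg; lra).
      replace (RInt f1 y Y - RInt f0 y Y)%R with (RInt (fun u => minus (f1 u) (f0 u)) y Y)
        by (apply (RInt_minus (V := R_CompleteNormedModule)); [exact E1|apply E0; lra]).
      apply (norm_RInt_le (V := R_NormedModule) (fun u => minus (f1 u) (f0 u))
        (fun u => (p * gamma_real_integrand b u)%R) y Y);
        [lra| |apply (RInt_correct (V := R_CompleteNormedModule)),
          (ex_RInt_minus (V := R_NormedModule)); [exact E1|apply E0; lra]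
        |apply (RInt_correct (V := R_CompleteNormedModule)),
          (ex_RInt_scal (V := R_NormedModule)), Eg; lra].
      intros u Hu. apply Hf10. lra. }
    assert (P1 : (0 <= RInt (gamma_real_integrand b) y' y)%R).
    { apply RInt_ge_0; [lra|apply Eg; lra|]. intros; left; apply gamma_real_integrand_pos. }
    assert (P2 : (0 <= RInt (gamma_real_integrand b) y Y)%R).
    { apply RInt_ge_0; [lra|apply Eg; lra|]. intros; left; apply gamma_real_integrand_pos. }
    replace (L1 - L0)%R with (- (RInt f1 y Y - L1) + ((RInt f0 y' Y - L0)
      + ((RInt f1 y Y - RInt f0 y Y) - RInt f0 y' y)))%R by (rewrite Ch; ring).
    eapply Rle_trans; [apply Rabs_triang|]. rewrite Rabs_Ropp.
    eapply Rle_trans; [apply Rplus_le_compat_l, Rabs_triang|].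
    pose proof (Rabs_triang (RInt f1 y Y - RInt f0 y Y) (- RInt f0 y' y)) as T3.
    rewrite Rabs_Ropp in T3. unfold Rminus in *.
    assert ((x + 1) * RInt (gamma_real_integrand b) y' y + p * RInt (gamma_real_integrand b) y Y <= (x + 1 + p) * G)%R
      by nra. lra. }
  destruct (contC_gamma_integrand nu p x Hx) as [C1 C2].
  destruct (contC_gamma_integrand nu 0 0 (Rle_refl _)) as [D1 D2].
  pose proof (Hcomp _ _ _ _ C1 D1 A1 B1) as K1.
  pose proof (Hcomp _ _ _ _ C2 D2 A2 B2) as K2.
  eapply Rle_trans; [apply Cmod_le_abs|].
  change (fst (iGamma nu x p - iGamma nu 0 0)) with (fst (iGamma nu x p) - fst (iGamma nu 0 0))%R.
  change (snd (iGamma nu x p - iGamma nu 0 0)) with (snd (iGamma nu x p) - snd (iGamma nu 0 0))%R.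
  assert (K1' : (Rabs (fst (iGamma nu x p) - fst (iGamma nu 0 0)) <= (x + 1 + p) * G)%R).
  { apply K1.
    - intros u Hu. rewrite <- Hle by exact Hu. apply fst_abs_le.
    - intros u Hu. eapply Rle_trans; [|apply (Hdiff u Hu)].
      apply (fst_abs_le (gamma_integrand nu p u - gamma_integrand nu 0 u)). }
  assert (K2' : (Rabs (snd (iGamma nu x p) - snd (iGamma nu 0 0)) <= (x + 1 + p) * G)%R).
  { apply K2.
    - intros u Hu. rewrite <- Hle by exact Hu. apply snd_abs_le.
    - intros u Hu. eapply Rle_trans; [|apply (Hdiff u Hu)].
      apply (snd_abs_le (gamma_integrand nu p u - gamma_integrand nu 0 u)). }
  lra.
Qed.

(** * Growth of the coefficients *)

Local Open Scope R_scope.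

(** f has the size of (n!)^P up to polynomial factors, from both sides and for large n. The lower
    bound is stated without division. *)
Definition fact_growth (P : nat) (f : nat -> R) : Prop :=
  exists K k n0, 0 < K /\ forall n, (n0 <= n)%nat ->
    INR (fact n) ^ P <= K * INR (S n) ^ k * f n /\
    f n <= K * INR (S n) ^ k * INR (fact n) ^ P.

Lemma INR_S_ge_1 n : 1 <= INR (S n).
Proof. rewrite S_INR. pose proof (pos_INR n). lra. Qed.

Lemma fact_growth_pos P f :
  fact_growth P f -> exists n0, forall n, (n0 <= n)%nat -> 0 < f n.
Proof.
  intros (K & k & n0 & HK & H). exists n0. intros n Hn. destruct (H n Hn) as [H1 _].
  pose proof (pow_lt _ P (INR_fact_lt_0 n)).
  pose proof (pow_lt (INR (S n)) k ltac:(pose proof (INR_S_ge_1 n); lra)).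
  assert (0 < K * INR (S n) ^ k) by now apply Rmult_lt_0_compat. nra.
Qed.

Lemma fact_growth_mult P Q f g :
  fact_growth P f -> fact_growth Q g -> fact_growth (P + Q) (fun n => f n * g n).
Proof.
  intros Hf Hg.
  destruct (fact_growth_pos P f Hf) as [nf Hfp].
  destruct (fact_growth_pos Q g Hg) as [ng Hgp].
  destruct Hf as (K & k & n0 & HK & H), Hg as (L & l & n1 & HL & H').
  exists (K * L), (k + l)%nat, (max (max n0 n1) (max nf ng)).
  split; [now apply Rmult_lt_0_compat|].
  intros n Hn.
  destruct (H n ltac:(lia)) as [A1 A2], (H' n ltac:(lia)) as [B1 B2].
  specialize (Hfp n ltac:(lia)). specialize (Hgp n ltac:(lia)).
  pose proof (pow_lt _ P (INR_fact_lt_0 n)). pose proof (pow_lt _ Q (INR_fact_lt_0 n)).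
  rewrite !pow_add. split.
  - replace (K * L * (INR (S n) ^ k * INR (S n) ^ l) * (f n * g n))
      with (K * INR (S n) ^ k * f n * (L * INR (S n) ^ l * g n)) by ring.
    apply Rmult_le_compat; lra.
  - replace (K * L * (INR (S n) ^ k * INR (S n) ^ l)
        * (INR (fact n) ^ P * INR (fact n) ^ Q))
      with (K * INR (S n) ^ k * INR (fact n) ^ P * (L * INR (S n) ^ l * INR (fact n) ^ Q))
      by ring.
    apply Rmult_le_compat; lra.
Qed.

Lemma fact_growth_const c : 0 < c -> fact_growth 0 (fun _ => c).
Proof.
  intros Hc. exists (c + / c), 0%nat, 0%nat.
  assert (0 < / c) by now apply Rinv_0_lt_compat.
  split; [lra|]. intros n _. simpl. split; [|lra].
  assert (/ c * c = 1) by (apply Rinv_l; lra). nra.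
Qed.

Lemma fact_growth_fact : fact_growth 1 (fun n => INR (fact n)).
Proof. exists 1, 0%nat, 0%nat. split; [lra|]. intros n _. simpl. split; lra. Qed.

Lemma fact_growth_between f g h P :
  fact_growth P f -> fact_growth P h ->
  (exists c d n0, 0 < c /\ 0 < d /\ forall n, (n0 <= n)%nat -> c * f n <= g n <= d * h n) ->
  fact_growth P g.
Proof.
  intros (K & k & n0 & HK & H) (L & l & n1 & HL & H') (c & d & n2 & Hc & Hd & Hg).
  exists (K / c + d * L), (k + l)%nat, (max (max n0 n1) n2).
  assert (HKc : 0 < K / c) by now apply Rdiv_lt_0_compat.
  assert (HdL : 0 < d * L) by now apply Rmult_lt_0_compat.
  split; [lra|]. intros n Hn.
  destruct (H n ltac:(lia)) as [A1 _], (H' n ltac:(lia)) as [_ B2].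
  destruct (Hg n ltac:(lia)) as [G1 G2].
  pose proof (INR_S_ge_1 n) as HS.
  pose proof (pow_R1_Rle _ k HS) as Hk. pose proof (pow_R1_Rle _ l HS) as Hl.
  pose proof (pow_lt _ P (INR_fact_lt_0 n)) as HP.
  rewrite pow_add.
  set (u := INR (S n) ^ k) in *. set (v := INR (S n) ^ l) in *.
  set (F := INR (fact n) ^ P) in *.
  assert (Hf : 0 < f n).
  { assert (0 < K * u) by (apply Rmult_lt_0_compat; lra). nra. }
  assert (Hgp : 0 < g n) by nra.
  split.
  - apply Rle_trans with (K / c * u * g n).
    + eapply Rle_trans; [exact A1|].
      replace (K * u * f n) with (K / c * u * (c * f n)) by (field; lra).
      apply Rmult_le_compat_l; [apply Rmult_le_pos; lra|exact G1].
    + apply Rmult_le_compat_r; [lra|].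
      apply Rmult_le_compat; [lra|lra|lra|]. nra.
  - eapply Rle_trans; [exact G2|].
    apply Rle_trans with (d * L * v * F).
    + rewrite !Rmult_assoc. apply Rmult_le_compat_l; [lra|].
      rewrite <- Rmult_assoc. exact B2.
    + apply Rmult_le_compat_r; [lra|].
      apply Rmult_le_compat; [lra|lra|lra|]. nra.
Qed.

Lemma fact_growth_ext P f g :
  (forall n, f n = g n) -> fact_growth P f -> fact_growth P g.
Proof.
  intros E (K & k & n0 & HK & H). exists K, k, n0. split; [exact HK|].
  intros n Hn. rewrite <- E. now apply H.
Qed.

Lemma bernoulli_INR (n k : nat) :
  (1 + INR k / INR (S n)) * INR (S n) ^ k <= INR (S (S n)) ^ k.
Proof.
  pose proof (INR_S_ge_1 n) as HS.
  assert (H0 : 0 < / INR (S n)) by (apply Rinv_0_lt_compat; lra).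
  pose proof (poly k _ H0) as H.
  replace (INR (S (S n))) with ((1 + / INR (S n)) * INR (S n)).
  - rewrite Rpow_mult_distr. apply Rmult_le_compat_r; [apply pow_le; lra|exact H].
  - rewrite (S_INR (S n)). field. lra.
Qed.

Lemma poch_neq0 (a : C) n : ~ nonpos_int a -> poch a n <> 0%C.
Proof.
  intros Ha. induction n; simpl.
  - intros E. apply RtoC_inj in E. lra.
  - apply Cmult_neq_0; [exact IHn|]. intros E. apply Ha. exists n.
    rewrite <- (Cplus_0_l (- natC n)), <- E. ring.
Qed.

(** Bernoulli's inequality ((n + 2) / (n + 1))^L >= 1 + L / (n + 1) pays for the factor |a + n| <=
    (n + 1) + L. *)
Lemma Cmod_poch_upper (a : C) (L n : nat) :
  Cmod a <= INR L -> Cmod (poch a n) <= INR (S n) ^ L * INR (fact n).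
Proof.
  intros HL. induction n.
  - simpl. rewrite Cmod_1, pow1. lra.
  - rewrite Cmod_poch_S.
    pose proof (Cmod_plus_natC_le a n) as H1. pose proof (INR_S_ge_1 n) as HS.
    apply Rle_trans with (INR (S n) ^ L * INR (fact n) * (INR L + INR (S n))).
    + apply Rmult_le_compat; [apply Cmod_ge_0|apply Cmod_ge_0|exact IHn|].
      rewrite S_INR. lra.
    + change (fact (S n)) with (S n * fact n)%nat. rewrite mult_INR.
      pose proof (bernoulli_INR n L) as HB.
      apply Rmult_le_compat_r with (r := INR (S n) * INR (fact n)) in HB.
      * replace ((1 + INR L / INR (S n)) * INR (S n) ^ L * (INR (S n) * INR (fact n)))
          with (INR (S n) ^ L * INR (fact n) * (INR L + INR (S n))) in HB by (field; lra).
        exact HB.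
      * apply Rmult_le_pos; [lra|]. left. apply INR_fact_lt_0.
Qed.

(** The lower bound holds because |(a)_n| (n + 1)^k / n! is eventually nondecreasing for k = 2 L:
    with s = n + 1, |a + n| >= s - L and Bernoulli's factor 1 + 2 L / s give (s - L) (s + 2 L) >=
    s^2 as soon as s >= 2 L. *)
Lemma fact_growth_poch (a : C) : ~ nonpos_int a -> fact_growth 1 (fun n => Cmod (poch a n)).
Proof.
  intros Ha. destruct (exists_nat_ge (Cmod a + 1)) as [L HL].
  set (k := (2 * L)%nat).
  set (D := fun n => Cmod (poch a n) * INR (S n) ^ k / INR (fact n)).
  assert (Hpos : forall n, 0 < Cmod (poch a n)) by (intros; now apply Cmod_gt_0, poch_neq0).
  assert (HSk : forall n, 0 < INR (S n) ^ k).
  { intros n. apply pow_lt. pose proof (INR_S_ge_1 n). lra. }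
  assert (HD : forall n, (k <= n)%nat -> D n <= D (S n)).
  { intros n Hn. unfold D. rewrite Cmod_poch_S.
    change (fact (S n)) with (S n * fact n)%nat. rewrite mult_INR.
    pose proof (INR_S_ge_1 n) as HS. pose proof (INR_fact_lt_0 n) as HF.
    pose proof (bernoulli_INR n k) as HB. pose proof (HSk n) as Hp.
    assert (Hk : INR k = 2 * INR L) by (unfold k; rewrite mult_INR; simpl; lra).
    assert (HnL : 2 * INR L <= INR n) by (rewrite <- Hk; now apply le_INR).
    pose proof (pos_INR L) as HL0.
    assert (Han : INR (S n) - INR L <= Cmod (a + natC n)).
    { pose proof (Cmod_triangle (a + natC n) (- a)) as H.
      replace (a + natC n + - a)%C with (natC n) in H by ring.
      rewrite Cmod_natC, Cmod_opp in H. rewrite S_INR. lra. }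
    rewrite Hk in HB.
    assert (Hmain : INR (S n) * INR (S n) ^ k <= Cmod (a + natC n) * INR (S (S n)) ^ k).
    { apply Rle_trans with ((INR (S n) - INR L)
        * ((1 + 2 * INR L / INR (S n)) * INR (S n) ^ k)).
      - rewrite <- Rmult_assoc. apply Rmult_le_compat_r; [lra|].
        apply Rmult_le_reg_r with (INR (S n)); [lra|].
        replace ((INR (S n) - INR L) * (1 + 2 * INR L / INR (S n)) * INR (S n))
          with ((INR (S n) - INR L) * (INR (S n) + 2 * INR L)) by (field; lra).
        rewrite S_INR. nra.
      - apply Rmult_le_compat; [rewrite S_INR; lra| |exact Han|exact HB].
        apply Rmult_le_pos; [|lra].
        assert (0 <= 2 * INR L / INR (S n)); [|lra].
        apply Rmult_le_pos; [lra|]. left. apply Rinv_0_lt_compat. lra. }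
    apply Rmult_le_reg_r with (INR (S n) * INR (fact n)); [apply Rmult_lt_0_compat; lra|].
    replace (Cmod (poch a n) * INR (S n) ^ k / INR (fact n) * (INR (S n) * INR (fact n)))
      with (Cmod (poch a n) * (INR (S n) * INR (S n) ^ k)) by (field; lra).
    replace (Cmod (poch a n) * Cmod (a + natC n) * INR (S (S n)) ^ k
        / (INR (S n) * INR (fact n)) * (INR (S n) * INR (fact n)))
      with (Cmod (poch a n) * (Cmod (a + natC n) * INR (S (S n)) ^ k)) by (field; lra).
    apply Rmult_le_compat_l; [left; apply Hpos|exact Hmain]. }
  assert (HDk : 0 < D k).
  { apply Rdiv_lt_0_compat; [|apply INR_fact_lt_0].
    apply Rmult_lt_0_compat; [apply Hpos|apply HSk]. }
  assert (HDn : forall n, (k <= n)%nat -> D k <= D n).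
  { intros n Hn. induction Hn; [lra|]. eapply Rle_trans; [exact IHHn|now apply HD]. }
  assert (HiD : 0 < / D k) by now apply Rinv_0_lt_compat.
  exists (/ D k + 1), k, k. split; [lra|].
  intros n Hn. specialize (HDn n Hn). rewrite pow_1.
  pose proof (INR_fact_lt_0 n) as HF. pose proof (HSk n) as HS.
  specialize (Hpos n). split.
  - apply Rle_trans with (/ D k * INR (S n) ^ k * Cmod (poch a n)).
    + apply Rmult_le_compat_r with (r := INR (fact n) * / D k) in HDn;
        [|apply Rmult_le_pos; lra].
      replace (D k * (INR (fact n) * / D k)) with (INR (fact n)) in HDn by (field; lra).
      unfold D at 1 in HDn.
      replace (Cmod (poch a n) * INR (S n) ^ k / INR (fact n) * (INR (fact n) * / D k))
        with (/ D k * INR (S n) ^ k * Cmod (poch a n)) in HDn by (field; lra).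
      exact HDn.
    + apply Rmult_le_compat_r; [lra|]. apply Rmult_le_compat_r; lra.
  - eapply Rle_trans; [apply (Cmod_poch_upper a L n); lra|].
    apply Rmult_le_compat_r; [lra|].
    apply Rle_trans with (1 * INR (S n) ^ k).
    + rewrite Rmult_1_l. apply Rle_pow; [apply INR_S_ge_1|unfold k; lia].
    + apply Rmult_le_compat_r; lra.
Qed.

(** Each unit of shift costs a factor n in the factorial, that is, one more power in the polynomial
    factor; the truncated subtraction affects only small n. *)
Lemma fact_growth_shift f k : fact_growth 1 f -> fact_growth 1 (fun n => f (n - k)%nat).
Proof.
  induction k; intros H.
  - eapply fact_growth_ext; [|exact H]. intros n. now rewrite Nat.sub_0_r.
  - apply IHk in H. clear IHk. destruct H as (K & l & n0 & HK & H).
    exists K, (S l), (S n0). split; [exact HK|].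
    intros n Hn. destruct n as [|n]; [lia|].
    destruct (H n ltac:(lia)) as [H1 H2]. rewrite pow_1 in *.
    replace (S n - S k)%nat with (n - k)%nat by lia.
    pose proof (INR_S_ge_1 n) as HS. pose proof (INR_fact_lt_0 n) as HF.
    assert (Hle : INR (S n) <= INR (S (S n))) by (apply le_INR; lia).
    assert (Hp : INR (S n) ^ l <= INR (S (S n)) ^ l) by (apply pow_incr; lra).
    pose proof (pow_lt (INR (S n)) l ltac:(lra)) as Hp0.
    change (fact (S n)) with (S n * fact n)%nat. rewrite mult_INR.
    assert (Hf : 0 < f (n - k)%nat).
    { assert (0 < K * INR (S n) ^ l) by (apply Rmult_lt_0_compat; lra). nra. }
    change (INR (S (S n)) ^ S l) with (INR (S (S n)) * INR (S (S n)) ^ l).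
    set (u := INR (S (S n))) in *. set (s := INR (S n)) in *. split.
    + apply Rle_trans with (u * (K * s ^ l * f (n - k)%nat)).
      * apply Rmult_le_compat; lra.
      * replace (K * (u * u ^ l) * f (n - k)%nat) with (u * (K * u ^ l * f (n - k)%nat)) by ring.
        apply Rmult_le_compat_l; [lra|]. apply Rmult_le_compat_r; [lra|].
        apply Rmult_le_compat_l; lra.
    + eapply Rle_trans; [exact H2|].
      apply Rle_trans with (K * u ^ l * INR (fact n)).
      * apply Rmult_le_compat_r; [lra|]. apply Rmult_le_compat_l; lra.
      * replace (K * (u * u ^ l) * (s * INR (fact n)))
          with (K * u ^ l * INR (fact n) * (u * s)) by ring.
        rewrite <- (Rmult_1_r (K * u ^ l * INR (fact n))) at 1.
        apply Rmult_le_compat_l; [|nra].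
        apply Rmult_le_pos; [apply Rmult_le_pos; lra|lra].
Qed.

Lemma Re_not_nonpos_int (z : C) : 0 < Re z -> ~ nonpos_int z.
Proof.
  intros H [k ->]. unfold natC in H. simpl in H. pose proof (pos_INR k). lra.
Qed.

(** The error of the comparison with Gamma is measured by (Re nu)_n; this makes it comparable with
    the main term (nu)_n. *)
Lemma Cmod_poch_ge_Re (nu : C) n :
  0 <= Re nu -> Cmod (poch (RtoC (Re nu)) n) <= Cmod (poch nu n).
Proof.
  intros H. induction n; [simpl; lra|]. rewrite !Cmod_poch_S.
  apply Rmult_le_compat; try apply Cmod_ge_0; [exact IHn|].
  unfold natC. rewrite <- RtoC_plus, Cmod_R.
  apply Rle_trans with (Rabs (Re (nu + natC n))); [|apply re_le_Cmod].
  now rewrite Re_plus_natC.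
Qed.

(* [Gamma(nu + n, x; p)] is a small perturbation of [Gamma(nu + n)]: the difference is
   O(Gamma(Re nu + n - 1)). *)
Lemma fact_growth_iGamma_large (nu : C) (x p : R) :
  2 <= Re nu -> 0 <= x -> 0 <= p -> iGamma nu 0 0 <> 0%C ->
  fact_growth 1 (fun n => Cmod (iGamma (nu + natC n) x p)).
Proof.
  intros Hnu Hx Hp H0. set (b := Re nu) in *.
  destruct (iGamma_real_bound b) as (G & HG & EG & _); [lra|].
  set (g := Cmod (iGamma nu 0 0)). assert (Hg : 0 < g) by now apply Cmod_gt_0.
  set (c := 2 * (x + 1 + p) * G).
  assert (Hc : 0 < c).
  { unfold c. apply Rmult_lt_0_compat; [|exact HG]. lra. }
  assert (Hcmp : forall n, Cmod (iGamma (nu + natC n) x p - iGamma (nu + natC n) 0 0)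
    * (b + INR n - 1) <= c * Cmod (poch (RtoC b) n)).
  { intros n. pose proof (pos_INR n) as Hn0.
    destruct (iGamma_real_bound (b + INR n - 1)) as (G1 & HG1 & EG1 & HG1le); [lra|].
    pose proof (iGamma_compare (nu + natC n) x p (b + INR n - 1) G1) as H.
    rewrite Re_plus_natC in H. fold b in H.
    specialize (H ltac:(lra) ltac:(lra) Hx Hp HG1le).
    (* Both sides are Gamma(b + n), reached by one step from b + n - 1 and by n steps from b. *)
    assert (E : (b + INR n - 1) * G1 = Cmod (poch (RtoC b) n) * G).
    { assert (E1 : iGamma (RtoC b + natC n) 0 0 = (RtoC (b + INR n - 1) * RtoC G1)%C).
      { replace (RtoC b + natC n)%C with (RtoC (b + INR n - 1) + 1)%C
          by (unfold natC; rewrite RtoC_minus, RtoC_plus; ring).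
        rewrite iGamma_rec by (simpl; lra). now rewrite EG1. }
      rewrite iGamma_poch, EG in E1 by (simpl; lra).
      apply (f_equal Cmod) in E1. rewrite !Cmod_mult, !Cmod_R in E1.
      rewrite (Rabs_pos_eq G), (Rabs_pos_eq G1), Rabs_pos_eq in E1 by lra. lra. }
    unfold c. rewrite Rmult_comm.
    apply Rle_trans with ((b + INR n - 1) * (2 * (x + 1 + p) * G1)).
    - apply Rmult_le_compat_l; [lra|exact H].
    - right. transitivity (2 * (x + 1 + p) * ((b + INR n - 1) * G1)); [ring|].
      rewrite E. ring. }
  assert (Hnb : ~ nonpos_int (RtoC b)) by (apply Re_not_nonpos_int; simpl; lra).
  assert (Hnn : ~ nonpos_int nu) by (apply Re_not_nonpos_int; fold b; lra).
  (* From n0 on the error is at most half of the main term g |(nu)_n|. *)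
  destruct (exists_nat_ge (2 * c / g)) as [n0 Hn0].
  apply (fact_growth_between (fun n => Cmod (poch (RtoC b) n)) _
    (fun n => Cmod (poch nu n))); [now apply fact_growth_poch|now apply fact_growth_poch|].
  exists (g / 2), (2 * g), n0. split; [lra|]. split; [lra|].
  intros n Hn. apply le_INR in Hn. specialize (Hcmp n).
  pose proof (Cmod_poch_ge_Re nu n) as Hge. fold b in Hge. specialize (Hge ltac:(lra)).
  set (A := Cmod (poch (RtoC b) n)) in *. set (B := Cmod (poch nu n)) in *.
  assert (HA : 0 <= A) by apply Cmod_ge_0.
  assert (HI : Cmod (iGamma (nu + natC n) 0 0) = B * g).
  { rewrite iGamma_poch by (fold b; lra). apply Cmod_mult. }
  set (E := Cmod (iGamma (nu + natC n) x p - iGamma (nu + natC n) 0 0)) in *.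
  assert (HE : E <= g / 2 * A).
  { assert (Hcg : 2 * c <= g * (b + INR n - 1)).
    { apply Rle_trans with (g * (2 * c / g)); [right; field; lra|].
      apply Rmult_le_compat_l; lra. }
    apply Rmult_le_reg_r with (b + INR n - 1); [pose proof (pos_INR n); lra|].
    eapply Rle_trans; [exact Hcmp|].
    replace (g / 2 * A * (b + INR n - 1)) with (g * (b + INR n - 1) / 2 * A) by field.
    apply Rmult_le_compat_r; lra. }
  pose proof (Cmod_triangle (iGamma (nu + natC n) x p - iGamma (nu + natC n) 0 0)
    (iGamma (nu + natC n) 0 0)) as T1.
  replace (iGamma (nu + natC n) x p - iGamma (nu + natC n) 0 0 + iGamma (nu + natC n) 0 0)%C
    with (iGamma (nu + natC n) x p) in T1 by ring.
  pose proof (Cmod_triangle (iGamma (nu + natC n) x p)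
    (- (iGamma (nu + natC n) x p - iGamma (nu + natC n) 0 0))) as T2.
  replace (iGamma (nu + natC n) x p + - (iGamma (nu + natC n) x p - iGamma (nu + natC n) 0 0))%C
    with (iGamma (nu + natC n) 0 0) in T2 by ring.
  rewrite Cmod_opp in T2. fold E in T1, T2. rewrite HI in T1, T2.
  split; nra.
Qed.

(** With the k of [CGamma], the value Gamma(alpha + k) is nonzero and Re (alpha + k) > 0. Two
    further steps reach real part at least 2, and the index is then shifted back by k + 2. *)
Lemma fact_growth_iGamma (alpha : C) (x p : R) :
  ~ nonpos_int alpha -> CGamma alpha <> 0%C -> 0 <= x -> 0 <= p ->
  fact_growth 1 (fun m => Cmod (iGamma (alpha + natC m) x p)).
Proof.
  intros Ha HG Hx Hp. unfold CGamma in HG.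
  set (k := Z.to_nat (up (- Re alpha))) in *.
  assert (Hk : 0 < Re (alpha + natC k)).
  { rewrite Re_plus_natC. destruct (archimed (- Re alpha)) as [Hup _].
    unfold k. rewrite INR_IZR_INZ.
    destruct (Z_le_gt_dec 0 (up (- Re alpha))) as [Hz|Hz].
    - rewrite Z2Nat.id by exact Hz. lra.
    (* [Z.to_nat] sends a negative integer to 0; in this case Re alpha is already positive. *)
    - assert (IZR (up (- Re alpha)) < 0) by (apply (IZR_lt _ 0); lia).
      assert (0 <= IZR (Z.of_nat (Z.to_nat (up (- Re alpha))))) by (apply IZR_le; lia).
      lra. }
  assert (HG0 : iGamma (alpha + natC k) 0 0 <> 0%C).
  { intros E. apply HG. rewrite E. unfold Cdiv. ring. }
  assert (H2 : fact_growth 1 (fun n => Cmod (iGamma (alpha + natC k + natC 2 + natC n) x p))).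
  { apply fact_growth_iGamma_large; auto.
    - rewrite Re_plus_natC. simpl (INR 2). lra.
    - rewrite iGamma_poch by exact Hk. apply Cmult_neq_0; [|exact HG0].
      apply poch_neq0. now apply Re_not_nonpos_int. }
  apply (fact_growth_shift _ (k + 2)) in H2.
  destruct H2 as (K & l & n0 & HK & H). exists K, l, (max n0 (k + 2)).
  split; [exact HK|]. intros n Hn. specialize (H n ltac:(lia)).
  replace (alpha + natC k + natC 2 + natC (n - (k + 2)))%C with (alpha + natC n)%C in H.
  - exact H.
  - rewrite <- !Cplus_assoc, <- !natC_plus. do 2 f_equal. lia.
Qed.

(** * Quotients of factorial type: geometric decay or a lower bound *)

Local Open Scope R_scope.

Lemma eventually_bounded (f : nat -> R) M n0 :
  (forall m, (n0 <= m)%nat -> f m <= M) -> exists M', forall m, f m <= M'.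
Proof.
  revert M. induction n0; intros M H; [exists M; intros; apply H; lia|].
  apply (IHn0 (Rmax M (f n0))). intros m Hm.
  destruct (Nat.eq_dec m n0) as [->|Hne]; [apply Rmax_r|].
  eapply Rle_trans; [apply H; lia|apply Rmax_l].
Qed.

(** One linear factor is peeled off at a time by writing y^m = (y / v)^m v^m with v between y and
    1. *)
Lemma poly_geometric_bounded j y :
  0 <= y < 1 -> exists M, forall m, INR (S m) ^ j * y ^ m <= M.
Proof.
  revert y. induction j; intros y Hy.
  - exists 1. intros m. simpl. rewrite Rmult_1_l. apply pow_le_1. lra.
  - set (v := (y + 1) / 2). assert (Hv : 0 < v < 1) by (unfold v; lra).
    assert (Hyv : 0 <= y / v < 1).
    { split; [apply Rmult_le_pos; [lra|]; left; apply Rinv_0_lt_compat; lra|].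
      apply Rmult_lt_reg_r with v; [lra|]. unfold Rdiv.
      rewrite Rmult_assoc, Rinv_l by lra. unfold v. lra. }
    destruct (IHj v ltac:(lra)) as [M HM].
    destruct (linear_geometric_bounded _ Hyv) as (K & HK & HKb).
    exists (K * M). intros m. specialize (HM m). specialize (HKb m).
    pose proof (INR_S_ge_1 m).
    replace (INR (S m) ^ S j * y ^ m)
      with (INR (S m) * (y / v) ^ m * (INR (S m) ^ j * v ^ m)).
    + apply Rmult_le_compat; [| |exact HKb|exact HM].
      * apply Rmult_le_pos; [lra|apply pow_le; lra].
      * apply Rmult_le_pos; apply pow_le; lra.
    + rewrite pow_div by lra. rewrite <- tech_pow_Rmult. field. apply pow_nonzero. lra.
Qed.

Lemma pow_le_fact y : 0 <= y -> exists M, 0 < M /\ forall m, y ^ m <= M * INR (fact m).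
Proof.
  intros Hy. destruct (exists_nat_ge y) as [J HJ].
  destruct (geometric_bound (fun m => y ^ m / INR (fact m)) 1 J) as (M & HM & H); [lra| |].
  - intros m Hm. apply le_INR in Hm. rewrite Rmult_1_l.
    change (fact (S m)) with (S m * fact m)%nat. rewrite mult_INR. simpl pow.
    pose proof (INR_fact_lt_0 m) as HF. pose proof (INR_S_ge_1 m) as HS.
    pose proof (pow_le y m Hy) as Hp. rewrite S_INR in *.
    apply Rmult_le_reg_r with ((INR m + 1) * INR (fact m)); [nra|].
    replace (y * y ^ m / ((INR m + 1) * INR (fact m)) * ((INR m + 1) * INR (fact m)))
      with (y * y ^ m) by (field; lra).
    replace (y ^ m / INR (fact m) * ((INR m + 1) * INR (fact m)))
      with ((INR m + 1) * y ^ m) by (field; lra).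
    apply Rmult_le_compat_r; lra.
  - exists M. split; [exact HM|]. intros m. specialize (H m). rewrite pow1, Rmult_1_r in H.
    pose proof (INR_fact_lt_0 m) as HF.
    replace (y ^ m) with (y ^ m / INR (fact m) * INR (fact m)) by (field; lra).
    apply Rmult_le_compat_r; lra.
Qed.

(** m + 1 <= 2^m reduces the polynomial factor to a change of base from y to 2^j y. *)
Lemma poly_pow_le_fact j y :
  0 <= y -> exists M, 0 < M /\ forall m, INR (S m) ^ j * y ^ m <= M * INR (fact m).
Proof.
  intros Hy. destruct (pow_le_fact (2 ^ j * y)) as (M & HM & H).
  { apply Rmult_le_pos; [apply pow_le; lra|exact Hy]. }
  exists M. split; [exact HM|]. intros m. eapply Rle_trans; [|apply H].
  rewrite Rpow_mult_distr. apply Rmult_le_compat_r; [now apply pow_le|].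
  rewrite <- pow_mult, Nat.mul_comm, pow_mult. apply pow_incr.
  split; [apply pos_INR|].
  clear. induction m; [simpl; lra|].
  rewrite S_INR. simpl pow. pose proof (pow_R1_Rle 2 m). lra.
Qed.

Lemma INR_fact_ge_1 m : 1 <= INR (fact m).
Proof. apply (le_INR 1). apply lt_O_fact. Qed.

(* Up to powers of [m], the general term is [(m!) ^ (P - Q) * z ^ m]: this decays
   geometrically, or is bounded below by a constant. *)
Lemma fact_growth_ratio_decay X Y P Q z :
  fact_growth P X -> fact_growth Q Y -> 0 < z ->
  (forall k, exists M, forall m, INR (S m) ^ k * (X m / Y m * z ^ m) <= M) ->
  exists q M, 1 < q /\ forall m, X m / Y m * z ^ m * q ^ m <= M.
Proof.
  intros HX HY Hz Hdec.
  destruct (fact_growth_pos P X HX) as [nX HXp].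
  destruct (fact_growth_pos Q Y HY) as [nY HYp].
  destruct HX as (K & k & n0 & HK & HX), HY as (L & l & n1 & HL & HY).
  set (n2 := max (max n0 n1) (max nX nY)).
  set (b := fun m => X m / Y m * z ^ m).
  assert (HKL : 0 < K * L) by now apply Rmult_lt_0_compat.
  assert (Hlow : forall m, (n2 <= m)%nat ->
    z ^ m * INR (fact m) ^ P <= K * L * INR (S m) ^ (k + l) * b m * INR (fact m) ^ Q).
  { intros m Hm. destruct (HX m ltac:(lia)) as [X1 X2], (HY m ltac:(lia)) as [Y1 Y2].
    specialize (HXp m ltac:(lia)). specialize (HYp m ltac:(lia)).
    pose proof (pow_lt z m Hz) as Hzm. unfold b. rewrite pow_add.
    pose proof (INR_S_ge_1 m) as HS.
    pose proof (pow_lt (INR (S m)) k ltac:(lra)) as Hsk.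
    apply Rle_trans with (z ^ m * (K * INR (S m) ^ k * X m)).
    - apply Rmult_le_compat_l; lra.
    - replace (K * L * (INR (S m) ^ k * INR (S m) ^ l) * (X m / Y m * z ^ m) * INR (fact m) ^ Q)
        with (z ^ m * (K * INR (S m) ^ k * X m)
          * (L * INR (S m) ^ l * INR (fact m) ^ Q * / Y m)) by (field; lra).
      rewrite <- (Rmult_1_r (z ^ m * (K * INR (S m) ^ k * X m))) at 1.
      apply Rmult_le_compat_l.
      + apply Rmult_le_pos; [lra|]. apply Rmult_le_pos; [apply Rmult_le_pos; lra|lra].
      + apply Rmult_le_reg_r with (Y m); [exact HYp|].
        rewrite Rmult_1_l, Rmult_assoc, Rinv_l by lra. rewrite Rmult_1_r. exact Y2. }
  assert (Hup : forall m, (n2 <= m)%nat ->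
    b m * INR (fact m) ^ Q <= K * L * INR (S m) ^ (k + l) * z ^ m * INR (fact m) ^ P).
  { intros m Hm. destruct (HX m ltac:(lia)) as [X1 X2], (HY m ltac:(lia)) as [Y1 Y2].
    specialize (HXp m ltac:(lia)). specialize (HYp m ltac:(lia)).
    pose proof (pow_lt z m Hz) as Hzm. unfold b. rewrite pow_add.
    apply Rle_trans with (X m / Y m * z ^ m * (L * INR (S m) ^ l * Y m)).
    - apply Rmult_le_compat_l; [|exact Y1].
      apply Rmult_le_pos; [|lra]. apply Rmult_le_pos; [lra|]. left. now apply Rinv_0_lt_compat.
    - replace (X m / Y m * z ^ m * (L * INR (S m) ^ l * Y m))
        with (z ^ m * (L * INR (S m) ^ l) * X m) by (field; lra).
      replace (K * L * (INR (S m) ^ k * INR (S m) ^ l) * z ^ m * INR (fact m) ^ P)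
        with (z ^ m * (L * INR (S m) ^ l) * (K * INR (S m) ^ k * INR (fact m) ^ P)) by ring.
      apply Rmult_le_compat_l; [|exact X2].
      apply Rmult_le_pos; [lra|]. apply Rmult_le_pos; [lra|]. apply pow_le, pos_INR. }
  (* If (m!)^(P-Q) z^m stays above c, then so does the term times K L (m + 1)^(k+l); decay with
     exponent k + l + 1, one more than this, is contradictory. *)
  assert (Hcontra : forall c, 0 < c ->
    (forall m, c * INR (fact m) ^ Q <= z ^ m * INR (fact m) ^ P) -> False).
  { intros c Hc H. destruct (Hdec (S (k + l))) as [M HM].
    destruct (exists_nat_ge (K * L * M / c)) as [n3 Hn3].
    set (m := max n2 n3).
    specialize (Hlow m ltac:(lia)). specialize (H m). specialize (HM m).
    fold (b m) in HM.
    assert (Hm : INR n3 <= INR m) by (apply le_INR; lia).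
    pose proof (pow_lt _ Q (INR_fact_lt_0 m)) as HF.
    assert (H1 : c <= K * L * INR (S m) ^ (k + l) * b m).
    { apply Rmult_le_reg_r with (INR (fact m) ^ Q); [exact HF|]. lra. }
    pose proof (INR_S_ge_1 m) as HS.
    assert (H2 : c * INR (S m) <= K * L * M).
    { apply Rle_trans with (K * L * INR (S m) ^ (k + l) * b m * INR (S m)).
      - apply Rmult_le_compat_r; lra.
      - replace (K * L * INR (S m) ^ (k + l) * b m * INR (S m))
          with (K * L * (INR (S m) ^ S (k + l) * b m)) by (rewrite <- tech_pow_Rmult; ring).
        apply Rmult_le_compat_l; lra. }
    assert (H3 : K * L * M / c * c <= INR m * c) by (apply Rmult_le_compat_r; lra).
    replace (K * L * M / c * c) with (K * L * M) in H3 by (field; lra).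
    rewrite S_INR in H2. nra. }
  assert (Hgood : forall q c, 1 < q ->
    (forall m, INR (S m) ^ (k + l) * (z * q) ^ m * INR (fact m) ^ P <= c * INR (fact m) ^ Q) ->
    exists q M, 1 < q /\ forall m, X m / Y m * z ^ m * q ^ m <= M).
  { intros q c Hq H.
    destruct (eventually_bounded (fun m => X m / Y m * z ^ m * q ^ m) (K * L * c) n2)
      as [M HM].
    - intros m Hm. fold (b m). specialize (Hup m Hm). specialize (H m).
      pose proof (pow_lt _ Q (INR_fact_lt_0 m)) as HF.
      pose proof (pow_lt q m ltac:(lra)) as Hqm.
      apply Rmult_le_reg_r with (INR (fact m) ^ Q); [exact HF|].
      apply Rle_trans with (K * L * INR (S m) ^ (k + l) * z ^ m * INR (fact m) ^ P * q ^ m).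
      + replace (b m * q ^ m * INR (fact m) ^ Q) with (b m * INR (fact m) ^ Q * q ^ m) by ring.
        apply Rmult_le_compat_r; lra.
      + rewrite Rpow_mult_distr in H.
        replace (K * L * INR (S m) ^ (k + l) * z ^ m * INR (fact m) ^ P * q ^ m)
          with (K * L * (INR (S m) ^ (k + l) * (z ^ m * q ^ m) * INR (fact m) ^ P)) by ring.
        rewrite (Rmult_assoc (K * L)). apply Rmult_le_compat_l; lra.
    - exists q, M. split; [exact Hq|exact HM]. }
  (* For P < Q the factorial gives decay for every z, for P = Q decay holds exactly when z < 1, and
     for P > Q the terms grow. *)
  destruct (lt_eq_lt_dec P Q) as [[HPQ|HPQ]|HPQ].
  - destruct (poly_pow_le_fact (k + l) (z * 2)) as (M & HM & H); [lra|].
    apply (Hgood 2 M); [lra|]. intros m. specialize (H m).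
    pose proof (INR_fact_ge_1 m) as HF.
    apply Rle_trans with (M * INR (fact m) * INR (fact m) ^ P).
    + apply Rmult_le_compat_r; [apply pow_le; lra|exact H].
    + rewrite Rmult_assoc. apply Rmult_le_compat_l; [lra|].
      change (INR (fact m) * INR (fact m) ^ P) with (INR (fact m) ^ S P).
      apply Rle_pow; [exact HF|lia].
  - subst Q. destruct (Rlt_le_dec z 1) as [Hz1|Hz1].
    (* q is taken as the midpoint of 1 and 1 / z, so that z q = (z + 1) / 2 < 1. *)
    + assert (Hi : 1 < / z) by (rewrite <- Rinv_1; apply Rinv_lt_contravar; lra).
      destruct (poly_geometric_bounded (k + l) (z * ((1 + / z) / 2))) as [M HM].
      { replace (z * ((1 + / z) / 2)) with ((z + 1) / 2) by (field; lra). lra. }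
      apply (Hgood ((1 + / z) / 2) M); [lra|]. intros m.
      apply Rmult_le_compat_r; [apply pow_le; pose proof (INR_fact_ge_1 m); lra|apply HM].
    + exfalso. apply (Hcontra 1); [lra|]. intros m. apply Rmult_le_compat_r.
      * apply pow_le. pose proof (INR_fact_ge_1 m). lra.
      * now apply pow_R1_Rle.
  - exfalso. destruct (pow_le_fact (/ z)) as (M & HM & H).
    { left. now apply Rinv_0_lt_compat. }
    apply (Hcontra (/ M)); [now apply Rinv_0_lt_compat|]. intros m. specialize (H m).
    pose proof (INR_fact_ge_1 m) as HF. pose proof (pow_lt z m Hz) as Hzm.
    assert (Hone : / M <= z ^ m * INR (fact m)).
    { rewrite pow_inv in H. apply Rmult_le_reg_l with (M * / z ^ m).
      - apply Rmult_lt_0_compat; [lra|]. now apply Rinv_0_lt_compat.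
      - replace (M * / z ^ m * / M) with (/ z ^ m) by (field; lra).
        replace (M * / z ^ m * (z ^ m * INR (fact m))) with (M * INR (fact m)) by (field; lra).
        exact H. }
    apply Rle_trans with (z ^ m * INR (fact m) * INR (fact m) ^ Q).
    + apply Rmult_le_compat_r; [apply pow_le; lra|exact Hone].
    + rewrite Rmult_assoc. apply Rmult_le_compat_l; [lra|].
      change (INR (fact m) * INR (fact m) ^ Q) with (INR (fact m) ^ S Q).
      apply Rle_pow; [exact HF|lia].
Qed.

(** * The hypergeometric terms and the conclusion *)

Local Open Scope C_scope.

Lemma fold_right_Cmult_app (l1 l2 : list C) :
  fold_right Cmult 1 (l1 ++ l2) = fold_right Cmult 1 l1 * fold_right Cmult 1 l2.
Proof. induction l1; simpl; [ring|]. rewrite IHl1. ring. Qed.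

Lemma fold_right_Cmult_map_mult (f g : nat -> C) (l : list nat) :
  fold_right Cmult 1 (map (fun j => f j * g j) l)
  = fold_right Cmult 1 (map f l) * fold_right Cmult 1 (map g l).
Proof. induction l; simpl; [ring|]. rewrite IHl. ring. Qed.

Lemma prod_shifts (a d : C) (n : nat) :
  d <> 0 ->
  fold_right Cmult 1 (map (fun j => (a + natC j) * / d) (seq 0 n)) = poch a n * / Cpow d n.
Proof.
  intros Hd. induction n.
  - simpl. field.
  - rewrite seq_S, map_app, fold_right_Cmult_app, IHn, Cpow_S. simpl.
    field. split; [now apply Cpow_nz|exact Hd].
Qed.

(** The multiplication formula for Pochhammer symbols: raising m by one adds the N factors (lambda +
    N m + j) / N, which continue (lambda)_(N m) without a gap. *)
Lemma poch_prod_Delta (N : nat) (lambda : C) (m : nat) :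
  (1 <= N)%nat ->
  poch_prod (Delta_array N lambda) m = poch lambda (N * m) * / Cpow (natC N) (N * m).
Proof.
  intros HN. assert (HNC : natC N <> 0) by (apply natC_neq0; lia).
  unfold poch_prod, Delta_array. rewrite map_map.
  induction m.
  - rewrite Nat.mul_0_r. simpl.
    replace (fold_right Cmult 1 (map (fun _ : nat => RtoC 1) (seq 0 N))) with (RtoC 1).
    + field.
    + generalize (seq 0 N). intros l. induction l; simpl; [reflexivity|]. rewrite <- IHl. ring.
  - simpl poch. rewrite fold_right_Cmult_map_mult, IHm.
    replace (map (fun j => (lambda + natC j) / natC N + natC m) (seq 0 N))
      with (map (fun j => (lambda + natC (N * m) + natC j) * / natC N) (seq 0 N)).
    + rewrite prod_shifts, Nat.mul_succ_r, poch_add, Cpow_add_r by exact HNC.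
      field. split; now apply Cpow_nz.
    + apply map_ext. intros j. rewrite natC_mult. field. exact HNC.
Qed.

(** Both sides carry the same power of N; what remains is (lambda)_(n + N m) split in two ways. *)
Lemma hypGamma_term_shift N lambda alpha1 x p alpha beta z n m :
  (1 <= N)%nat ->
  poch lambda n * hypGamma_term (Delta_array N (lambda + natC n)) alpha1 x p alpha beta z m
  = hypGamma_term (Delta_array N lambda) alpha1 x p alpha beta z m
    * poch (lambda + natC (N * m)) n.
Proof.
  intros HN. unfold hypGamma_term. rewrite !poch_prod_Delta by exact HN.
  assert (E : poch lambda n * poch (lambda + natC n) (N * m)
    = poch lambda (N * m) * poch (lambda + natC (N * m)) n).
  { rewrite <- !poch_add. f_equal. lia. }
  unfold Cdiv.
  match goal with |- _ * (_ * ?c * ?i * ?a * ?b * ?zz) = _ =>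
    transitivity (poch lambda n * poch (lambda + natC n) (N * m) * (c * i * a * b * zz));
    [ring|rewrite E; ring] end.
Qed.

Lemma hypGamma_term_scale a alpha1 x p alpha beta (z v : C) N m :
  v <> 0 ->
  hypGamma_term a alpha1 x p alpha beta (z / Cpow v N) m
  = hypGamma_term a alpha1 x p alpha beta z m / Cpow v (N * m).
Proof.
  intros Hv. unfold hypGamma_term. unfold Cdiv.
  rewrite Cpow_mult_l, Cpow_inv by (now apply Cpow_nz).
  rewrite Cpow_mult_r. ring.
Qed.

Lemma poch_nonpos_int_eventually_0 a :
  nonpos_int a -> exists n0, forall n, (n0 <= n)%nat -> poch a n = 0.
Proof.
  intros [k ->]. exists (S k). intros n Hn. induction Hn.
  - simpl. ring.
  - simpl. rewrite IHHn. ring.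
Qed.

Lemma poch_prod_eventually_0 l a :
  In a l -> nonpos_int a -> exists n0, forall n, (n0 <= n)%nat -> poch_prod l n = 0.
Proof.
  intros Hin Ha. destruct (poch_nonpos_int_eventually_0 a Ha) as [n0 H].
  exists n0. intros n Hn. specialize (H n Hn). unfold poch_prod.
  induction l as [|c l IH]; [destruct Hin|]. simpl. destruct Hin as [->|Hin].
  - rewrite H. ring.
  - rewrite IH by exact Hin. ring.
Qed.

Lemma fact_growth_poch_prod l :
  (forall a, In a l -> ~ nonpos_int a) ->
  fact_growth (length l) (fun m => Cmod (poch_prod l m)).
Proof.
  induction l as [|a l IH]; intros H.
  - apply (fact_growth_ext 0 (fun _ => 1%R)); [|apply fact_growth_const; lra].
    intros n. unfold poch_prod. simpl. now rewrite Cmod_1.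
  - apply (fact_growth_ext (1 + length l) (fun m => Cmod (poch a m) * Cmod (poch_prod l m))%R).
    + intros n. unfold poch_prod. simpl. now rewrite Cmod_mult.
    + apply fact_growth_mult; [apply fact_growth_poch, H; now left|].
      apply IH. intros c Hc. apply H. now right.
Qed.

Lemma Delta_array_nonpos_int N lambda :
  (1 <= N)%nat -> nonpos_int lambda -> exists a, In a (Delta_array N lambda) /\ nonpos_int a.
Proof.
  (* The residue of k modulo N selects the entry that is minus the integer quotient of k by N. *)
  intros HN [k ->]. exists ((- natC k + natC (k mod N)) / natC N). split.
  - unfold Delta_array. apply in_map_iff. exists (k mod N). split; [reflexivity|].
    apply in_seq. pose proof (Nat.mod_upper_bound k N). lia.
  - exists (k / N)%nat.
    assert (HNC : natC N <> 0) by (apply natC_neq0; lia).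
    pose proof (Nat.div_mod_eq k N) as E.
    assert (E2 : natC k = natC N * natC (k / N) + natC (k mod N)).
    { rewrite <- natC_mult, <- natC_plus. now f_equal. }
    rewrite E2. field. exact HNC.
Qed.

Lemma Cinv_0 : / (RtoC 0) = 0.
Proof. unfold Cinv. simpl. apply injective_projections; simpl; unfold Rdiv; ring. Qed.

(** The inverse of 0 is 0, so a nonzero value of [rGamma] also excludes a zero of [CGamma]. *)
Lemma rGamma_neq0 a : rGamma a <> 0 -> ~ nonpos_int a /\ CGamma a <> 0.
Proof.
  unfold rGamma. destruct (excluded_middle_informative (nonpos_int a)) as [H|H].
  - intros Hr. now destruct Hr.
  - intros Hr. split; [exact H|]. intros E. apply Hr. rewrite E. apply Cinv_0.
Qed.

(** Every factor has modulus at least m - |lambda|, which is at least (m + 1) / 2 in this range.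
    Thus the n-th inner series controls m^n times the coefficient B_m. *)
Lemma poch_large lambda N n m :
  (1 <= N)%nat -> (2 * Cmod lambda + 1 <= INR m)%R ->
  ((INR (S m) / 2) ^ n <= Cmod (poch (lambda + natC (N * m)) n))%R.
Proof.
  intros HN Hm. induction n; [simpl; rewrite Cmod_1; lra|].
  rewrite Cmod_poch_S, <- tech_pow_Rmult, Rmult_comm.
  pose proof (INR_S_ge_1 m).
  apply Rmult_le_compat; [apply pow_le; lra|lra|exact IHn|].
  rewrite <- Cplus_assoc, <- natC_plus.
  pose proof (Cmod_triangle (lambda + natC (N * m + n)) (- lambda)) as T.
  replace (lambda + natC (N * m + n) + - lambda) with (natC (N * m + n)) in T by ring.
  rewrite Cmod_natC, Cmod_opp in T.
  assert (INR m <= INR (N * m + n))%R by (apply le_INR; nia).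
  rewrite S_INR. lra.
Qed.

Lemma hypGamma_term_decay N lambda alpha1 x p alpha beta z :
  (1 <= N)%nat -> (forall b, In b beta -> ~ nonpos_int b) -> (0 <= x)%R -> (0 <= p)%R ->
  (forall n, ex_hypGamma (Delta_array N (lambda + natC n)) alpha1 x p alpha beta z) ->
  exists q M, (1 < q)%R /\ forall m,
    (Cmod (hypGamma_term (Delta_array N lambda) alpha1 x p alpha beta z m) * q ^ m <= M)%R.
Proof.
  intros HN Hbeta Hx Hp Hex.
  set (B := hypGamma_term (Delta_array N lambda) alpha1 x p alpha beta z).
  (* Terminating series are split off first, since the two-sided growth estimates require nonzero
     factors. *)
  assert (Hzero : (exists n0, forall m, (n0 <= m)%nat -> B m = 0) ->
    exists q M, (1 < q)%R /\ forall m, (Cmod (B m) * q ^ m <= M)%R).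
  { intros [n0 H]. destruct (eventually_bounded (fun m => Cmod (B m) * 2 ^ m)%R 0 n0) as [M HM].
    - intros m Hm. rewrite H, Cmod_0 by exact Hm. lra.
    - exists 2%R, M. split; [lra|exact HM]. }
  destruct (classic (exists a, In a (Delta_array N lambda) /\ nonpos_int a)) as [(a & Ha & Hna)|HD].
  { apply Hzero. destruct (poch_prod_eventually_0 _ a Ha Hna) as [n0 H]. exists n0.
    intros m Hm. unfold B, hypGamma_term. rewrite H by exact Hm. unfold Cdiv. ring. }
  destruct (classic (exists a, In a alpha /\ nonpos_int a)) as [(a & Ha & Hna)|HA].
  { apply Hzero. destruct (poch_prod_eventually_0 _ a Ha Hna) as [n0 H]. exists n0.
    intros m Hm. unfold B, hypGamma_term. rewrite H by exact Hm. unfold Cdiv. ring. }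
  destruct (Ceq_dec z 0) as [Hz|Hz].
  { apply Hzero. exists 1%nat. intros m Hm. unfold B, hypGamma_term. rewrite Hz.
    destruct m; [lia|]. rewrite Cpow_S. unfold Cdiv. ring. }
  destruct (Ceq_dec (rGamma alpha1) 0) as [Hr|Hr].
  { apply Hzero. exists 0%nat. intros m _. unfold B, hypGamma_term, ipoch. rewrite Hr.
    unfold Cdiv. ring. }
  destruct (rGamma_neq0 _ Hr) as [Ha1 HG1].
  assert (Hlam : ~ nonpos_int lambda).
  { intros H. apply HD. now apply Delta_array_nonpos_int. }
  pose (X := fun m => (Cmod (poch_prod (Delta_array N lambda) m)
    * (Cmod (iGamma (alpha1 + natC m) x p) * Cmod (rGamma alpha1))
    * Cmod (poch_prod alpha m))%R).
  pose (Y := fun m => (Cmod (poch_prod beta m) * INR (fact m))%R).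
  assert (HX : fact_growth (length (Delta_array N lambda) + (1 + 0) + length alpha) X).
  { apply fact_growth_mult; [apply fact_growth_mult|].
    - apply fact_growth_poch_prod. intros a Ha Hn. apply HD. now exists a.
    - apply fact_growth_mult; [now apply fact_growth_iGamma|].
      apply fact_growth_const. now apply Cmod_gt_0.
    - apply fact_growth_poch_prod. intros a Ha Hn. apply HA. now exists a. }
  assert (HY : fact_growth (length beta + 1) Y).
  { apply fact_growth_mult; [now apply fact_growth_poch_prod|apply fact_growth_fact]. }
  assert (Hb0 : forall m, poch_prod beta m <> 0).
  { intros m. unfold poch_prod. clear - Hbeta. induction beta as [|b l IH]; simpl.
    - intros E. apply RtoC_inj in E. lra.
    - apply Cmult_neq_0; [apply poch_neq0, Hbeta; now left|].
      apply IH. intros c Hc. apply Hbeta. now right. }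
  assert (EB : forall m, Cmod (B m) = (X m / Y m * Cmod z ^ m)%R).
  { intros m. unfold B, hypGamma_term, X, Y, ipoch.
    rewrite Cmod_mult, !Cmod_div by (apply Hb0 || apply natC_fact_neq0).
    rewrite !Cmod_mult, Cmod_natC, Cmod_pow. field.
    split; [apply INR_fact_neq_0|]. apply Rgt_not_eq. apply Cmod_gt_0, Hb0. }
  destruct (fact_growth_ratio_decay X Y _ _ (Cmod z) HX HY) as (q & M & Hq & HM).
  - now apply Cmod_gt_0.
  (* The terms of the n-th inner series, times (lambda)_n, are B_m (lambda + N m)_n; their
     boundedness gives decay of order n for B_m. *)
  - intros n. destruct (ex_series_bounded _ (Hex n)) as (M & HM & Hbd).
    destruct (exists_nat_ge (2 * Cmod lambda + 1)) as [n0 Hn0].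
    apply (eventually_bounded (fun m => INR (S m) ^ n * (X m / Y m * Cmod z ^ m))%R
      (2 ^ n * (Cmod (poch lambda n) * M))%R n0).
    intros m Hm. rewrite <- EB. apply le_INR in Hm.
    pose proof (poch_large lambda N n m HN ltac:(lra)) as HL.
    pose proof (f_equal Cmod (hypGamma_term_shift N lambda alpha1 x p alpha beta z n m HN)) as E.
    rewrite !Cmod_mult in E. fold B in E.
    replace (INR (S m)) with (2 * (INR (S m) / 2))%R by field.
    rewrite Rpow_mult_distr, Rmult_assoc.
    apply Rmult_le_compat_l; [apply pow_le; lra|].
    apply Rle_trans with (Cmod (B m) * Cmod (poch (lambda + natC (N * m)) n))%R.
    + rewrite Rmult_comm. apply Rmult_le_compat_l; [apply Cmod_ge_0|exact HL].
    + rewrite <- E. apply Rmult_le_compat_l; [apply Cmod_ge_0|apply Hbd].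
  - exists q, M. split; [exact Hq|]. intros m. rewrite EB. apply HM.
Qed.

Theorem theorem4 :
  forall (alpha1 : C) (alpha beta : list C) (x p : R) (t lambda : C) (N : nat)
    (z : C),
    (forall b : C, In b beta -> ~ nonpos_int b) ->
    (0 <= x)%R -> (0 <= p)%R ->
    (p = 0%R -> x = 0%R -> (0 < Re alpha1)%R) ->
    (Cmod t < 1)%R ->
    (1 <= N)%nat ->
    let lhs_term (n : nat) : C :=
      poch lambda n / natC (fact n)
      * hypGamma (Delta_array N (lambda + natC n)) alpha1 x p alpha beta z
      * Cpow t n in
    let w : C := z / Cpow (1 - t) N in
    (forall n : nat,
       ex_hypGamma (Delta_array N (lambda + natC n)) alpha1 x p alpha beta z) ->
    ex_series lhs_term ->
    ex_hypGamma (Delta_array N lambda) alpha1 x p alpha beta w ->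
    CSeries lhs_term
    = Cpower (1 - t) (- lambda)
      * hypGamma (Delta_array N lambda) alpha1 x p alpha beta w.
Proof.
  intros alpha1 alpha beta x p t lambda N z Hbeta Hx Hp _ Ht HN lhs_term w Hin Hout Hw.
  set (B := hypGamma_term (Delta_array N lambda) alpha1 x p alpha beta z).
  (* The n-th derivative at 0 of the function on the right; the factor (lambda)_n of the left-hand
     side is absorbed in it. *)
  pose (e := fun n => CSeries (fun m => B m * poch (lambda + natC (N * m)) n)).
  assert (He : forall n, e n = poch lambda n
    * hypGamma (Delta_array N (lambda + natC n)) alpha1 x p alpha beta z).
  { intros n. apply CSeries_unique.
    eapply is_series_cext; [|apply is_series_cmult_l, CSeries_correct, (Hin n)].
    intros m. cbv beta. now apply hypGamma_term_shift. }
  assert (El : lhs_term = (fun n => e n * divpow t n)).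
  { apply functional_extensionality. intros n. unfold lhs_term, divpow. rewrite He.
    unfold Cdiv. ring. }
  assert (Ew : hypGamma_term (Delta_array N lambda) alpha1 x p alpha beta w
    = (fun m => B m / Cpow (1 - t) (N * m))).
  { apply functional_extensionality. intros m. apply hypGamma_term_scale.
    now apply Cneq0_Re, Re_1_minus_pos. }
  destruct (hypGamma_term_decay N lambda alpha1 x p alpha beta z HN Hbeta Hx Hp Hin)
    as (q & M & Hq & HM).
  unfold hypGamma, ex_hypGamma in *. rewrite Ew in Hw |- *. rewrite El in Hout |- *.
  apply resummation with q M; auto.
Qed.
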